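(* Let $K$ be a field with $\operatorname{char}(K)=0$, $S=K[x_1,\ldots,x_n]$ the standard graded polynomial ring, $I\subsetneq S$ a componentwise linear (graded) ideal, $R=S/I$ and $c=\operatorname{codim}(R)$. Then $$e(R)\leq \frac{1}{c!}\prod_{i=1}^{c} M_i,$$ where $M_i=\max\{j\in\mathbb{Z} : \beta^S_{i,j}(R)\neq 0\}$.
   Context: $S=K[x_1,\ldots,x_n]$ is graded by $\deg(x_i)=1$. For a finitely generated graded $S$-module $M$, $\beta^S_{i,j}(M)=\dim_K \operatorname{Tor}^S_i(M,K)_j$ are the graded Betti numbers; $M_i$ is defined for $1\le i\le \operatorname{projdim}(R)$, and $c\le\operatorname{projdim}(R)$. For a graded ideal $I$ and $d\geq 0$, $I_{\langle d\rangle}\subseteq I$ is the ideal generated by all homogeneous elements of degree $d$ in $I$. A graded ideal $J$ has a $d$-linear resolution if $\beta^S_{i,i+j}(J)=0$ for all $i$ and all $j\neq d$ (the zero ideal satisfies this trivially). A graded ideal $I$ is componentwise linear if for all $d\geq 0$ the ideal $I_{\langle d\rangle}$ has a $d$-linear resolution. $e(R)$ denotes the multiplicity of $R$: if $\delta=\dim R>0$, it is $(\delta-1)!$ times the leading coefficient of the Hilbert polynomial of $R$ (which has degree $\delta-1$); if $\dim R=0$, it is $\dim_K R$. The codimension is $\operatorname{codim}(R)=n-\dim(R)$. *)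

(* Defs.v *)
From Stdlib Require Import ClassicalEpsilon.
From HB Require Import structures.
From mathcomp Require Import all_boot all_order all_algebra.
From mathcomp.multinomials Require Import mpoly.

Set Implicit Arguments.
Unset Strict Implicit.
Unset Printing Implicit Defensive.

Import Order.TTheory GRing.Theory Num.Theory.
Local Open Scope ring_scope.

Definition is_greatest d (T : porderType d) (P : T -> Prop) (m : T) : Prop :=
  P m /\ forall x, P x -> (x <= m)%O.

(* Unspecified value when [P] has no greatest element; [x0] only witnesses that
   [T] is inhabited. *)
Definition greatest d (T : porderType d) (x0 : T) (P : T -> Prop) : T :=
  epsilon (inhabits x0) (is_greatest P).

(* [P 0 < P 1 < ... < P l] is a strictly increasing chain of prime ideals;
   [idealr_closed] includes [1 \notin P i]. *)
Definition prime_chain (A : comNzRingType) (l : nat) (P : nat -> {pred A}) : Prop :=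
  (forall i, (i <= l)%N -> idealr_closed (P i) /\ prime_idealr_closed (P i)) /\
  (forall i, (i < l)%N ->
     {subset P i <= P i.+1} /\ exists2 a, a \in P i.+1 & a \notin P i).

Definition krull_dim (A : comNzRingType) : nat :=
  greatest 0%N (fun l : nat => exists P : nat -> {pred A}, prime_chain l P).

Section GradedModules.
Variables (K : fieldType) (n : nat).
Local Notation S := {mpoly K[n]}.

Definition graded_ideal (I : {pred S}) : Prop :=
  forall p d, p \in I -> pihomog mdeg d p \in I.

(* Homogeneous of integer degree [e]; only 0 is so when [e < 0]. *)
Definition zhomog (e : int) (p : S) : Prop :=
  {in msupp p, forall m, (mdeg m)%:Z = e}.

(* The vectors [b k] represent a K-basis of the image of [P] in [S / N], for
   K-subspaces [P] and [N] of [S]. *)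
Definition basis_mod (P N : S -> Prop) (h : nat) (b : 'I_h -> S) : Prop :=
  [/\ forall k, P (b k),
      forall a : 'I_h -> K, N (\sum_k a k *: b k) -> forall k, a k = 0
    & forall p, P p -> exists a : 'I_h -> K, N (p - \sum_k a k *: b k)].

(* Meaningful when the image of [P] in [S / N] is finite-dimensional. *)
Definition dim_mod (P N : S -> Prop) : nat :=
  epsilon (inhabits 0%N) (fun h => exists b : 'I_h -> S, basis_mod P N b).

Definition hilbert_fun (I : {pred S}) (d : nat) : nat :=
  dim_mod (fun p => p \is d.-homog) (fun p => p \in I).

Definition hilbert_poly (I : {pred S}) : {poly rat} :=
  epsilon (inhabits 0) (fun P : {poly rat} =>
    exists d0 : nat, forall d, (d0 <= d)%N -> P.[d%:R] = (hilbert_fun I d)%:R).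

(* The graded module [top / bot], for graded ideals [bot] and [top] of [S]
   (possibly [top = S]) with [bot] contained in [top]. *)
Record subquotient := Subquotient { top : S -> Prop; bot : S -> Prop }.

(* A complex of graded free modules F_i = \bigoplus_k S(- fdeg i k), with
   k < rk i.  Elements of F_i are row vectors, [diff i] is the matrix of the
   differential F_{i+1} -> F_i (acting by right multiplication) and [aug] gives
   representatives in [S] of the images of the basis of F_0. *)
Record free_complex := FreeComplex {
  rk : nat -> nat;
  fdeg : forall i, 'I_(rk i) -> int;
  diff : forall i, 'M[S]_(rk i.+1, rk i);
  aug : 'cV[S]_(rk 0)
}.

Definition free_complex0 : free_complex :=
  @FreeComplex (fun=> 0%N) (fun _ _ => 0) (fun=> 0) 0.

Definition homogeneous_maps (F : free_complex) : Prop :=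
  (forall k, zhomog (@fdeg F 0 k) (aug F k 0)) /\
  (forall i k l, zhomog (@fdeg F i.+1 k - @fdeg F i l) (diff F i k l)).

(* ... -> F_1 -> F_0 -> top M / bot M -> 0 is exact. *)
Definition exact_augmented (F : free_complex) (M : subquotient) : Prop :=
  [/\ forall k, top M (aug F k 0),
      forall p, top M p -> exists v : 'rV_(rk F 0), bot M (p - (v *m aug F) 0 0),
      forall v : 'rV_(rk F 0),
        bot M ((v *m aug F) 0 0) <-> exists w, v = w *m diff F 0
    & forall i (v : 'rV_(rk F i.+1)),
        v *m diff F i = 0 <-> exists w, v = w *m diff F i.+1].

Definition free_resolution (M : subquotient) (F : free_complex) : Prop :=
  homogeneous_maps F /\ exact_augmented F M.

(* Here K = S / (x_1, ..., x_n), so that tensoring with K sends a matrix over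
   [S] to the matrix of its constant terms. *)
Definition diffK (F : free_complex) (i : nat) : 'M[K]_(rk F i.+1, rk F i) :=
  map_mx (mcoeff 0%MM) (diff F i).

(* The row space of this matrix is the degree [j] part of F_i \otimes_S K. *)
Definition componentK (F : free_complex) (i : nat) (j : int) : 'M[K]_(rk F i) :=
  diag_mx (\row_k (@fdeg F i k == j)%:R).

Definition cyclesK (F : free_complex) (i : nat) (j : int) : 'M[K]_(rk F i) :=
  match i return 'M[K]_(rk F i) with
  | 0 => componentK F 0 j
  | i'.+1 => (componentK F i'.+1 j :&: kermx (diffK F i'))%MS
  end.

Definition boundariesK (F : free_complex) (i : nat) (j : int) :
    'M[K]_(rk F i.+1, rk F i) :=
  componentK F i.+1 j *m diffK F i.

(* dim_K H_i(F \otimes_S K)_j *)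
Definition tor_dim (F : free_complex) (i : nat) (j : int) : nat :=
  (\rank (cyclesK F i j) - \rank (boundariesK F i j))%N.

(* dim_K Tor_i(M, K)_j, computed from some graded free resolution of M by
   finitely generated modules; its value does not depend on the resolution. *)
Definition betti (M : subquotient) (i : nat) (j : int) : nat :=
  tor_dim (epsilon (inhabits free_complex0) (free_resolution M)) i j.

Definition quotient_module (I : {pred S}) : subquotient :=
  Subquotient (fun=> True) (fun p => p \in I).

Definition ideal_module (J : S -> Prop) : subquotient :=
  Subquotient J (fun p => p = 0).

Definition degree_part_ideal (I : {pred S}) (d : nat) : S -> Prop := fun p =>
  exists (h : nat) (a f : 'I_h -> S),
    (forall k, f k \in I /\ f k \is d.-homog) /\ p = \sum_k a k * f k.

Definition has_linear_resolution (J : S -> Prop) (d : int) : Prop :=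
  forall (i : nat) (j : int), j != d -> betti (ideal_module J) i (i%:Z + j) = 0%N.

Definition componentwise_linear (I : {pred S}) : Prop :=
  forall d : nat, has_linear_resolution (degree_part_ideal I d) d%:Z.

Definition max_shift (I : {pred S}) (i : nat) : int :=
  greatest 0 (fun j : int => betti (quotient_module I) i j <> 0%N).

Definition codim (I : idealr S) : nat := (n - krull_dim {ideal_quot I})%N.

Definition multiplicity (I : idealr S) : rat :=
  let delta := krull_dim {ideal_quot I} in
  if delta == 0%N then (dim_mod (fun=> True) (fun p => p \in I))%:R
  else (delta.-1)`!%:R * lead_coef (hilbert_poly I).

End GradedModules.

(* Main.v *)
From Stdlib Require Import Classical ClassicalEpsilon.
From HB Require Import structures.
Require Import Defs.
From mathcomp Require Import all_boot all_order all_algebra.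
From mathcomp Require Import zify ring lra.
From mathcomp.multinomials Require Import mpoly.

(** Let [R = S / I], let [D] be the largest degree of a minimal generator of [I]
    (with [D = 1] for [I = 0]) and [c] the codimension.  The bound follows from
    [e(R) <= 'C(D + c - 1, c)] and [D + i - 1 <= M_i] for [1 <= i <= c], since
    [c! * 'C(D + c - 1, c)] is the product of the numbers [D + i - 1].

    Choose a linear substitution [pi] from [S] onto [S' = K[y_1, ..., y_c]] such
    that [pi I] contains powers of all the variables, with [c] as large as
    possible ([parameters_exist]).  Its kernel is generated by [s = n - c] linear
    forms, and [I] contains no polynomial in these forms: at a point where such a
    polynomial does not vanish, which exists because [K] is infinite, one of the
    forms could be traded for a new variable ([trade_parameter]).  So these forms
    are a linear system of parameters, and [R] is a finite module over the
    polynomial ring in them.  The Hilbert function of [R] therefore grows with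
    exponent [s - 1] ([hilb_ge], [hilb_le]), and [s] is the Krull dimension.  For
    one inequality, each step of a chain of primes raises the order of growth of
    the quotients ([tower_length]); for the other, a graded ideal that is maximal
    among those of a given growth is prime, and adding a variable to a prime
    lowers the growth by at most one ([tower_exists]).  That the Hilbert function
    is eventually polynomial follows by noetherian induction on graded ideals
    ([hilbert_poly_exists]).

    Let [F] be a graded free resolution of [S / J] with [pi J] containing
    [y_1 ^ N, ..., y_c ^ N].  Multiplication by an element of [J] is homotopic to
    0 on [F], and the powers of the [y_i] form a regular sequence in [S'].  Hence
    the cohomology of [Hom(F, S' / (y_1 ^ N, ..., y_k ^ N))] vanishes in degrees
    [i] with [i + k < c] ([cocycle_coboundary]); this is how the vanishing of
    [Ext^i] below the grade enters.  For [J = I], [k = 0] and [F] minimal it gives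
    [M_i < M_(i+1)] for [i < c] ([shift_increases]), and so the lower bounds for
    the [M_i], as [M_1 = D].

    For [i + k = c] only cohomology of low internal degree has to vanish, and it
    does when the generators of [F_c] have degree less than [D + c]
    ([low_cocycle_coboundary]).  For [k = c] this cohomology is the annihilator of
    [pi J] in [S' / (y_1 ^ N, ..., y_c ^ N)], which is dual to [S' / pi J]; so all
    forms of degree at least [D] in [S'] lie in [pi J] ([socle_bound]).  This is
    applied to [J = I_<D>], whose resolution is [D]-linear by hypothesis and which
    agrees with [I] from degree [D] on.  So [R] is generated over the polynomial
    ring in the parameters by the ['C(D + c - 1, c)] monomials of degree less than
    [D] in [c] variables, which bounds the multiplicity.

    Betti numbers are defined by an arbitrary resolution; comparing resolutions
    shows that a minimal one, which exists because [S] is noetherian, computes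
    them by the degrees of its generators ([betti_min]). *)

Set Implicit Arguments.
Unset Strict Implicit.
Unset Printing Implicit Defensive.

Import Order.TTheory GRing.Theory Num.Theory.
Local Open Scope ring_scope.

(** * Noetherian rings *)

Lemma fun_choice (A B : Type) (P : A -> B -> Prop) :
  (forall x, exists y, P x y) -> exists f : A -> B, forall x, P x (f x).
Proof.
move=> h; exists (fun x => sval (constructive_indefinite_description _ (h x))).
by move=> x; case: constructive_indefinite_description.
Qed.

Definition submodule (R : pzRingType) (V : lmodType R) (N : V -> Prop) : Prop :=
  N 0 /\ forall a u v, N u -> N v -> N (a *: u + v).

Section Submodules.
Variables (R : pzRingType) (V : lmodType R) (N : V -> Prop).
Hypothesis subN : submodule N.

Lemma submod0 : N 0. Proof. by case: subN. Qed.

Lemma submodZ a u : N u -> N (a *: u).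
Proof. by move=> Nu; rewrite -[a *: u]addr0; apply: subN.2 => //; apply: submod0. Qed.

Lemma submodD u v : N u -> N v -> N (u + v).
Proof. by move=> Nu Nv; rewrite -[u]scale1r; apply: subN.2. Qed.

Lemma submodN u : N u -> N (- u).
Proof. by move=> Nu; rewrite -scaleN1r; apply: submodZ. Qed.

Lemma submodB u v : N u -> N v -> N (u - v).
Proof. by move=> Nu Nv; apply: submodD => //; apply: submodN. Qed.

Lemma submod_sum (I : Type) (r : seq I) (P : pred I) F :
  (forall i, P i -> N (F i)) -> N (\sum_(i <- r | P i) F i).
Proof. by move=> h; elim/big_ind: _ => //; [apply: submod0 | apply: submodD]. Qed.

End Submodules.

Lemma submod_mulmx (R : pzRingType) (m r : nat) (N : 'rV[R]_r -> Prop)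
    (G : 'M[R]_(m, r)) (w : 'rV_m) :
  submodule N -> (forall k, N (row k G)) -> N (w *m G).
Proof.
by move=> sN h; rewrite mulmx_sum_row; apply: submod_sum => // i _; apply: submodZ.
Qed.

Definition spans_rows (R : pzRingType) (m r : nat) (G : 'M[R]_(m, r))
    (N : 'rV[R]_r -> Prop) : Prop :=
  forall v, N v <-> exists w, v = w *m G.

Lemma spans_rowsP (R : pzRingType) (m r : nat) (G : 'M[R]_(m, r))
    (N : 'rV[R]_r -> Prop) :
  submodule N -> (forall k, N (row k G)) ->
  (forall v, N v -> exists w, v = w *m G) -> spans_rows G N.
Proof. by move=> sN h1 h2 v; split=> [/h2//|[w ->]]; apply: submod_mulmx. Qed.

Lemma spans_rows_row (R : pzRingType) (m r : nat) (G : 'M[R]_(m, r))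
    (N : 'rV[R]_r -> Prop) k : spans_rows G N -> N (row k G).
Proof. by move=> h; apply/h; exists (delta_mx 0 k); rewrite rowE. Qed.

(** Stated for submodules of free modules: the induction on polynomial rings
    below uses free modules of every rank. *)
Definition noetherian (R : pzRingType) : Prop :=
  forall r (N : 'rV[R]_r -> Prop), submodule N ->
  exists m, exists G : 'M[R]_(m, r), spans_rows G N.

Definition ideals_fg (R : pzRingType) : Prop :=
  forall J : R -> Prop, @submodule R R^o J ->
  exists m, exists g : 'I_m -> R, (forall k, J (g k)) /\
    forall x, J x -> exists w : 'I_m -> R, x = \sum_k w k * g k.

(** Induction on the rank: the first coordinates of the vectors of a submodule
    form an ideal, and the vectors with first coordinate 0 a submodule of lower
    rank. *)
Lemma ideals_fg_noetherian (R : pzRingType) : ideals_fg R -> noetherian R.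
Proof.
move=> fgR; elim=> [|r IH].
  move=> N subN; exists 0%N, 0 => v; split=> [_|_].
    by exists 0; rewrite thinmx0 [RHS]thinmx0.
  by rewrite thinmx0; apply: submod0.
rewrite -[r.+1]add1n => N subN.
pose J (x : R) := exists v : 'rV_r, N (row_mx x%:M v : 'rV_(1 + r)).
have [|m [g [Jg gJ]]] := fgR J.
  split; first by exists 0; rewrite raddf0 row_mx0; apply: submod0.
  move=> a x y [u Nu] [v Nv]; exists (a *: u + v).
  have := subN.2 a _ _ Nu Nv.
  by rewrite scale_row_mx add_row_mx scale_scalar_mx -raddfD.
have [L LP] := fun_choice Jg.
pose G := \matrix_k (row_mx (g k)%:M (L k) : 'rV_(1 + r)).
have [|m' [H HP]] := IH (fun v : 'rV_r => N (row_mx 0 v : 'rV_(1 + r))).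
  split; first by rewrite row_mx0; apply: submod0.
  move=> a u v Nu Nv; have := subN.2 a _ _ Nu Nv.
  by rewrite scale_row_mx add_row_mx scaler0 addr0.
exists (m + m')%N, (col_mx G (row_mx 0 H : 'M_(m', 1 + r))).
apply: spans_rowsP => //.
  move=> k; rewrite -[k]splitK; case: (split k) => j /=.
    by rewrite rowKu rowK.
  rewrite rowKd row_row_mx row0; apply: (spans_rows_row j HP).
move=> v; rewrite -[v]hsubmxK; set x := lsubmx v; set u := rsubmx v => Nv.
have [|w wP] := gJ (x 0 0); first by exists u; rewrite -mx11_scalar.
have GE : (\row_k w k) *m G = row_mx x (\sum_k w k *: L k).
  rewrite mulmx_sum_row [x]mx11_scalar wP.
  have -> : (\sum_k w k * g k)%:M = \sum_k w k *: (g k)%:M :> 'M_1.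
    by rewrite raddf_sum; apply: eq_bigr => k _; rewrite scale_scalar_mx.
  elim/big_rec3: _ => [|k y1 y2 y3 _ ->]; first by rewrite row_mx0.
  by rewrite rowK mxE scale_row_mx add_row_mx.
have : N (row_mx 0 (u - \sum_k w k *: L k) : 'rV_(1 + r)).
  have -> : row_mx 0 (u - \sum_k w k *: L k) = row_mx x u - (\row_k w k) *m G.
    by rewrite GE opp_row_mx add_row_mx subrr.
  apply: submodB => //; apply: submod_mulmx => // k; rewrite rowK; exact: LP.
move=> /HP [w' w'E]; exists (row_mx (\row_k w k) w').
by rewrite mul_row_col GE mul_mx_row mulmx0 -w'E add_row_mx addr0 addrC subrK.
Qed.

(** Hilbert's basis theorem.  The leading coefficients of an ideal [J] of
    [R[X]] form an ideal; division by finitely many members of [J] whose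
    leading coefficients generate it brings every member of [J] below some
    fixed size [d], and the members of size at most [d] form a submodule of a
    free module of rank [d]. *)
Lemma ideals_fg_poly (R : comNzRingType) : noetherian R -> ideals_fg {poly R}.
Proof.
move=> noeR J subJ.
have JD := submodD subJ; have JZ := submodZ subJ.
have JM a p : J p -> J (a * p) by exact: JZ.
pose Lc (a : R) (s : nat) := exists p : {poly R}, [/\ J p, (size p <= s.+1)%N & p`_s = a].
pose L (v : 'rV[R]_1) := exists s, Lc (v 0 0) s.
have LcW a s s' : (s <= s')%N -> Lc a s -> Lc a s'.
  move=> le_s [p [Jp sp <-]]; exists (p * 'X^(s' - s)); split.
  - by rewrite mulrC; apply: JM.
  - apply: (leq_trans (size_polyMleq _ _)); rewrite size_polyXn; lia.
  - by rewrite coefMXn ltnNge leq_subr /= subKn.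
have [|m [G GP]] := noeR 1%N L.
  split; first by exists 0%N, 0; split; rewrite ?size_poly0 ?mxE ?coef0 //;
    apply: (submod0 subJ).
  move=> a u v [s1 h1] [s2 h2]; exists (maxn s1 s2).
  have [p1 [Jp1 sp1 e1]] := LcW _ _ _ (leq_maxl s1 s2) h1.
  have [p2 [Jp2 sp2 e2]] := LcW _ _ _ (leq_maxr s1 s2) h2.
  exists (a *: p1 + p2); split; last by rewrite coefD coefZ e1 e2 !mxE.
    by apply: JD => //; rewrite -mul_polyC; apply: JM.
  apply: (leq_trans (size_polyD _ _)); rewrite geq_max sp2 andbT.
  exact: leq_trans (size_scale_leq _ _) sp1.
have Lg k : L (row k G) by apply: (spans_rows_row k GP).
have [sz szP] := fun_choice Lg.
(* All the generators are raised to a common size [d + 1]. *)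
pose d := \max_k sz k.
have Lg' k : Lc (G k 0) d.
  by have := szP k; rewrite mxE; apply: LcW; apply: leq_bigmax.
have [f fP] := fun_choice Lg'.
pose T (v : 'rV[R]_d) := J (rVpoly v).
have [|m' [H HP]] := noeR d T.
  split; first by rewrite /T linear0; apply: (submod0 subJ).
  move=> a u v Tu Tv; rewrite /T linearP; apply: JD; last exact: Tv.
  by rewrite /= -mul_polyC; apply: JM.
exists (m + m')%N, (fun k => match split k with inl i => f i | inr j =>
  rVpoly (row j H) end).
split.
  move=> k; case: (split k) => j; first by case: (fP j).
  exact: (spans_rows_row j HP).
suff: forall s (p : {poly R}), (size p <= s)%N -> J p -> exists w1 : 'I_m -> {poly R},
  exists w2 : 'I_m' -> {poly R},
    p = \sum_k w1 k * f k + \sum_k w2 k * rVpoly (row k H).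
  move=> h p Jp; have [w1 [w2 ->]] := h (size p) p (leqnn _) Jp.
  exists (fun k => match split k with inl i => w1 i | inr j => w2 j end).
  rewrite big_split_ord /=; congr (_ + _); apply: eq_bigr => i _.
    by rewrite (unsplitK (inl _)).
  by rewrite (unsplitK (inr _)).
elim=> [|s IH] p sp Jp.
  move: sp; rewrite leqn0 size_poly_eq0 => /eqP ->.
  by exists (fun=> 0), (fun=> 0); rewrite !big1 ?addr0 // => i _; rewrite mul0r.
have [le_sd|lt_ds] := leqP s.+1 d.
  have : T (poly_rV p) by rewrite /T poly_rV_K //; apply: leq_trans sp _.
  move=> /HP [w wE].
  exists (fun=> 0), (fun k => (w 0 k)%:P).
  rewrite big1 ?add0r => [|i _]; last by rewrite mul0r.
  rewrite -[LHS](@poly_rV_K _ d); last exact: leq_trans sp _.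
  rewrite wE mulmx_sum_row linear_sum /=; apply: eq_bigr => k _.
  by rewrite linearZ /= mul_polyC.
have : L (p`_s)%:M by exists s, p; split=> //; rewrite mxE eqxx mulr1n.
move=> /GP [w wE].
pose q : {poly R} := \sum_k (w 0 k *: 'X^(s - d)) * f k.
have Jq : J q by apply: (submod_sum subJ) => k _; apply: JM; case: (fP k).
have spq : (size (p - q : {poly R})%R <= s)%N.
  apply/leq_sizeP => j; rewrite leq_eqVlt => /predU1P[<-|lt_sj].
    rewrite coefB /q coef_sum.
    have /matrixP /(_ 0 0) := wE; rewrite !mxE eqxx mulr1n => ->.
    apply/eqP; rewrite subr_eq0; apply/eqP; apply: eq_bigr => k _.
    rewrite -scalerAl coefZ mulrC mulrC coefXnM ltnNge leq_subr /= subKn //.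
    by case: (fP k) => _ _ ->.
  rewrite coefB nth_default; last exact: leq_trans sp _.
  rewrite sub0r coef_sum big1 ?oppr0 // => k _.
  rewrite -scalerAl coefZ coefXnM; case: ltnP; rewrite ?mulr0 // => _.
  case: (fP k) => _ szf _; rewrite nth_default ?mulr0 //.
  apply: leq_trans szf _; lia.
have [//|w1 [w2 E]] := IH _ spq; first exact: (submodB subJ).
exists (fun k => w1 k + w 0 k *: 'X^(s - d)), w2.
rewrite -[LHS](subrK q) E /q addrAC -big_split /=; congr (_ + _).
by apply: eq_bigr => k _; rewrite mulrDl.
Qed.

Lemma ideals_fg_surj (R R' : comNzRingType) (f : {rmorphism R -> R'}) :
  (forall y, exists x, f x = y) -> ideals_fg R -> ideals_fg R'.
Proof.
move=> fsurj fgR J subJ.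
have [|m [g [Jg gJ]]] := fgR (fun x => J (f x)).
  split; first by rewrite rmorph0; apply: (submod0 subJ).
  by move=> a u v Ju Jv; rewrite rmorphD rmorphM; apply: (subJ.2 (f a)).
exists m, (fun k => f (g k)); split=> // y; have [x <-] := fsurj y.
move=> /gJ [w ->]; exists (fun k => f (w k)); rewrite rmorph_sum.
by apply: eq_bigr => k _; rewrite rmorphM.
Qed.

Lemma noetherian_field (K : fieldType) : noetherian K.
Proof.
apply: ideals_fg_noetherian => J subJ.
case: (classic (exists2 x, J x & x != 0)) => [[x Jx nz_x]|h].
  exists 1%N, (fun=> x); split=> // y _; exists (fun=> y / x).
  by rewrite big_ord1 divfK.
exists 0%N, (fun=> 0); split=> [[]//|y Jy]; exists (fun=> 0).
rewrite big_ord0; apply/eqP/negPn/negP => nz_y; case: h; by exists y.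
Qed.

(** [K[X_1, ..., X_n+1]] is a quotient of [K[X_1, ..., X_n][X]], by evaluation at
    the last variable. *)
Lemma noetherian_mpoly (K : fieldType) n : noetherian {mpoly K[n]}.
Proof.
elim: n => [|n IH].
  have fgK : ideals_fg K.
    move=> J subJ; have [|m [G GP]] := @noetherian_field K 1 (fun v => J (v 0 0)).
      split; first by rewrite mxE; apply: (submod0 subJ).
      by move=> a u v Ju Jv; rewrite !mxE; apply: (subJ.2 a).
    exists m, (fun k => G k 0); split.
      by move=> k; have := spans_rows_row k GP; rewrite mxE.
    move=> x Jx; have /GP [w wE] : J ((x%:M : 'M_1) 0 0) by rewrite mxE eqxx mulr1n.
    by exists (fun k => w 0 k); have /matrixP /(_ 0 0) := wE; rewrite !mxE eqxx mulr1n.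
  apply: ideals_fg_noetherian; apply: (@ideals_fg_surj K {mpoly K[0]} (@mpolyC 0 K)) fgK.
  by move=> p; exists (p@_0%MM); rewrite [RHS]nvar0_mpolyC.
apply: ideals_fg_noetherian.
pose ev (p : {poly {mpoly K[n]}}) : {mpoly K[n.+1]} :=
  (map_poly (@mwiden n K) p).['X_ord_max].
have evC c : ev c%:P = mwiden c by rewrite /ev map_polyC hornerC.
have evM p q : ev (p * q) = ev p * ev q by rewrite /ev rmorphM hornerM.
have evD p q : ev (p + q) = ev p + ev q by rewrite /ev rmorphD hornerD.
have evX k : ev 'X^k = 'X_ord_max ^+ k by rewrite /ev map_polyXn hornerXn.
apply: (@ideals_fg_surj _ _
  (horner_eval ('X_ord_max : {mpoly K[n.+1]}) \o map_poly (@mwiden n K)))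
  (ideals_fg_poly IH) => p.
change (exists x, ev x = p).
elim/mpolyind: p => [|c m p _ _ [q <-]].
  by exists 0%:P; rewrite evC mwiden0.
suff [x xE] : exists x, ev x = 'X_[m].
  by exists ((c%:MP)%:P * x + q); rewrite evD evM evC xE mwidenC mul_mpolyC.
exists ('X_[[multinom m (widen_ord (leqnSn n) i) | i < n]]%:P * 'X ^+ m ord_max).
rewrite evM evC evX mwidenX mpolyXn -mpolyXD; congr 'X_[_].
apply/mnmP => i; rewrite mnmDE mulmnE mnm1E.
case: (unliftP ord_max i) => [j ->|->].
  rewrite -[lift _ _]/(lift ord_max j) (negbTE (neq_lift _ _)) mul0n addn0.
  have -> : lift ord_max j = widen_ord (leqnSn n) j.
    by apply: val_inj; rewrite /= /bump leqNgt ltn_ord.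
  have := mnmwiden_widen [multinom m (widen_ord (leqnSn n) i) | i < n] j.
  by rewrite mnmE => <-; congr (_ _); apply: val_inj.
by rewrite mnmwiden_ordmax eqxx mul1n.
Qed.

(** * Homogeneous components and minimal free resolutions *)

Section Components.
Variables (K : fieldType) (n : nat).
Local Notation S := {mpoly K[n]}.

Lemma mcoeff_pihomog d (p : S) m :
  (pihomog mdeg d p)@_m = if mdeg m == d then p@_m else 0.
Proof.
rewrite pihomogE raddf_sum big_mkcond /=.
under eq_bigr do rewrite mcoeffZ mcoeffX.
case: (boolP (m \in msupp p)) => [m_p|/memN_msupp_eq0 p0]; last first.
  rewrite p0 if_same big1_seq // => k /andP[_ k_p].
  by case: ifP => // _; case: eqP => [km|]; rewrite ?mulr0 // km p0 mul0r.
rewrite (bigD1_seq m) ?msupp_uniq //= eqxx mulr1 big1 ?addr0 // => k /negbTE ->.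
by rewrite mulr0 if_same.
Qed.

Definition zcomp (z : int) (p : S) : S :=
  if z is Posz d then pihomog mdeg d p else 0.

Lemma mcoeff_zcomp z p m : (zcomp z p)@_m = if (mdeg m)%:Z == z then p@_m else 0.
Proof. by case: z => d /=; rewrite ?mcoeff_pihomog ?mcoeff0. Qed.

Lemma zhomogP e (p : S) : zhomog e p <-> forall m, (mdeg m)%:Z != e -> p@_m = 0.
Proof.
split=> [h m|h m m_p]; first by apply: contraNeq; rewrite -mcoeff_msupp => /h ->.
by apply/eqP; apply: contraTT m_p => /h p0; rewrite mcoeff_msupp p0 eqxx.
Qed.

Lemma zcomp_is_linear z : linear (zcomp z).
Proof.
move=> a p q; apply/mpolyP => m; rewrite !(mcoeff_zcomp, mcoeffD, mcoeffZ).
by case: ifP; rewrite // mulr0 addr0.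
Qed.

HB.instance Definition _ z := GRing.isLinear.Build K S S _ (zcomp z) (zcomp_is_linear z).

Lemma zhomog_zcomp z p : zhomog z (zcomp z p).
Proof. by apply/zhomogP => m /negbTE; rewrite mcoeff_zcomp => ->. Qed.

Lemma zcomp_id z p : zhomog z p -> zcomp z p = p.
Proof.
move=> /zhomogP h; apply/mpolyP => m; rewrite mcoeff_zcomp.
by case: ifPn => // /h ->.
Qed.

Lemma zcomp_ne z e p : zhomog e p -> e != z -> zcomp z p = 0.
Proof.
move=> /zhomogP h ne; apply/mpolyP => m; rewrite mcoeff_zcomp mcoeff0.
by case: eqP => // mz; rewrite h // mz eq_sym.
Qed.

Lemma zhomog0 e : zhomog e (0 : S).
Proof. by apply/zhomogP => m _; rewrite mcoeff0. Qed.

Lemma zhomogD e (p q : S) : zhomog e p -> zhomog e q -> zhomog e (p + q).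
Proof. by move=> /zhomogP hp /zhomogP hq; apply/zhomogP => m ne;
  rewrite mcoeffD hp // hq // addr0. Qed.

Lemma zhomog_sum e (I : Type) (r : seq I) (P : pred I) (F : I -> S) :
  (forall i, P i -> zhomog e (F i)) -> zhomog e (\sum_(i <- r | P i) F i).
Proof. by move=> h; elim/big_ind: _ => //; [apply: zhomog0 | apply: zhomogD]. Qed.

Lemma dhomog_zhomog d (p : S) : p \is d.-homog <-> zhomog d%:Z p.
Proof.
split=> [/dhomogP h m m_p|h]; first by rewrite h.
by apply/dhomogP => m /h [].
Qed.

Lemma zhomogM a b (p q : S) : zhomog a p -> zhomog b q -> zhomog (a + b) (p * q).
Proof.
case: a => a hp; last first.
  suff -> : p = 0 by rewrite mul0r => _; apply: zhomog0.
  by rewrite -(zcomp_id hp).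
case: b => b hq; last first.
  suff -> : q = 0 by rewrite mulr0; apply: zhomog0.
  by rewrite -(zcomp_id hq).
by rewrite -PoszD; apply/dhomog_zhomog/dhomogM; apply/dhomog_zhomog.
Qed.

Lemma zhomog1 : zhomog 0 (1 : S).
Proof. by apply/(dhomog_zhomog 0)/dhomog1. Qed.

Lemma zhomog_mcoeff0 e (p : S) : zhomog e p -> p@_0%MM != 0 -> e = 0 /\ p = (p@_0%MM)%:MP.
Proof.
move=> /zhomogP h nz.
have e0 : e = 0 by apply/eqP; apply: contraNT nz => ne; rewrite h // mdeg0 eq_sym.
split=> //; apply/mpolyP => m; rewrite mcoeffC.
case: eqP => [->|/eqP nz_m]; first by rewrite mulr1.
by rewrite mulr0 h // e0; move: nz_m; rewrite -mdeg_eq0; case: (mdeg m).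
Qed.

(** Multiplication by a homogeneous element commutes with taking components,
    up to the shift by its degree. *)
Lemma zcompM a z (p q : S) : zhomog a q -> zcomp (z + a) (p * q) = zcomp z p * q.
Proof.
move=> hq; rewrite [p in LHS](pihomog_partitionE (leqnn (msize p))).
rewrite mulr_suml raddf_sum /=.
have E (d : 'I_(msize p)) : zcomp (z + a) (pihomog mdeg d p * q) =
    if (d%:Z == z) then pihomog mdeg d p * q else 0.
  have h : zhomog (d%:Z + a) (pihomog mdeg d p * q).
    by apply: zhomogM => //; apply/dhomog_zhomog/pihomogP.
  case: ifPn => [/eqP <-|ne]; first by rewrite zcomp_id.
  by apply: zcomp_ne h _; apply: contraNneq ne => /addIr ->.
rewrite (eq_bigr _ (fun d _ => E d)) -big_mkcond /=.
case: z {E} => [z|z]; last by rewrite big_pred0 ?mul0r.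
have [lt_z|le_z] := ltnP z (msize p).
  by rewrite (big_pred1 (Ordinal lt_z)).
rewrite big_pred0 => [|d]; last first.
  by apply/negbTE/eqP => - [dz]; move: le_z; rewrite -dz leqNgt ltn_ord.
suff -> : zcomp z p = 0 by rewrite mul0r.
apply/mpolyP => m; rewrite mcoeff_zcomp mcoeff0; case: eqP => // - [mz].
by apply: memN_msupp_eq0; apply: msize_mdeg_ge; rewrite mz.
Qed.

(** Below, [dg] gives the degrees of the basis of a graded free module. *)
Definition rhomog r (dg : 'I_r -> int) (z : int) (v : 'rV[S]_r) : Prop :=
  forall l, zhomog (z - dg l) (v 0 l).

Definition rcomp r (dg : 'I_r -> int) (z : int) (v : 'rV[S]_r) : 'rV[S]_r :=
  \row_l zcomp (z - dg l) (v 0 l).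

Definition mhomog m r (dm : 'I_m -> int) (dr : 'I_r -> int) (G : 'M[S]_(m, r)) : Prop :=
  forall k l, zhomog (dm k - dr l) (G k l).

Definition graded_sub r (dg : 'I_r -> int) (N : 'rV[S]_r -> Prop) : Prop :=
  forall z v, N v -> N (rcomp dg z v).

Lemma rhomog_rcomp r (dg : 'I_r -> int) z v : rhomog dg z (rcomp dg z v).
Proof. by move=> l; rewrite mxE; apply: zhomog_zcomp. Qed.

Lemma rcomp_id r (dg : 'I_r -> int) z v : rhomog dg z v -> rcomp dg z v = v.
Proof. by move=> h; apply/rowP => l; rewrite mxE zcomp_id. Qed.

Lemma rcompM m r (dm : 'I_m -> int) (dr : 'I_r -> int) (G : 'M[S]_(m, r)) z w :
  mhomog dm dr G -> rcomp dr z (w *m G) = rcomp dm z w *m G.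
Proof.
move=> hG; apply/rowP => l; rewrite !mxE raddf_sum; apply: eq_bigr => k _.
by rewrite mxE -(zcompM _ _ (hG k l)) addrA subrK.
Qed.

Lemma rcomp0 r (dg : 'I_r -> int) z : rcomp dg z 0 = 0.
Proof. by apply/rowP => l; rewrite !mxE raddf0. Qed.

(** The degrees of the basis are nonnegative so that the components can be summed
    over natural numbers. *)
Lemma rcomp_partition r (dg : 'I_r -> int) (v : 'rV[S]_r) : (forall l, 0 <= dg l) ->
  exists B, v = \sum_(d < B) rcomp dg d%:Z v.
Proof.
move=> dg0; pose B := (\max_l (absz (dg l) + msize (v 0%R l)))%N; exists B.
apply/rowP => l; rewrite summxE; apply/mpolyP => m; rewrite raddf_sum /=.
under eq_bigr do rewrite mxE mcoeff_zcomp.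
rewrite -big_mkcond /=.
have [-> |nz] := eqVneq ((v 0 l)@_m) 0; first by rewrite big1.
have lt : (absz (dg l) + mdeg m < B)%N.
  have := @leq_bigmax _ (fun l => (absz (dg l) + msize (v 0%R l))%N) l.
  apply: leq_trans; rewrite ltn_add2l; apply: msize_mdeg_lt.
  by rewrite mcoeff_msupp.
rewrite (big_pred1 (Ordinal lt)) // => d /=.
rewrite -val_eqE /= eq_sym subr_eq addrC -{1}(gez0_abs (dg0 l)).
by rewrite -PoszD.
Qed.

End Components.

Lemma nat_min (P : nat -> Prop) : (exists n, P n) -> exists n, P n /\ forall m, P m ->
  (n <= m)%N.
Proof.
case=> n; elim/ltn_ind: n => n IH Pn.
case: (classic (exists2 m, (m < n)%N & P m)) => [[m lt_mn /(IH m lt_mn)]//|h].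
by exists n; split=> // m Pm; rewrite leqNgt; apply/negP => lt_mn; case: h; exists m.
Qed.

Section Minimal.
Variables (K : fieldType) (n : nat).
Local Notation S := {mpoly K[n]}.

Definition hgens r (dg : 'I_r -> int) (N : 'rV[S]_r -> Prop) m
    (e : 'I_m -> int) (G : 'M[S]_(m, r)) : Prop :=
  [/\ forall k, 0 <= e k, mhomog e dg G & spans_rows G N].

Lemma hgens_exist r (dg : 'I_r -> int) (N : 'rV[S]_r -> Prop) :
  (forall l, 0 <= dg l) -> submodule N -> graded_sub dg N ->
  exists m, exists e : 'I_m -> int, exists G, hgens dg N e G.
Proof.
move=> dg0 sN gN; have [m [G GP]] := noetherian_mpoly sN.
have [B BP] := fun_choice (fun k => rcomp_partition (row k G) dg0).
pose C := (\max_k B k)%N; pose T := ('I_m * 'I_C)%type.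
pose H (t : T) := if (t.2 < B t.1)%N then rcomp dg (val t.2)%:Z (row t.1 G) else 0.
exists #|{: T}|, (fun i => (val (enum_val i).2)%:Z),
  (\matrix_i H (enum_val i)).
split=> //.
  move=> k l; rewrite mxE /H; case: ifP => _; last by rewrite mxE; apply: zhomog0.
  exact: rhomog_rcomp.
apply: spans_rowsP => //.
  move=> i; rewrite rowK /H; case: ifP => _; last exact: (submod0 sN).
  by apply: gN; apply: (spans_rows_row _ GP).
move=> v /GP [w ->]; exists (\row_i w 0 (enum_val i).1).
rewrite !mulmx_sum_row.
transitivity (\sum_(i < #|{: T}|) w 0 (enum_val i).1 *: H (enum_val i)); last first.
  by apply: eq_bigr => i _; rewrite mxE rowK.
rewrite -(big_enum_val (A := {: T}) (fun t : T => w 0 t.1 *: H t)) /=.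
rewrite -(pair_bigA _ (fun (k : 'I_m) (d : 'I_C) => w 0 k *: H (k, d))) /=.
apply: eq_bigr => k _; rewrite -scaler_sumr; congr (_ *: _).
rewrite {1}[row k G]BP (big_ord_widen C (fun d : nat => rcomp dg d%:Z (row k G))).
  by rewrite big_mkcond.
exact: leq_bigmax.
Qed.

(** In a relation [w] with [w 0 k = 1] the [k]-th generator is redundant. *)
Lemma hgens_drop r (dg : 'I_r -> int) (N : 'rV[S]_r -> Prop) m
    (e : 'I_m.+1 -> int) G k (w : 'rV_m.+1) :
  submodule N -> hgens dg N e G -> w *m G = 0 -> w 0 k = 1 ->
  exists (e' : 'I_m -> int) G', hgens dg N e' G'.
Proof.
move=> sN [e0 hG GP] wG wk.
exists (fun j => e (lift k j)), (row' k G); split=> [j|j l|]; first exact: e0.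
  by rewrite mxE; apply: hG.
apply: spans_rowsP => // [j|v /GP [u ->]].
  have -> : row j (row' k G) = row (lift k j) G by apply/rowP => l; rewrite !mxE.
  exact: (spans_rows_row _ GP).
exists (\row_j (u 0 (lift k j) - u 0 k * w 0 (lift k j))).
have /eqP := wG; rewrite mulmx_sum_row (bigD1_ord k) //= wk scale1r addr_eq0 => /eqP Gk.
rewrite !mulmx_sum_row (bigD1_ord k) //= Gk scalerN scaler_sumr -sumrN -big_split /=.
apply: eq_bigr => j _.
have -> : row j (row' k G) = row (lift k j) G by apply/rowP => l; rewrite !mxE.
by rewrite mxE scalerBl scalerA addrC.
Qed.

(** A system of homogeneous generators with the least number of members: a
    relation with a nonzero constant coefficient would allow dropping a
    generator. *)
Lemma minimal_hgens r (dg : 'I_r -> int) (N : 'rV[S]_r -> Prop) :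
  (forall l, 0 <= dg l) -> submodule N -> graded_sub dg N ->
  exists m, exists e : 'I_m -> int, exists G, hgens dg N e G /\
    forall w : 'rV_m, w *m G = 0 -> forall k, (w 0 k)@_0%MM = 0.
Proof.
move=> dg0 sN gN.
have [m [[e [G hG]] mmin]] := nat_min (hgens_exist dg0 sN gN).
exists m, e, G; split=> // w wG k; apply/eqP/negPn/negP => nz.
case: m e G hG mmin w wG k nz => [|m] e G hG mmin w wG k nz; first by case: k nz.
pose c := (w 0 k)@_0%MM.
pose w' := (c^-1)%:MP *: rcomp e (e k) w.
have w'G : w' *m G = 0.
  by case: hG => _ hG _; rewrite -scalemxAl -(rcompM _ _ hG) wG rcomp0 scaler0.
have w'k : w' 0 k = 1.
  rewrite !mxE subrr.
  have cE : (zcomp 0 (w 0 k))@_0%MM = c by rewrite mcoeff_zcomp mdeg0 eqxx.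
  have [|_ ->] := zhomog_mcoeff0 (@zhomog_zcomp _ _ 0 (w 0 k)); first by rewrite cE.
  by rewrite cE -mpolyCM mulVf.
have [e' [G' h']] := hgens_drop sN hG w'G w'k.
have /mmin : exists (e : 'I_m -> int) G, hgens dg N e G by exists e', G'.
by rewrite ltnn.
Qed.

(** A stage in the construction of a minimal resolution: a graded submodule of a
    graded free module, whose generators form the basis of the next module and
    whose syzygies are the next stage. *)
Record gsub := GSub {
  gs_rk : nat;
  gs_deg : 'I_gs_rk -> int;
  gs_mem : 'rV[S]_gs_rk -> Prop;
  gs_deg0 : forall l, 0 <= gs_deg l;
  gs_sub : submodule gs_mem;
  gs_graded : graded_sub gs_deg gs_mem
}.

Record mgens (s : gsub) := MGens {
  mg_num : nat;
  mg_deg : 'I_mg_num -> int;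
  mg_mx : 'M[S]_(mg_num, gs_rk s);
  mg_gens : hgens (@gs_deg s) (@gs_mem s) mg_deg mg_mx;
  mg_min : forall w : 'rV_mg_num, w *m mg_mx = 0 -> forall k, (w 0 k)@_0%MM = 0
}.

Lemma mgens_inhabited s : inhabited (mgens s).
Proof.
have [m [e [G [h1 h2]]]] := minimal_hgens (@gs_deg0 s) (@gs_sub s) (@gs_graded s).
by constructor; exact: MGens h1 h2.
Qed.

Definition mgens_of s : mgens s := epsilon (mgens_inhabited s) (fun=> True).

Lemma kernel_submodule m r (G : 'M[S]_(m, r)) : submodule (fun w : 'rV_m => w *m G = 0).
Proof.
split; first by rewrite mul0mx.
by move=> a u v Gu Gv; rewrite mulmxDl -scalemxAl Gu Gv scaler0 addr0.
Qed.

Lemma kernel_graded m r (dm : 'I_m -> int) (dr : 'I_r -> int) (G : 'M[S]_(m, r)) :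
  mhomog dm dr G -> graded_sub dm (fun w : 'rV_m => w *m G = 0).
Proof. by move=> hG z v Gv; rewrite -(rcompM _ _ hG) Gv rcomp0. Qed.

Lemma mg_deg0 s (t : mgens s) k : 0 <= @mg_deg s t k.
Proof. by case: (mg_gens t). Qed.

Lemma mg_homog s (t : mgens s) : mhomog (@mg_deg s t) (@gs_deg s) (mg_mx t).
Proof. by case: (mg_gens t). Qed.

Definition syzygies s : gsub :=
  let t := mgens_of s in
  GSub (@mg_deg0 s t) (kernel_submodule (mg_mx t)) (kernel_graded (@mg_homog s t)).

Definition min_complex (s : gsub) (e : gs_rk s = 1%N) : free_complex K n :=
  let stage i := iter i syzygies s in
  @FreeComplex K n (fun i => mg_num (mgens_of (stage i)))
    (fun i => @mg_deg _ (mgens_of (stage i)))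
    (fun i => mg_mx (mgens_of (stage i.+1)))
    (castmx (erefl, e) (mg_mx (mgens_of s))).

Definition min_diff (F : free_complex K n) : Prop :=
  forall i k l, (diff F i k l)@_0%MM = 0.

Definition gideal (J : S -> Prop) : Prop :=
  @submodule S S^o J /\ forall d p, J p -> J (pihomog mdeg d p).

Lemma min_resolution (J : S -> Prop) : gideal J ->
  exists H : free_complex K n, free_resolution (ideal_module J) H /\ min_diff H.
Proof.
move=> [sJ gJ].
have sN : submodule (fun v : 'rV[S]_1 => J (v 0 0)).
  split; first by rewrite mxE; apply: (submod0 sJ).
  by move=> a u v Ju Jv; rewrite !mxE; apply: (sJ.2 a).
have gN : graded_sub (fun=> 0) (fun v : 'rV[S]_1 => J (v 0 0)).
  move=> [d|d] v Jv; rewrite mxE subr0 /=; [exact: gJ | exact: (submod0 sJ)].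
pose s : gsub := @GSub 1%N (fun=> 0) _ (fun=> lexx 0) sN gN.
exists (min_complex (erefl : gs_rk s = 1%N)); split; first split.
- split=> [k|i k l] /=; last exact: mg_homog.
  by have := @mg_homog s (mgens_of s) k 0; rewrite /= subr0.
- have [_ _ G0] := mg_gens (mgens_of s).
  split=> /=.
  + by move=> k; have := spans_rows_row k G0; rewrite /= mxE.
  + move=> p Jp.
    have /G0 [w wE] : gs_mem (p%:M : 'rV_(gs_rk s)) by rewrite /= mxE eqxx mulr1n.
    by exists w; rewrite -wE mxE eqxx mulr1n subrr.
  + move=> v.
    have [_ _ G1] := mg_gens (mgens_of (syzygies s)).
    rewrite -G1 /=; split=> [h|->]; last by rewrite mxE.
    by apply/rowP => j; rewrite ord1 h mxE.
  + by move=> i v; have [_ _ Gi] := mg_gens (mgens_of (iter i.+2 syzygies s)); rewrite -Gi.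
- move=> i k l; rewrite /=.
  have [_ _ Gi] := mg_gens (mgens_of (iter i.+1 syzygies s)).
  have := spans_rows_row k Gi; rewrite /= => /(@mg_min _ _ _) /(_ l).
  by rewrite mxE.
Qed.

(** Splicing [F_0 = S] to a resolution of an ideal gives one of the quotient. *)
Definition cons_complex (H : free_complex K n) : free_complex K n :=
  @FreeComplex K n (fun i => if i is i'.+1 then rk H i' else 1%N)
    (fun i => match i return 'I_(if i is i'.+1 then rk H i' else 1%N) -> int with
              | 0 => fun=> 0 | i'.+1 => @fdeg _ _ H i' end)
    (fun i => match i return 'M[S]_(rk H i, if i is i'.+1 then rk H i' else 1%N) with
              | 0 => aug H | i'.+1 => diff H i' end)
    1%:M.

Lemma cons_resolution (J : S -> Prop) (H : free_complex K n) :
  @submodule S S^o J -> free_resolution (ideal_module J) H ->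
  free_resolution (Subquotient (fun=> True) J) (cons_complex H).
Proof.
move=> sI [[h1 h2] [e1 e2 e3 e4]]; split; first split=> [k|i].
- by rewrite /= mxE ord1 eqxx; apply: zhomog1.
- case: i => [|i] k l /=; last exact: h2.
  by rewrite subr0 ord1; apply: h1.
split=> //=.
- move=> p _; exists p%:M; rewrite mulmx1 mxE eqxx mulr1n subrr.
  exact: (submod0 sI).
- move=> v; rewrite mulmx1; split=> [/e2 [w]|[w ->]].
    move/eqP; rewrite subr_eq0 => /eqP vE; exists w.
    by apply/rowP => j; rewrite ord1 vE.
  rewrite mxE; apply: (submod_sum sI) => k _.
  exact: (submodZ sI _ (e1 k)).
- case=> [|i] v /=; last exact: e4.
  have -> : v *m aug H = 0 <-> (v *m aug H) 0 0 = 0.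
    by split=> [->|h]; [rewrite mxE | apply/rowP => j; rewrite ord1 h mxE].
  exact: e3.
Qed.
End Minimal.

(** * Comparison of resolutions and Betti numbers *)

Lemma dependent_choice (T : nat -> Type) (P : forall i, T i -> Prop)
    (Q : forall i, T i -> T i.+1 -> Prop) :
  (exists a, P 0%N a) -> (forall i a, P i a -> exists b, P i.+1 b /\ Q i a b) ->
  exists f : forall i, T i, forall i, P i (f i) /\ Q i (f i) (f i.+1).
Proof.
move=> /constructive_indefinite_description [a0 Pa0] step.
pose next i (x : {a : T i | P i a}) :=
  constructive_indefinite_description _ (step i (sval x) (svalP x)).
pose g := fix g i : {a : T i | P i a} :=
  match i with
  | 0 => exist _ a0 Pa0
  | i'.+1 => exist _ (sval (next i' (g i'))) (proj1 (svalP (next i' (g i'))))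
  end.
exists (fun i => sval (g i)) => i; split; first exact: svalP.
exact: (proj2 (svalP (next i (g i)))).
Qed.

Section Comparison.
Variables (K : fieldType) (n : nat).
Local Notation S := {mpoly K[n]}.
Variable M : subquotient K n.
Hypothesis subM : @submodule S S^o (bot M).
Hypothesis gradedM : forall z p, bot M p -> bot M (zcomp z p).

Lemma row_lift (m r : nat) (G : 'M[S]_(m, r)) (p : nat) (V : 'M[S]_(p, r)) :
  (forall k, exists w, row k V = w *m G) -> exists W, V = W *m G.
Proof.
move=> /fun_choice [w wE]; exists (\matrix_k w k).
by apply/row_matrixP => k; rewrite row_mul rowK wE.
Qed.

(** The homogeneous components of any lift of homogeneous rows form a
    homogeneous lift. *)
Lemma hrow_lift (m r : nat) (dm : 'I_m -> int) (dr : 'I_r -> int) (G : 'M[S]_(m, r))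
    (p : nat) (dp : 'I_p -> int) (V : 'M[S]_(p, r)) :
  mhomog dm dr G -> mhomog dp dr V ->
  (forall k, exists w, row k V = w *m G) -> exists W, mhomog dp dm W /\ V = W *m G.
Proof.
move=> hG hV /fun_choice [w wE]; exists (\matrix_k rcomp dm (dp k) (w k)); split.
  by move=> k l; rewrite mxE; apply: rhomog_rcomp.
apply/row_matrixP => k; rewrite row_mul rowK -(rcompM _ _ hG) -wE rcomp_id //.
by move=> l; rewrite mxE; apply: hV.
Qed.

Lemma mhomogM (m p r : nat) (dm : 'I_m -> int) (dp : 'I_p -> int) (dr : 'I_r -> int)
    (A : 'M[S]_(m, p)) (B : 'M[S]_(p, r)) :
  mhomog dm dp A -> mhomog dp dr B -> mhomog dm dr (A *m B).
Proof.
move=> hA hB k l; rewrite mxE; apply: zhomog_sum => i _.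
have -> : dm k - dr l = (dm k - dp i) + (dp i - dr l) by rewrite addrA subrK.
exact: zhomogM.
Qed.

Section OneComplex.
Variable F : free_complex K n.
Hypothesis resF : free_resolution M F.

Lemma diff_diff i : diff F i.+1 *m diff F i = 0.
Proof.
case: resF => _ [_ _ _ ex]; apply/row_matrixP => k; rewrite row_mul row0.
by apply/ex; exists (delta_mx 0 k); rewrite rowE.
Qed.

Lemma bot_diff_aug (u : 'rV_(rk F 1)) : bot M ((u *m diff F 0 *m aug F) 0 0).
Proof. by case: resF => _ [_ _ ex _]; apply/ex; exists u. Qed.

Lemma diff_homog i : mhomog (@fdeg _ _ F i.+1) (@fdeg _ _ F i) (diff F i).
Proof. by case: resF => [[_ h] _]; apply: h. Qed.

(** An endomorphism of a resolution that induces 0 on the module is homotopic to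
    0: the homotopy is built degree by degree, its next component being a lift
    through the exact complex.  The predicate [P] keeps what the next lift
    needs. *)
Lemma null_homotopy (e : forall i, 'M[S]_(rk F i)) :
  (forall u : 'rV_(rk F 0), bot M ((u *m e 0%N *m aug F) 0 0)) ->
  (forall i, e i.+1 *m diff F i = diff F i *m e i) ->
  exists h : forall i, 'M[S]_(rk F i, rk F i.+1),
    e 0%N = h 0%N *m diff F 0 /\
    forall i, e i.+1 = h i.+1 *m diff F i.+1 + diff F i *m h i.
Proof.
move=> e0 eS; case: resF => _ [_ _ ex0 exS].
pose P i (h : 'M[S]_(rk F i, rk F i.+1)) :=
  diff F i *m h *m diff F i = diff F i *m e i /\
  match i return 'M[S]_(rk F i, rk F i.+1) -> Prop with
  | 0 => fun h => e 0%N = h *m diff F 0 | _ => fun=> True end h.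
pose Q i (h : 'M[S]_(rk F i, rk F i.+1)) h' :=
  e i.+1 = h' *m diff F i.+1 + diff F i *m h.
have [||h hP] := @dependent_choice _ P Q.
- have [k|h hE] := @row_lift _ _ (diff F 0) _ (e 0%N).
    by apply/ex0; rewrite rowE; apply: e0.
  by exists h; split=> //; rewrite -mulmxA -hE.
- move=> i h [hP _].
  have [k|h' h'E] := @row_lift _ _ (diff F i.+1) _ (e i.+1 - diff F i *m h).
    by apply/exS; rewrite -row_mul mulmxBl hP eS subrr row0.
  exists h'; split; last by rewrite /Q -h'E subrK.
  by split=> //; rewrite -mulmxA -h'E mulmxBr mulmxA diff_diff mul0mx subr0.
by exists h; split; [case: (hP 0%N) => [[]] | move=> i; case: (hP i)].
Qed.

End OneComplex.

(** The identity of the module lifts to resolutions, one degree at a time, by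
    homogeneous maps. *)
Lemma chain_map (F G : free_complex K n) : free_resolution M F -> free_resolution M G ->
  exists f : forall i, 'M[S]_(rk F i, rk G i),
    [/\ forall i, mhomog (@fdeg _ _ F i) (@fdeg _ _ G i) (f i),
        forall u : 'rV_(rk F 0), bot M ((u *m f 0%N *m aug G - u *m aug F) 0 0)
      & forall i, f i.+1 *m diff G i = diff F i *m f i].
Proof.
move=> resF resG.
have [[hF0 hF] [topF _ _ _]] := resF; have [[hG0 hG] [_ surjG ex0 exS]] := resG.
pose P i (f : 'M[S]_(rk F i, rk G i)) :=
  mhomog (@fdeg _ _ F i) (@fdeg _ _ G i) f /\
  match i return 'M[S]_(rk F i, rk G i) -> Prop with
  | 0 => fun f => forall u : 'rV_(rk F 0), bot M ((u *m f *m aug G - u *m aug F) 0 0)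
  | i'.+1 => fun f => forall u : 'rV_(rk F i'.+1), u *m diff F i' = 0 -> u *m f *m diff
    G i' = 0 end f.
pose Q i (f : 'M[S]_(rk F i, rk G i)) f' := f' *m diff G i = diff F i *m f.
have [||f fP] := @dependent_choice _ P Q.
- have /fun_choice [v vP] := fun k => surjG _ (topF k).
  pose f := \matrix_k rcomp (@fdeg _ _ G 0) (@fdeg _ _ F 0 k) (v k).
  exists f; split; first by move=> k l; rewrite mxE; apply: rhomog_rcomp.
  suff fk k : bot M ((row k f *m aug G - row k (aug F)) 0 0).
    move=> u; rewrite -mulmxA -mulmxBr mxE; apply: (submod_sum subM) => k _.
    apply: (submodZ subM); have := fk k.
    by rewrite -row_mul !mxE.
  rewrite rowK.
  have hG0' : mhomog (@fdeg _ _ G 0) (fun=> 0) (aug G).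
    by move=> l j; rewrite ord1 subr0.
  have := gradedM (@fdeg _ _ F 0 k) (submodN subM (vP k)).
  rewrite opprB raddfB /= (zcomp_id (hF0 k)) -(rcompM _ _ hG0').
  by rewrite !mxE subr0.
- move=> i f [hf fP].
  have [||k|f' [hf' f'E]] := @hrow_lift _ _ (@fdeg _ _ G i.+1)
    (@fdeg _ _ G i) (diff G i) _ (@fdeg _ _ F i.+1) (diff F i *m f).
  + exact: hG.
  + exact: mhomogM (hF i) hf.
  + case: i f hf fP => [|i] f hf fP in k *; last first.
      apply/exS; rewrite rowE mulmxA fP //.
      by rewrite -mulmxA -(mulmx0 _ (delta_mx 0 k)) -(diff_diff resF i).
    apply/ex0; rewrite rowE mulmxA.
    have := fP (delta_mx 0 k *m diff F 0).
    have := bot_diff_aug resF (delta_mx 0 k).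
    move=> h1 h2; have := submodD subM h2 h1.
    by rewrite !mxE subrK.
  + exists f'; split=> //; split=> // u uF.
    by rewrite -mulmxA -f'E mulmxA uF mul0mx.
by exists f; split=> [i||i]; [case: (fP i) => [[]] | case: (fP 0%N) => [[]] | case: (fP i)].
Qed.

Definition constK m r (A : 'M[S]_(m, r)) : 'M[K]_(m, r) := map_mx (mcoeff 0%MM) A.

Lemma constKM m p r (A : 'M[S]_(m, p)) (B : 'M[S]_(p, r)) :
  constK (A *m B) = constK A *m constK B.
Proof. exact: map_mxM. Qed.

Definition degK r (dg : 'I_r -> int) (j : int) : 'M[K]_r := diag_mx (\row_k (dg k == j)%:R).

Lemma degK_comm m r (dm : 'I_m -> int) (dr : 'I_r -> int) (A : 'M[S]_(m, r)) j :
  mhomog dm dr A -> degK dm j *m constK A = constK A *m degK dr j.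
Proof.
move=> hA; apply/matrixP => k l; rewrite mul_diag_mx mul_mx_diag !mxE.
have [->|nz] := eqVneq ((A k l)@_0%MM) 0; first by rewrite mulr0 mul0r.
have [/eqP e _] := zhomog_mcoeff0 (hA k l) nz.
by rewrite subr_eq0 in e; rewrite (eqP e) mulrC.
Qed.

Lemma degK_idem r (dg : 'I_r -> int) j : degK dg j *m degK dg j = degK dg j.
Proof.
apply/matrixP => k l; rewrite mul_diag_mx !mxE.
by case: (dg k == j); rewrite ?mul1r ?mul0r ?mul0rn.
Qed.

Lemma sub_degK r (dg : 'I_r -> int) j p (v : 'M[K]_(p, r)) :
  (v <= degK dg j)%MS -> v *m degK dg j = v.
Proof. by move=> /submxP [w ->]; rewrite -mulmxA degK_idem. Qed.

(** [ZF / BF] and [ZG / BG] are homology spaces, and the last hypothesis says that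
    the map between them that is induced by [A] is injective. *)
Lemma homology_rank_le (a b p q : nat) (ZF : 'M[K]_a) (BF : 'M[K]_(p, a))
    (ZG : 'M[K]_b) (BG : 'M[K]_(q, b)) (A : 'M[K]_(a, b)) :
  (ZF *m A <= ZG)%MS -> (BF <= ZF)%MS -> (BG <= ZG)%MS ->
  (forall v : 'rV_a, (v <= ZF)%MS -> (v *m A <= BG)%MS -> (v <= BF)%MS) ->
  (\rank ZF - \rank BF <= \rank ZG - \rank BG)%N.
Proof.
move=> ZA BZF BZG inj.
have := mxrank_mul_ker ZF (A *m cokermx BG).
have := mxrank_mul_ker ZG (cokermx BG).
have -> : \rank (ZG :&: kermx (cokermx BG))%MS = \rank BG.
  apply/eqmx_rank/andP; split; last first.
    by rewrite sub_capmx BZG; apply/sub_kermxP; apply: mulmx_coker.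
  have /sub_kermxP h := capmxSr ZG (kermx (cokermx BG)).
  by rewrite submxE h.
have le1 : (\rank (ZF *m (A *m cokermx BG)) <= \rank (ZG *m cokermx BG))%N.
  by rewrite mulmxA; apply: mxrankS; apply: submxMr.
have le2 : (\rank (ZF :&: kermx (A *m cokermx BG))%MS <= \rank BF)%N.
  apply: mxrankS; apply/row_subP => k; apply: inj.
    exact: submx_trans (row_sub _ _) (capmxSl _ _).
  have /sub_kermxP h : (row k (ZF :&: kermx (A *m cokermx BG)) <= kermx (A *m cokermx
    BG))%MS.
    exact: submx_trans (row_sub _ _) (capmxSr _ _).
  by rewrite submxE -mulmxA h.
lia.
Qed.

(** A chain map from [F] to [G] that lifts the identity is a homotopy equivalence.
    It remains one after tensoring with [K], and is then injective on
    homology. *)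
Lemma tor_dim_le (F G : free_complex K n) i j :
  free_resolution M F -> free_resolution M G -> (tor_dim F i j <= tor_dim G i j)%N.
Proof.
move=> resF resG.
have [f [hf f0 fS]] := chain_map resF resG.
have [g [hg g0 gS]] := chain_map resG resF.
have [||h [h0 hS]] := @null_homotopy F resF (fun i => f i *m g i - 1%:M).
- move=> u; have := submodD subM (g0 (u *m f 0%N)) (f0 u).
  rewrite mulmxBr mulmx1 mulmxBl mulmxA !mxE => e.
  by move: e; rewrite addrA subrK.
- by move=> k; rewrite mulmxBl mulmxBr mul1mx mulmx1 -mulmxA gS !mulmxA fS.
have dF k := degK_comm j (@diff_homog F resF k).
have dG k := degK_comm j (@diff_homog G resG k).
have fE k := degK_comm j (hf k); have gE k := degK_comm j (hg k).
have bF : (boundariesK F i j <= cyclesK F i j)%MS.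
  have le : (boundariesK F i j <= componentK F i j)%MS.
    by rewrite /boundariesK /componentK /diffK (dF i) submxMl.
  case: i le => [//|i] le; rewrite [cyclesK _ _ _]/= sub_capmx le; apply/sub_kermxP.
  by rewrite -mulmxA -constKM (diff_diff resF) /constK map_mx0 mulmx0.
have bG : (boundariesK G i j <= cyclesK G i j)%MS.
  have le : (boundariesK G i j <= componentK G i j)%MS.
    by rewrite /boundariesK /componentK /diffK (dG i) submxMl.
  case: i {bF} le => [//|i] le; rewrite [cyclesK _ _ _]/= sub_capmx le; apply/sub_kermxP.
  by rewrite -mulmxA -constKM (diff_diff resG) /constK map_mx0 mulmx0.
have ZE (X : free_complex K n) k : (cyclesK X k j <= componentK X k j)%MS.
  by case: k => [|k] //=; apply: capmxSl.
have key k (v : 'rV_(rk F k)) : (v <= cyclesK F k j)%MS ->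
    v *m constK (f k) *m constK (g k) - v = v *m constK (h k) *m constK (diff F k).
  move=> vZ; rewrite -!mulmxA -!constKM -{2}[v]mulmx1 -mulmxBr.
  have <- : constK (f k *m g k - 1%:M) = constK (f k *m g k) - 1%:M.
    by rewrite /constK map_mxB map_mx1.
  case: k v vZ => [|k] v vZ; first by rewrite h0.
  rewrite hS /constK map_mxD -/constK mulmxDr.
  have /sub_kermxP e : (v <= kermx (diffK F k))%MS.
    by apply: submx_trans vZ _; apply: capmxSr.
  by rewrite -/(constK _) -/(constK _) [X in _ + v *m X]constKM [X in _ + X]mulmxA e
    mul0mx addr0.
apply: (homology_rank_le (A := constK (f i))) => //.
  have le : (cyclesK F i j *m constK (f i) <= componentK G i j)%MS.
    by rewrite -(sub_degK (ZE F i)) -mulmxA fE mulmxA submxMl.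
  case: i bF bG le => [//|i] _ _ le; rewrite [cyclesK _ _ _]/= sub_capmx le;
    apply/sub_kermxP.
  rewrite -mulmxA -constKM fS constKM mulmxA.
  by rewrite (sub_kermxP (capmxSr _ _)) mul0mx.
move=> v vZ /submxP [u vA].
have vE : v *m degK (@fdeg _ _ F i) j = v by apply: sub_degK;
  apply: submx_trans vZ (ZE F i).
have bE : boundariesK F i j *m degK (@fdeg _ _ F i) j = boundariesK F i j.
  by rewrite /boundariesK -mulmxA -(dF i) mulmxA degK_idem.
have uE : v *m constK (f i) *m constK (g i) = u *m constK (g i.+1) *m boundariesK F i j.
  rewrite vA /boundariesK -!mulmxA; congr (u *m _).
  by rewrite -constKM -gS constKM mulmxA gE mulmxA.
have hE : v *m constK (h i) *m constK (diff F i) *m degK (@fdeg _ _ F i) j =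
    v *m constK (h i) *m boundariesK F i j.
  by rewrite -mulmxA -(dF i).
rewrite -vE -[v in v *m _](subKr (v *m constK (f i) *m constK (g i))) (key i v vZ).
rewrite mulmxBl hE uE -(mulmxA _ (boundariesK F i j)) bE -mulmxBl.
exact: submxMl.
Qed.

Lemma betti_resolution (G : free_complex K n) i j :
  free_resolution M G -> betti M i j = tor_dim G i j.
Proof.
move=> resG; set F := epsilon (inhabits (free_complex0 K n)) (free_resolution M).
have resF : free_resolution M F by apply: epsilon_spec; exists G.
by apply/eqP; rewrite eqn_leq !tor_dim_le.
Qed.

(** In a minimal resolution the differentials vanish modulo the variables, so
    the Betti numbers count basis elements. *)
Lemma betti_min (G : free_complex K n) i j :
  free_resolution M G -> min_diff G ->
  betti M i j <> 0%N <-> exists k, @fdeg _ _ G i k = j.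
Proof.
move=> resG minG; rewrite (betti_resolution _ _ resG).
have d0 k : diffK G k = 0 by apply/matrixP => a b; rewrite !mxE minG.
have -> : tor_dim G i j = \rank (componentK G i j).
  rewrite /tor_dim /boundariesK d0 mulmx0 mxrank0 subn0.
  case: i => [|i] //=; apply/eqmx_rank/andP; split; first exact: capmxSl.
  by rewrite sub_capmx submx_refl; apply/sub_kermxP; rewrite d0 mulmx0.
split=> [nz|[k <-] r0].
  case: (pickP (fun k => @fdeg _ _ G i k == j)) => [k /eqP <-|none]; first by exists k.
  case: nz; apply/eqP; rewrite mxrank_eq0; apply/eqP/matrixP => a b.
  by rewrite !mxE none mul0rn.
have /eqP : componentK G i (@fdeg _ _ G i k) = 0 by apply/eqP; rewrite -mxrank_eq0 r0.
move=> /eqP/matrixP /(_ k k); rewrite !mxE !eqxx mulr1n => /eqP.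
by rewrite oner_eq0.
Qed.

End Comparison.

(** * Cochains modulo powers of the variables *)

Section Coefficients.
Variables (R : comNzRingType) (c : nat).
Implicit Types (p q : {mpoly R[c]}) (m k : 'X_{1..c}).

Lemma mcoeffM_eq0 p q m :
  (forall m1 m2, m = (m1 + m2)%MM -> p@_m1 * q@_m2 = 0) -> (p * q)@_m = 0.
Proof. by move=> h; rewrite mcoeffM big1 // => ij /eqP; apply: h. Qed.

Lemma mcoeffXM k p m : ('X_[k] * p)@_m = if (k <= m)%MM then p@_(m - k) else 0.
Proof.
case: ifPn => [le|nle]; first by rewrite mulrC -{1}(submK le) addmC mcoeffMX.
apply: mcoeffM_eq0 => m1 m2 mE; rewrite mcoeffX; case: eqP => [e|]; rewrite ?mul0r //.
by case/negP: nle; rewrite mE e lem_addr.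
Qed.

Lemma mcoeffM_supp p q m :
  (p * q)@_m = \sum_(k <- msupp p) p@_k * (if (k <= m)%MM then q@_(m - k) else 0).
Proof.
rewrite {1}[p]mpolyE mulr_suml raddf_sum; apply: eq_bigr => k _.
by rewrite /= -scalerAl mcoeffZ mcoeffXM.
Qed.

End Coefficients.

Section PowerIdeals.
Variables (K : fieldType) (c N : nat).
Local Notation S := {mpoly K[c]}.

(** The ideal generated by the [N]-th powers of the first [k] variables. *)
Definition powI (k : nat) (p : S) : Prop :=
  forall m : 'X_{1..c}, (forall i : 'I_c, (i < k)%N -> (m i < N)%N) -> p@_m = 0.

Lemma powI_submod k : @submodule S S^o (powI k).
Proof.
split=> [m _|a u v hu hv m small]; first exact: mcoeff0.
rewrite mcoeffD hv // addr0; apply: mcoeffM_eq0 => m1 m2 mE.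
by rewrite hu ?mulr0 // => i /small; rewrite mE mnmDE; apply: leq_trans;
  rewrite ltnS leq_addl.
Qed.

Lemma powI_XM (k : 'I_c) p : powI k ('X_k ^+ N * p) -> powI k p.
Proof.
move=> h m small; rewrite -(mcoeffMX p (U_(k) *+ N)%MM m) mulrC -mpolyXn.
have -> : (U_(k) *+ N + m = m + U_(k) *+ N)%MM by rewrite addmC.
apply: h => i lt_ik.
by rewrite mnmDE mulmnE mnm1E -val_eqE /= (gtn_eqF lt_ik) addn0 small.
Qed.

Lemma powI_le k k' p : (k <= k')%N -> powI k p -> powI k' p.
Proof. by move=> le h m small; apply: h => i /leq_trans/(_ le); apply: small. Qed.

Lemma lem_Xn (k : 'I_c) m : (U_(k) *+ N <= m)%MM = (N <= m k)%N.
Proof.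
apply/mnm_lepP/idP => [/(_ k)|le i]; rewrite mulmnE mnm1E ?eqxx ?mul1n //.
by case: eqP => [<-|]; rewrite ?mul1n.
Qed.

Lemma powI_X (k : 'I_c) p : powI k.+1 ('X_k ^+ N * p).
Proof. by move=> m small; rewrite mpolyXn mcoeffXM lem_Xn leqNgt small. Qed.

Definition degle (z : int) (p : S) : Prop := forall m, z < (mdeg m)%:Z -> p@_m = 0.

Lemma powI_split (k : 'I_c) z p : powI k.+1 p -> degle z p ->
  exists w, powI k (p - 'X_k ^+ N * w) /\ degle (z - N%:Z) w.
Proof.
move=> Ip dp.
pose w := \sum_(m : 'X_{1..c < msize p}) (p@_(m + U_(k) *+ N)) *: 'X_[m] : S.
have wE m : w@_m = p@_(m + U_(k) *+ N).
  have [lt|ge] := ltnP (mdeg m) (msize p).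
    exact: (mcoeff_mpoly (fun m => p@_(m + U_(k) *+ N))).
  rewrite [RHS]memN_msupp_eq0; last first.
    by apply: msize_mdeg_ge; rewrite mdegD (leq_trans ge) ?leq_addr.
  rewrite raddf_sum big1 // => m' _; rewrite /= mcoeffZ mcoeffX.
  by case: eqP => [e|]; rewrite ?mulr0 //; move: ge; rewrite -e leqNgt bmdeg.
exists w; split.
  move=> m small; rewrite mcoeffB mpolyXn mcoeffXM lem_Xn.
  case: leqP => [le|lt]; first by rewrite wE submK ?subrr // lem_Xn.
  rewrite subr0; apply: Ip => i; rewrite ltnS leq_eqVlt.
  by case/orP => [/eqP/val_inj ->|/small].
move=> m lt; rewrite wE dp // mdegD mdegMn mdeg1 mul1n PoszD -ltrBlDr.
exact: lt.
Qed.

Lemma degleD z p q : degle z p -> degle z q -> degle z (p + q).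
Proof. by move=> hp hq m lt; rewrite mcoeffD hp // hq // addr0. Qed.

Lemma degle_sum z (I : Type) (r : seq I) (P : pred I) (F : I -> S) :
  (forall i, P i -> degle z (F i)) -> degle z (\sum_(i <- r | P i) F i).
Proof.
move=> h; elim/big_ind: _ => //; first by move=> m _; rewrite mcoeff0.
by move=> p q; apply: degleD.
Qed.

Lemma degleM a b p q : degle a p -> degle b q -> degle (a + b) (p * q).
Proof.
move=> hp hq m lt; apply: mcoeffM_eq0 => m1 m2 mE.
have [/hp ->|le] := ltrP a (mdeg m1)%:Z; first by rewrite mul0r.
by rewrite hq ?mulr0 //; move: lt; rewrite mE mdegD; lia.
Qed.

Lemma zhomog_degle z p : zhomog z p -> degle z p.
Proof. by move=> /zhomogP h m lt; apply: h; rewrite gt_eqF. Qed.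

Lemma degle_neg z p : z < 0 -> degle z p -> p = 0.
Proof.
move=> z0 h; apply/mpolyP => m; rewrite mcoeff0 h //.
exact: lt_le_trans z0 _.
Qed.

(** Cochains with coefficients in [S / powI k] of a complex of free
    [S]-modules on which the [N]-th power of each variable is homotopic to 0. *)
Section Cochains.
Variables (r : nat -> nat) (d : forall i, 'M[S]_(r i.+1, r i)).
Hypothesis dd : forall i, d i.+1 *m d i = 0.
Hypothesis homotopy : forall k : 'I_c, exists h : forall i, 'M[S]_(r i, r i.+1),
  ('X_k ^+ N)%:M = h 0%N *m d 0%N /\
  forall i, ('X_k ^+ N)%:M = h i.+1 *m d i.+1 + d i *m h i.

Definition powV k m (v : 'cV[S]_m) : Prop := forall a, powI k (v a 0).

Lemma powVD k m (u v : 'cV[S]_m) : powV k u -> powV k v -> powV k (u + v).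
Proof. by move=> hu hv a; rewrite mxE; apply: (submodD (powI_submod k)). Qed.

Lemma powVN k m (u : 'cV[S]_m) : powV k u -> powV k (- u).
Proof. by move=> hu a; rewrite mxE; apply: (submodN (powI_submod k)). Qed.

Lemma powVM k m m' (A : 'M[S]_(m', m)) v : powV k v -> powV k (A *m v).
Proof.
move=> hv a; rewrite mxE; apply: (submod_sum (powI_submod k)) => b _.
exact: (submodZ (powI_submod k)).
Qed.

Lemma powV0 k m : powV k (0 : 'cV[S]_m).
Proof. by move=> a m' _; rewrite mxE mcoeff0. Qed.

Lemma powV_le k k' m (v : 'cV[S]_m) : (k <= k')%N -> powV k v -> powV k' v.
Proof. by move=> le h a; apply: powI_le le _. Qed.

Lemma powV_XM (k : 'I_c) m (v : 'cV[S]_m) : powV k ('X_k ^+ N *: v) -> powV k v.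
Proof. by move=> h a; apply: powI_XM; have := h a; rewrite mxE. Qed.

Lemma powV_split (k : 'I_c) m (z : 'I_m -> int) (v : 'cV[S]_m) : powV k.+1 v ->
  (forall a, degle (z a) (v a 0)) ->
  exists w : 'cV[S]_m, powV k (v - 'X_k ^+ N *: w) /\
    forall a, degle (z a - N%:Z) (w a 0).
Proof.
move=> hv dv; have /fun_choice [w wP] := fun a => powI_split (hv a) (dv a).
exists (\col_a w a); split=> a; rewrite !mxE; by case: (wP a).
Qed.

Lemma degle_msize p : degle (msize p)%:Z p.
Proof. by move=> m lt; apply/memN_msupp_eq0/msize_mdeg_ge/ltnW; lia. Qed.

Definition coboundary k i : 'cV[S]_(r i) -> Prop :=
  match i return 'cV[S]_(r i) -> Prop with
  | 0 => @powV k (r 0%N)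
  | i'.+1 => fun v => exists w, powV k (v - d i' *m w)
  end.

Lemma coboundary_lift (k : 'I_c) i (v : 'cV_(r i)) : coboundary k.+1 v ->
  exists w, powV k (d i *m v - 'X_k ^+ N *: (d i *m w)).
Proof.
have split_d (u : 'cV_(r i)) : powV k.+1 u ->
    exists w, powV k (d i *m u - 'X_k ^+ N *: (d i *m w)).
  move=> hu; have [w [hw _]] := powV_split hu (fun a => @degle_msize (u a 0)).
  by exists w; rewrite scalemxAr -mulmxBr; apply: powVM.
case: i v split_d => [|i] v split_d; first exact: split_d.
move=> [x /split_d [w]]; rewrite mulmxBr mulmxA dd mul0mx subr0.
by exists w.
Qed.

(** The vanishing of [Ext^i (-, S / powI k)] for [i + k < c], for a module
    annihilated by the powers of the variables. *)
Lemma cocycle_coboundary i k (v : 'cV_(r i)) :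
  (i + k < c)%N -> powV k (d i *m v) -> coboundary k v.
Proof.
elim: i k v => [|i IH] k v lt_c hv; have lt_k : (k < c)%N by lia.
  have [h [h0 _]] := homotopy (Ordinal lt_k).
  apply: (@powV_XM (Ordinal lt_k)).
  by rewrite -mul_scalar_mx h0 -mulmxA; apply: powVM.
have [h [_ hS]] := homotopy (Ordinal lt_k).
have hom : powV k ('X_(Ordinal lt_k) ^+ N *: v - d i *m (h i *m v)).
  by rewrite -mul_scalar_mx hS mulmxDl -!mulmxA addrK; apply: powVM.
have [|w hw] := @coboundary_lift (Ordinal lt_k) i (h i *m v).
  apply: IH; first by rewrite /=; lia.
  rewrite -[d i *m _](subKr ('X_(Ordinal lt_k) ^+ N *: v)).
  apply: powVD; last by apply: powVN; apply: powV_le (leqnSn k) hom.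
  by move=> a; rewrite mxE; apply: powI_X.
exists w; apply: (@powV_XM (Ordinal lt_k)); rewrite scalerBr.
by have := powVD hom hw; rewrite addrA subrK.
Qed.

Variable dg : forall i, 'I_(r i) -> int.
Hypothesis d_homog : forall i, mhomog (@dg i.+1) (@dg i) (d i).

(** In the critical degree [i + k = c] there may be cohomology, but none of low
    internal degree: each step of the induction divides the coboundary by a
    power of a variable, and the last one lands in negative degrees. *)
Lemma low_cocycle_coboundary k i (t : int) (v : 'cV_(r i)) : (i + k = c)%N ->
  (forall a : 'I_(r c), @dg c a + t - (k * N)%:Z < 0) ->
  (forall a, degle (@dg i a + t) (v a 0)) ->
  powV k (d i *m v) -> coboundary k v.
Proof.
elim: k i t v => [|k IH] i t v ikc neg dv hv.
  have {}ikc : i = c by rewrite -ikc addn0.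
  subst i; have -> : v = 0.
    apply/colP => a; rewrite mxE; apply: degle_neg (dv a).
    by have := neg a; rewrite mul0n subr0.
  have cob0 j : @coboundary 0 j 0.
    by case: j => [|j]; [exact: powV0 | exists 0; rewrite mulmx0 subr0; apply: powV0].
  exact: cob0.
have lt_k : (k < c)%N by lia.
pose X := 'X_(Ordinal lt_k) ^+ N : S.
have ddv a : degle (@dg i.+1 a + t) ((d i *m v) a 0).
  rewrite mxE; apply: degle_sum => b _.
  have -> : @dg i.+1 a + t = (@dg i.+1 a - @dg i b) + (@dg i b + t) by ring.
  by apply: degleM => //; apply: zhomog_degle; apply: d_homog.
have [w [hw dw]] := @powV_split (Ordinal lt_k) _ _ _ hv ddv.
have [||||x hx] := IH i.+1 (t - N%:Z) w.
- by rewrite addSnnS.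
- by move=> a; have := neg a; lia.
- by move=> a; rewrite addrA.
- apply: (@powV_XM (Ordinal lt_k)); rewrite scalemxAr.
  have := powVN (powVM (d i.+1) hw).
  by rewrite mulmxBr mulmxA dd mul0mx sub0r opprK.
have : coboundary k (v - X *: x).
  apply: cocycle_coboundary; first by lia.
  have := powVD hw (powVM X%:M hx).
  rewrite mul_scalar_mx scalerBr addrA subrK mulmxBr -scalemxAr.
  exact.
have hX m (y : 'cV_m) : powV k.+1 (X *: y).
  by move=> a; rewrite mxE; apply: (@powI_X (Ordinal lt_k)).
case: i v x {ikc dv hv ddv w hw dw hx} => [|i] v x.
  move=> /(powV_le (leqnSn k)) h; have := powVD h (hX _ x).
  by rewrite subrK.
move=> [y /(powV_le (leqnSn k)) h]; exists y; have := powVD h (hX _ x).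
by rewrite addrAC subrK.
Qed.

End Cochains.
End PowerIdeals.

(** * The socle argument *)

(** Only the part of degree [e] matters, a space of finite dimension, in which the
    part of [J] is the row space of a matrix. *)
Lemma separating_functional (K : fieldType) (c e : nat) (J : {mpoly K[c]} -> Prop) p :
  gideal J -> p \is e.-homog -> ~ J p ->
  exists f : {mpoly K[c]} -> K, [/\ linear_for *%R f, forall q, J q -> f q = 0,
    forall m, mdeg m != e -> f 'X_[m] = 0 & f p <> 0].
Proof.
move=> [sJ gJ] hp nJp.
pose T := 'X_{1..c < e.+1}.
pose emb (v : 'rV[K]_#|{: T}|) : {mpoly K[c]} :=
  \sum_(i < #|{: T}|) v 0 i *: 'X_[(enum_val i : T)].
pose cv (q : {mpoly K[c]}) : 'rV[K]_#|{: T}| :=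
  \row_(i < #|{: T}|) (pihomog mdeg e q)@_(enum_val i : T).
have cvD a q q' : cv (a *: q + q') = a *: cv q + cv q'.
  by apply/rowP => i; rewrite !mxE linearP /= mcoeffD mcoeffZ.
have embK q : emb (cv q) = pihomog mdeg e q.
  rewrite /emb; under eq_bigr do rewrite mxE.
  rewrite -(big_enum_val (A := {: T}) (fun b : T => (pihomog mdeg e q)@_b *: 'X_[b])) /=.
  apply/mpolyP => m; have [lt|ge] := ltnP (mdeg m) e.+1.
    exact: (mcoeff_mpoly (fun m => (pihomog mdeg e q)@_m)).
  rewrite mcoeff_pihomog gtn_eqF //= raddf_sum big1 //= => b _.
  rewrite mcoeffZ mcoeffX; case: eqP => [bm|]; rewrite ?mulr0 //.
  by move: ge; rewrite -bm leqNgt bmdeg.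
have [|m [G GP]] := noetherian_field (N := fun v => J (emb v)).
  split.
    rewrite /emb big1 => [|i _]; first exact: (submod0 sJ).
    by rewrite mxE scale0r.
  move=> a u v Ju Jv; have -> : emb (a *: u + v) = a%:MP * emb u + emb v.
    rewrite mul_mpolyC /emb scaler_sumr -big_split /=; apply: eq_bigr => i _.
    by rewrite !mxE scalerDl scalerA.
  exact: (sJ.2 _).
have nG : ~~ (cv p <= G)%MS.
  by apply/negP => /submxP /GP; rewrite embK (pihomog_dE hp).
rewrite submxE in nG.
have [j nz] : exists j, (cv p *m cokermx G) 0 j <> 0.
  apply: NNPP => none; case/eqP: nG; apply/rowP => j; rewrite [RHS]mxE.
  by apply: NNPP => nz; apply: none; exists j.
exists (fun q => (cv q *m cokermx G) 0 j); split=> //.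
- by move=> a u v; rewrite cvD mulmxDl -scalemxAl !mxE.
- move=> q Jq; have /GP [w ->] : J (emb (cv q)) by rewrite embK; apply: gJ.
  by rewrite -mulmxA mulmx_coker mulmx0 mxE.
- move=> k ne; have -> : cv 'X_[k] = 0; last by rewrite mul0mx mxE.
  by apply/rowP => i; rewrite !mxE pihomogX (negbTE ne) mcoeff0.
Qed.

Section Socle.
Variables (K : fieldType) (c N D : nat).
Local Notation S := {mpoly K[c]}.
Variable J : S -> Prop.
Hypothesis gJ : gideal J.
Hypothesis N0 : (0 < N)%N.
Hypothesis JX : forall i : 'I_c, J ('X_i ^+ N).

Lemma pow_mem (i : 'I_c) (m : 'X_{1..c}) : (N <= m i)%N -> J 'X_[m].
Proof.
rewrite -lem_Xn => /submK <-; rewrite mpolyXD -mpolyXn.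
exact: (submodZ gJ.1).
Qed.

(** If [p] is not in [J], a functional that separates [p] from [J] is, through
    the perfect pairing of [S / (X_1 ^ N, ..., X_c ^ N)], multiplication by a
    form [u] which [J] annihilates there. *)
Lemma annihilator e p : p \is e.-homog -> ~ J p ->
  exists u : S, [/\ degle ((c * N.-1)%:Z - e%:Z) u, ~ powI N c u
    & forall g, J g -> powI N c (g * u)].
Proof.
move=> hp nJp; have [f [flin fJ f0 fp]] := separating_functional gJ hp nJp.
(* [f] is recovered from [u] because the monomials [X^m] and [X^(M - m)] are dual
   to each other: their product [X^M] spans the socle. *)
pose M : 'X_{1..c} := [multinom N.-1 | i < c].
pose small (m : 'X_{1..c}) := [forall i, (m i < N)%N].
have smallP m : small m -> (m <= M)%MM.
  by move=> /forallP h; apply/mnm_lepP => i; rewrite mnmE -ltnS prednK.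
have degM : mdeg M = (c * N.-1)%N.
  by rewrite mdegE; under eq_bigr do rewrite mnmE; rewrite sum_nat_const card_ord.
pose E m : K := if small m then f 'X_[M - m] else 0.
pose u : S := \sum_(b : 'X_{1..c < (mdeg M).+1}) E b *: 'X_[b].
have uE m : u@_m = E m.
  have [lt|ge] := ltnP (mdeg m) (mdeg M).+1; first exact: mcoeff_mpoly.
  have -> : E m = 0.
    rewrite /E; case: ifP => // /smallP /submK e1.
    by move: ge; rewrite -[in mdeg M]e1 mdegD leqNgt ltnS leq_addl.
  rewrite raddf_sum big1 //= => b _; rewrite mcoeffZ mcoeffX.
  by case: eqP => [bm|]; rewrite ?mulr0 //; move: ge; rewrite -bm leqNgt bmdeg.
have fsum q : f q = \sum_(m <- msupp q) q@_m * f 'X_[m].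
  have fzero : f 0 = 0 by have := flin (-1) 0 0; rewrite scaler0 addr0 mulN1r addNr.
  rewrite {1}[q]mpolyE; elim: (msupp q) => [|m s IH]; first by rewrite !big_nil.
  by rewrite !big_cons flin IH.
have f_big (m : 'X_{1..c}) i : (N <= m i)%N -> f 'X_[m] = 0.
  by move=> h; apply: fJ; apply: pow_mem h.
exists u; split.
- move=> m lt; rewrite uE /E; case: ifP => // /smallP /submK e1.
  apply: f0; apply/eqP => e2; move: lt; rewrite -degM -[in mdeg M]e1 mdegD e2.
  lia.
- move=> Iu; apply: fp; rewrite fsum big1 // => m _.
  have [sm|] := boolP (small m); last first.
    by rewrite negb_forall => /existsP [i]; rewrite -leqNgt => /f_big ->; rewrite mulr0.
  have sm' : small (M - m)%MM.
    apply/forallP => i; rewrite mnmBE mnmE.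
    by apply: leq_ltn_trans (leq_subr _ _) _; rewrite prednK.
  have mE : (M - (M - m) = m)%MM.
    apply/mnmP => i; rewrite !mnmBE subKn //.
    by have /mnm_lepP := smallP _ sm.
  have := Iu (M - m)%MM; rewrite uE /E sm' mE => -> //; first by rewrite mulr0.
  by move=> i _; have /forallP := sm'; apply.
- move=> g Jg m sm.
  have {}sm : small m by apply/forallP => i; apply: sm.
  rewrite mcoeffM_supp; transitivity (f ('X_[M - m] * g)); last first.
    by apply: fJ; apply: (submodZ gJ.1).
  have -> : f ('X_[M - m] * g) = \sum_(k <- msupp g) g@_k * f 'X_[M - m + k].
    have fzero : f 0 = 0 by have := flin (-1) 0 0; rewrite scaler0 addr0 mulN1r addNr.
    rewrite {1}[g]mpolyE; elim: (msupp g) => [|k s IH]; first by rewrite !big_nil mulr0.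
    by rewrite !big_cons mulrDr -scalerAr flin IH mpolyXD.
  apply: eq_bigr => k _; congr (_ * _); case: ifPn => [le|/mnm_lepP nle].
    rewrite uE /E ifT; last first.
      apply/forallP => i; rewrite mnmBE.
      by apply: leq_ltn_trans (leq_subr _ _) _; have /forallP := sm; apply.
    congr (f 'X_[_]); apply/mnmP => i; rewrite !(mnmBE, mnmDE).
    by have /mnm_lepP/(_ i) := le; have /mnm_lepP/(_ i) := smallP _ sm; lia.
  have [i lt] : exists i, (m i < k i)%N.
    by apply: NNPP => none; apply: nle => i; rewrite leqNgt; apply/negP => lt;
      apply: none; exists i.
  rewrite (f_big _ i) // mnmDE mnmBE mnmE.
  by have /forallP/(_ i) := sm; lia.
Qed.

Variables (r : nat -> nat) (d : forall i, 'M[S]_(r i.+1, r i)).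
Hypothesis dd : forall i, d i.+1 *m d i = 0.
Hypothesis homotopy : forall k : 'I_c, exists h : forall i, 'M[S]_(r i, r i.+1),
  ('X_k ^+ N)%:M = h 0%N *m d 0%N /\
  forall i, ('X_k ^+ N)%:M = h i.+1 *m d i.+1 + d i *m h i.
Variable dg : forall i, 'I_(r i) -> int.
Hypothesis d_homog : forall i, mhomog (@dg i.+1) (@dg i) (d i).

(** The form [u] that [J] annihilates is a cocycle in degree 0 modulo the powers
    of all the variables.  Its degree is [c * (N - 1) - e], so that the bound on
    the degrees in [F_c] makes it a coboundary, that is, 0. *)
Lemma socle_bound (a0 : 'I_(r 0)) : (forall a, @dg 0 a = 0) ->
  (forall a b, J (d 0 a b)) -> (forall a : 'I_(r c), @dg c a < (D + c)%:Z) ->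
  forall e p, (D <= e)%N -> p \is e.-homog -> J p.
Proof.
move=> dg0 Jd low e p le_De hp; apply: NNPP => /(annihilator hp) [u [du nu Ju]].
apply: nu; pose v : 'cV[S]_(r 0) := \col__ u.
have cob : coboundary N d c v.
  apply: (low_cocycle_coboundary dd homotopy d_homog (t := (c * N.-1)%:Z - e%:Z)).
  - by [].
  - move=> a; have := low a.
    have : (c * N = c * N.-1 + c)%N by rewrite -{1}(prednK N0) mulnS addnC.
    by lia.
  - by move=> a; rewrite mxE dg0 add0r.
  - move=> a; rewrite mxE; apply: (submod_sum (@powI_submod K c N c)) => b _.
    by rewrite mxE; apply: Ju.
by have := cob a0; rewrite mxE.
Qed.

End Socle.

(** * Linear substitutions *)

Section LinearSubstitution.
Variable K : fieldType.

Definition linform n c (A : 'M[K]_(n, c)) (i : 'I_n) : {mpoly K[c]} :=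
  \sum_j A i j *: 'X_j.

Definition lsub n c (A : 'M[K]_(n, c)) (p : {mpoly K[n]}) : {mpoly K[c]} :=
  p \mPo [tuple linform A i | i < n].

HB.instance Definition _ n c (A : 'M[K]_(n, c)) :=
  GRing.RMorphism.copy (lsub A) (comp_mpoly [tuple linform A i | i < n]).

Lemma lsub_is_scalable n c (A : 'M[K]_(n, c)) : scalable (lsub A).
Proof. by move=> a p; apply: comp_mpolyZ. Qed.

HB.instance Definition _ n c (A : 'M[K]_(n, c)) :=
  GRing.isScalable.Build K {mpoly K[n]} {mpoly K[c]} _ (lsub A) (lsub_is_scalable A).

Lemma lsubXU n c (A : 'M[K]_(n, c)) i : lsub A 'X_i = linform A i.
Proof. by rewrite /lsub comp_mpolyXU -tnth_nth tnth_mktuple. Qed.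

Lemma lsubX n c (A : 'M[K]_(n, c)) m : lsub A 'X_[m] = \prod_i linform A i ^+ m i.
Proof. by rewrite /lsub comp_mpolyX; apply: eq_bigr => i _; rewrite tnth_mktuple. Qed.

Lemma lsub_linform n c k (B : 'M[K]_(k, n)) (A : 'M[K]_(n, c)) i :
  lsub A (linform B i) = linform (B *m A) i.
Proof.
rewrite /linform raddf_sum /=.
under eq_bigr do rewrite linearZ /= lsubXU scaler_sumr.
rewrite exchange_big /=; apply: eq_bigr => j _.
by rewrite mxE scaler_suml; apply: eq_bigr => l _; rewrite scalerA.
Qed.

Lemma lsub_comp n c k (B : 'M[K]_(k, n)) (A : 'M[K]_(n, c)) p :
  lsub A (lsub B p) = lsub (B *m A) p.
Proof.
elim/mpolyind: p => [|a m p _ _ IH]; first by rewrite !raddf0.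
rewrite !linearP /= IH; congr (_ *: _ + _).
rewrite !lsubX rmorph_prod; apply: eq_bigr => i _.
by rewrite rmorphXn /= lsub_linform.
Qed.

Lemma lsub1 n (p : {mpoly K[n]}) : lsub 1%:M p = p.
Proof.
elim/mpolyind: p => [|a m p _ _ IH]; first by rewrite !raddf0.
rewrite !linearP /= IH; congr (_ *: _ + _).
rewrite lsubX mpolyXE_id; apply: eq_bigr => i _; congr (_ ^+ _).
rewrite /linform (bigD1 i) //= mxE eqxx scale1r big1 ?addr0 // => j ne.
by rewrite mxE eq_sym (negbTE ne) scale0r.
Qed.

Lemma lsub_sum n c (A : 'M[K]_(n, c)) p :
  lsub A p = \sum_(m <- msupp p) p@_m *: lsub A 'X_[m].
Proof.
by rewrite {1}[p]mpolyE raddf_sum; apply: eq_bigr => m _; rewrite /= linearZ.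
Qed.

Lemma dhomog_bigprod c (I : finType) (F : I -> {mpoly K[c]}) (e : I -> nat) :
  (forall i, F i \is (e i).-homog) -> \prod_i F i \is (\sum_i e i)%N.-homog.
Proof.
move=> h; elim/big_rec2: _ => [|i d p _ hp]; first exact: dhomog1.
exact: dhomogM.
Qed.

Lemma linform_homog n c (A : 'M[K]_(n, c)) i : linform A i \is 1.-homog.
Proof. by apply: rpred_sum => j _; apply: rpredZ; rewrite dhomogX /= mdeg1. Qed.

Lemma lsubX_homog n c (A : 'M[K]_(n, c)) m : lsub A 'X_[m] \is (mdeg m).-homog.
Proof.
rewrite lsubX mdegE; apply: dhomog_bigprod => i.
by rewrite -[X in X.-homog]mul1n; apply: dhomogMn; apply: linform_homog.
Qed.

Lemma pihomog_lsub n c (A : 'M[K]_(n, c)) d p :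
  pihomog mdeg d (lsub A p) = lsub A (pihomog mdeg d p).
Proof.
elim/mpolyind: p => [|a m p _ _ IH]; first by rewrite !raddf0.
rewrite !linearP /= IH; congr (_ *: _ + _).
rewrite pihomogX; case: eqP => [<-|/eqP ne]; first exact/pihomog_dE/lsubX_homog.
by rewrite raddf0; apply: pihomog_ne0 (lsubX_homog A m).
Qed.

Lemma lsub_homog n c (A : 'M[K]_(n, c)) d p : p \is d.-homog -> lsub A p \is d.-homog.
Proof. by rewrite homog_piE => /eqP <-; rewrite -pihomog_lsub; apply: pihomogP. Qed.

Lemma lsub_zhomog n c (A : 'M[K]_(n, c)) z p : zhomog z p -> zhomog z (lsub A p).
Proof.
case: z => d h; first by apply/dhomog_zhomog/lsub_homog/dhomog_zhomog.
by rewrite -(zcomp_id h) raddf0; apply: zhomog0.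
Qed.

Lemma pihomog0E c (p : {mpoly K[c]}) : pihomog mdeg 0 p = (p@_0%MM)%:MP.
Proof.
apply/mpolyP => m; rewrite mcoeff_pihomog mcoeffC mdeg_eq0.
by case: eqP => [->|]; rewrite ?mulr1 ?mulr0.
Qed.

Lemma lsub_const n c (A : 'M[K]_(n, c)) p : (lsub A p)@_0%MM = p@_0%MM.
Proof.
have := pihomog_lsub A 0 p; rewrite !pihomog0E /lsub comp_mpolyC => /eqP.
by rewrite mpolyC_eq => /eqP.
Qed.

Definition lsub_image n c (A : 'M[K]_(n, c)) (J : {mpoly K[n]} -> Prop) (q : {mpoly
  K[c]}) :=
  exists2 p, J p & lsub A p = q.

Lemma gideal_image n c (A : 'M[K]_(n, c)) (C : 'M[K]_(c, n)) J :
  C *m A = 1%:M -> gideal J -> gideal (lsub_image A J).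
Proof.
move=> CA [sJ gJ]; split; first split.
- by exists 0; [apply: (submod0 sJ) | rewrite raddf0].
- move=> a _ _ [p Jp <-] [q Jq <-]; exists (lsub C a * p + q).
    exact: (sJ.2 _).
  by rewrite rmorphD rmorphM /= lsub_comp CA lsub1.
move=> d _ [p Jp <-]; exists (pihomog mdeg d p); first exact: gJ.
by rewrite pihomog_lsub.
Qed.

End LinearSubstitution.

Section Specialization.
Variables (K : fieldType) (n c N : nat) (A : 'M[K]_(n, c)) (C : 'M[K]_(c, n)).
Local Notation S := {mpoly K[n]}.
Hypothesis CA : C *m A = 1%:M.
Variable J : S -> Prop.
Hypothesis gJ : gideal J.
Hypothesis JX : forall i : 'I_c, lsub_image A J ('X_i ^+ N).
Variable H : free_complex K n.
Hypothesis resH : free_resolution (ideal_module J) H.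

Let F := cons_complex H.
Let resF : free_resolution (Subquotient (fun=> True) J) F := cons_resolution gJ.1 resH.
Let d i : 'M[{mpoly K[c]}]_(rk F i.+1, rk F i) := map_mx (lsub A) (diff F i).

Let dd i : d i.+1 *m d i = 0.
Proof. by rewrite -map_mxM (diff_diff resF) map_mx0. Qed.

Let d_homog i : mhomog (@fdeg _ _ F i.+1) (@fdeg _ _ F i) (d i).
Proof. by move=> k l; rewrite mxE; apply: lsub_zhomog; apply: (diff_homog resF). Qed.

(** Multiplication by an element of [J] is homotopic to 0 on a resolution of
    [S / J]. *)
Let homotopy (k : 'I_c) : exists h : forall i, 'M_(rk F i, rk F i.+1),
  ('X_k ^+ N)%:M = h 0%N *m d 0%N /\
  forall i, ('X_k ^+ N)%:M = h i.+1 *m d i.+1 + d i *m h i.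
Proof.
have [f Jf fE] := JX k.
have [||h [h0 hS]] := null_homotopy resF (e := fun i => f%:M).
- move=> u /=; rewrite mulmx1 mul_mx_scalar mxE mulrC.
  exact: (submodZ gJ.1).
- by move=> i; rewrite scalar_mxC.
exists (fun i => map_mx (lsub A) (h i)).
by split=> [|i]; rewrite -fE -map_scalar_mx ?h0 ?hS ?map_mxD !map_mxM.
Qed.

Lemma lsub_diff_const i a b : min_diff F -> (d i a b)@_0%MM = 0.
Proof. by move=> h; rewrite mxE lsub_const h. Qed.

(** If all the generators of [F_{i+1}] had degree at most that of the
    generator [a] of [F_i], then by minimality no boundary would involve [a],
    and the coordinate function of [a] would be a cocycle, hence a coboundary;
    but coboundaries have no constant coefficients. *)
Lemma shift_increases i (a : 'I_(rk F i)) : min_diff F -> (i < c)%N ->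
  exists b, @fdeg _ _ F i a < @fdeg _ _ F i.+1 b.
Proof.
move=> minF lt_ic; apply: NNPP => none.
pose v : 'cV[{mpoly K[c]}]_(rk F i) := delta_mx a 0.
have dv : d i *m v = 0.
  rewrite -colE; apply/colP => b; rewrite mxE [RHS]mxE.
  have le : @fdeg _ _ F i.+1 b <= @fdeg _ _ F i a.
    by rewrite leNgt; apply/negP => lt; apply: none; exists b.
  apply/mpolyP => m; rewrite mcoeff0.
  have [->|nz] := eqVneq m 0%MM; first exact: lsub_diff_const.
  have /zhomogP := @d_homog i b a; apply; rewrite gt_eqF //.
  apply: le_lt_trans (_ : 0 < _); first by rewrite subr_le0.
  by rewrite ltz_nat lt0n mdeg_eq0.
have : coboundary N d 0 v.
  apply: (cocycle_coboundary dd homotopy); first by rewrite addn0.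
  by rewrite dv; apply: powV0.
have v1 : (v a 0)@_0%MM = 1 by rewrite mxE !eqxx /= mcoeff1 eqxx.
case: i a v {lt_ic none dv} v1 => [|i] a v v1.
  move=> /(_ a 0%MM) h; have /eqP := h (fun i => ltac:(by [])).
  by rewrite v1 oner_eq0.
move=> [w /(_ a 0%MM) h]; have /eqP := h (fun i => ltac:(by [])).
rewrite mxE mcoeffD v1 mxE mcoeffN mxE raddf_sum big1 => [|b _].
  by rewrite subr0 oner_eq0.
have := lsub_diff_const a b minF; rewrite /= -/(mcoeff _) => e.
by rewrite rmorphM /= e mul0r.
Qed.

(** Here the complex is the resolution of [S / J], specialized along [A]. *)
Lemma linear_image D : (0 < N)%N -> (forall a, @fdeg _ _ F c a < (D + c)%:Z) ->
  forall e p, (D <= e)%N -> p \is e.-homog -> lsub_image A J p.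
Proof.
move=> N0 low; apply: (socle_bound (gideal_image CA gJ) N0 JX dd homotopy d_homog
  (@ord0 0 : 'I_(rk F 0))) => //.
move=> a b; rewrite mxE /=.
by exists (aug H a b) => //; rewrite ord1; case: resH => _ [h _ _ _]; apply: h.
Qed.

End Specialization.

(** * Shifts of a componentwise linear ideal *)

Lemma greatestP d (T : porderType d) x0 (P : T -> Prop) :
  (exists m, is_greatest P m) -> is_greatest P (greatest x0 P).
Proof. exact: epsilon_spec. Qed.

Lemma greatest_eq d (T : porderType d) x0 (P : T -> Prop) m :
  is_greatest P m -> greatest x0 P = m.
Proof.
move=> [Pm mmax]; have [Pg gmax] := greatestP x0 (ex_intro _ m (conj Pm mmax)).
by apply: le_anti; rewrite mmax // gmax.
Qed.

Lemma fin_max r (f : 'I_r -> int) (k0 : 'I_r) : exists k, forall l, f l <= f k.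
Proof. by exists [arg max_(k > k0) f k]%O; case: arg_maxP => // k _ h l; apply: h. Qed.

Section DegreePart.
Variables (K : fieldType) (n : nat) (I : {pred {mpoly K[n]}}).
Local Notation S := {mpoly K[n]}.
Hypothesis gI : gideal (fun p : S => p \in I).

Lemma gideal_zcomp (J : S -> Prop) z p : gideal J -> J p -> J (zcomp z p).
Proof. by case: z => d [sJ gJ] Jp; [apply: gJ | apply: (submod0 sJ)]. Qed.

Lemma degree_part_sub D p : degree_part_ideal I D p -> p \in I.
Proof.
move=> [h [a [f [fP ->]]]]; apply: (submod_sum gI.1) => k _.
by apply: (submodZ gI.1); case: (fP k).
Qed.

Lemma degree_part_mem D a f : f \in I -> f \is D.-homog -> degree_part_ideal I D (a * f).
Proof. by move=> If hf; exists 1%N, (fun=> a), (fun=> f); rewrite big_ord1. Qed.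

Lemma degree_part_gideal D : gideal (degree_part_ideal I D).
Proof.
split; first split.
- by exists 0%N, (fun=> 0), (fun=> 0); rewrite big_ord0; split=> // - [].
- move=> a _ _ [h1 [a1 [f1 [P1 ->]]]] [h2 [a2 [f2 [P2 ->]]]].
  exists (h1 + h2)%N, (fun k => match split k with inl i => a * a1 i | inr j => a2 j end),
    (fun k => match split k with inl i => f1 i | inr j => f2 j end).
  split; first by move=> k; case: (split k).
  rewrite big_split_ord /= [a *: _]mulr_sumr; congr (_ + _); apply: eq_bigr => i _.
    by rewrite (unsplitK (inl _)) mulrA.
  by rewrite (unsplitK (inr _)).
- move=> d _ [h [a [f [P ->]]]]; exists h, (fun k => zcomp (d%:Z - D%:Z) (a k)), f.
  split=> //; rewrite raddf_sum; apply: eq_bigr => k _.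
  have [_ /dhomog_zhomog hf] := P k.
  by rewrite -(zcompM _ _ hf) subrK.
Qed.

Lemma submonomial (m : 'X_{1..n}) k : (k <= mdeg m)%N -> exists2 m', (m' <= m)%MM &
  mdeg m' = k.
Proof.
elim: k => [|k IH] le; first by exists 0%MM; [apply/mnm_lepP => i;
  rewrite mnm0E | exact: mdeg0].
have [m' le' dm'] := IH (ltnW le).
have [i lt] : exists i, (m' i < m i)%N.
  apply: NNPP => none; suff: (mdeg m <= mdeg m')%N by rewrite dm' leqNgt le.
  rewrite !mdegE; apply: leq_sum => i _; rewrite leqNgt.
  by apply/negP => lt; apply: none; exists i.
exists (m' + U_(i))%MM; last by rewrite mdegD mdeg1 dm' addn1.
apply/mnm_lepP => j; rewrite mnmDE mnm1E.
have /mnm_lepP /(_ j) := le'; case: eqP => [<-|_]; rewrite ?addn0 //.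
by rewrite addn1.
Qed.

(** A form of degree at least [D] in [I] is a combination of generators of degree
    at most [D] with monomial coefficients; a factor of each monomial raises the
    generator to degree [D]. *)
Lemma degree_part_high D (H : free_complex K n) :
  free_resolution (ideal_module (fun p => p \in I)) H ->
  (forall k, @fdeg _ _ H 0 k <= D%:Z) ->
  forall e p, (D <= e)%N -> p \is e.-homog -> p \in I -> degree_part_ideal I D p.
Proof.
move=> [[hom0 _] [augI surj _ _]] le_D e p le_De hp Ip.
have [sJ gJ] := degree_part_gideal D.
have [w /eqP] := surj p Ip; rewrite subr_eq0 => /eqP pE.
have -> : p = \sum_k zcomp (e%:Z - @fdeg _ _ H 0 k) (w 0 k) * aug H k 0.
  rewrite -[p](@zcomp_id _ _ e%:Z); last exact/dhomog_zhomog.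
  rewrite pE mxE raddf_sum; apply: eq_bigr => k _ /=.
  by rewrite -(zcompM _ _ (hom0 k)) subrK.
apply: (submod_sum sJ) => k _.
have hg := hom0 k; have Ig : aug H k 0 \in I := augI k.
have := le_D k; have : zhomog (e%:Z - @fdeg _ _ H 0 k) (zcomp (e%:Z - @fdeg _ _ H 0 k)
  (w 0 k)).
  exact: zhomog_zcomp.
move: (zcomp _ _) => u; move: (aug H k 0) (@fdeg _ _ H 0 k) hg Ig =>
  g [dk|dk] hg Ig hu le_dk.
  rewrite [u]mpolyE mulr_suml big_seq; apply: (submod_sum sJ) => m m_u.
  have dm : (mdeg m + dk = e)%N by have := hu m m_u; lia.
  have [|m' le' dm'] := @submonomial m (D - dk)%N; first by lia.
  rewrite -scalerAl -mul_mpolyC; apply: (submodZ sJ).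
  rewrite -(submK le') mpolyXD -mulrA; apply: degree_part_mem.
    exact: (submodZ gI.1).
  have -> : D = (D - dk + dk)%N by lia.
  by apply: dhomogM; [rewrite dhomogX /= dm' | apply/dhomog_zhomog].
by rewrite -(zcomp_id hg) mulr0; apply: (submod0 sJ).
Qed.

End DegreePart.

Section Shifts.
Variables (K : fieldType) (n c N : nat) (I : {pred {mpoly K[n]}}).
Variables (A : 'M[K]_(n, c)) (C : 'M[K]_(c, n)).
Hypothesis gI : gideal (fun p : {mpoly K[n]} => p \in I).
Hypothesis I1 : 1 \notin I.
Hypothesis linI : componentwise_linear I.
Hypothesis CA : C *m A = 1%:M.
Hypothesis IX : forall i : 'I_c, lsub_image A (fun p => p \in I) ('X_i ^+ N).

Lemma max_shift_ge (F : free_complex K n) i (a : 'I_(rk F i)) :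
  free_resolution (quotient_module I) F -> min_diff F -> @fdeg _ _ F i a <= max_shift I i.
Proof.
move=> resF minF.
have bettiE j : betti (quotient_module I) i j <> 0%N <-> exists k, @fdeg _ _ F i k = j.
  apply: betti_min => //; first exact: gI.1.
  by move=> z p; apply: gideal_zcomp.
have [k kmax] := fin_max (@fdeg _ _ F i) a.
have -> : max_shift I i = @fdeg _ _ F i k.
  apply: greatest_eq; split; first by apply/bettiE; exists k.
  by move=> _ /bettiE [l <-].
exact: kmax.
Qed.

(** For [c > 0], the number [D] is the largest degree of a generator of [I], that
    is, [M_1]. *)
Lemma componentwise_linear_shifts : exists D : nat,
  [/\ (0 < D)%N,
      forall e q, (D <= e)%N -> q \is e.-homog -> lsub_image A (fun p => p \in I) q
    & forall i, (i < c)%N -> (D + i)%:Z <= max_shift I i.+1].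
Proof.
have [H [resH minH]] := min_resolution gI.
pose F := cons_complex H.
have resF : free_resolution (quotient_module I) F := cons_resolution gI.1 resH.
have const0 p : p \in I -> p@_0%MM = 0.
  move=> Ip; apply/eqP/negPn/negP => nz; case/negP: I1.
  have := gI.2 0%N _ Ip; rewrite pihomog0E => /(submodZ gI.1 (p@_0%MM)^-1%:MP).
  by rewrite /GRing.scale /= -mpolyCM mulVf.
have minF : min_diff F.
  move=> [|i] k l /=; last exact: minH.
  by rewrite ord1; apply: const0; case: resH => _ [h _ _ _]; apply: h.
have [c0|c_gt0] := posnP c.
  exists 1%N; split=> // [e q e_gt0 hq|i]; last by rewrite c0.
  suff -> : q = 0 by exists 0; [apply: (submod0 gI.1) | rewrite raddf0].
  apply/mpolyP => m; rewrite mcoeff0; apply: (dhomog_nemf_coeff hq).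
  by rewrite /= mdegE big1 ?ltn_eqF // => i _; have := ltn_ord i;
    rewrite [X in (_ < X)%N]c0.
have incr := @shift_increases _ _ _ N A _ gI IX _ resH.
have [a0 a0_gt0] := incr 0%N 0 minF c_gt0.
have [a1 a1_max] := fin_max (@fdeg _ _ F 1) a0.
have a1_gt0 : 0 < @fdeg _ _ F 1 a1 := lt_le_trans a0_gt0 (a1_max a0).
pose D := absz (@fdeg _ _ F 1 a1).
have DE : @fdeg _ _ F 1 a1 = D%:Z by rewrite /D gez0_abs // ltW.
exists D; split; first by rewrite -ltz_nat -DE.
- pose J := degree_part_ideal I D.
  have gJ : gideal J := degree_part_gideal I D.
  have [HJ [resHJ minHJ]] := min_resolution gJ.
  have high : forall e p, (D <= e)%N -> p \is e.-homog -> p \in I -> J p.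
    by apply: (degree_part_high gI resH) => k; rewrite -DE; apply: a1_max.
  (* An exponent at least [D], so that the powers lie in the image of [J]. *)
  pose N' := (N + D.+1)%N.
  have N'_gt0 : (0 < N')%N by rewrite /N' addnS.
  have JX (i : 'I_c) : lsub_image A J ('X_i ^+ N').
    have hX : ('X_i ^+ N' : {mpoly K[c]}) \is N'.-homog.
      by rewrite mpolyXn dhomogX /= mdegMn mdeg1 mul1n.
    have [p Ip pE] : lsub_image A (fun p => p \in I) ('X_i ^+ N').
      rewrite /N' addnC exprD.
      exact: (submodZ (gideal_image CA gI).1).
    exists (pihomog mdeg N' p); last by rewrite -pihomog_lsub pE pihomog_dE.
    apply: (high N'); [by rewrite /N' addnS leqW ?leq_addl | exact: pihomogP | exact: gI.2].
  have degHJ i k : @fdeg _ _ HJ i k = i%:Z + D%:Z.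
    apply/eqP/negPn/negP => ne.
    have sub0 : @submodule _ {mpoly K[n]}^o (bot (ideal_module J)).
      by split=> //= a u v -> ->; rewrite scaler0 addr0.
    have gr0 z p : bot (ideal_module J) p -> bot (ideal_module J) (zcomp z p).
      by move=> /= ->; rewrite raddf0.
    have /(betti_min sub0 gr0 i _ resHJ minHJ) : exists l, @fdeg _ _ HJ i l = @fdeg _ _
      HJ i k.
      by exists k.
    apply; rewrite -[@fdeg _ _ HJ i k](subrK i%:Z) addrC; apply: linI.
    by apply: contraNneq ne => <-; rewrite addrC subrK.
  have low (a : 'I_(rk (cons_complex HJ) c)) : @fdeg _ _ (cons_complex HJ) c a < (D + c)%:Z.
    by move: c_gt0 a; case: (c) => // c' _ a; rewrite /= degHJ; lia.
  move=> e q le_De hq.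
  have [p /degree_part_sub Ip <-] := linear_image CA gJ JX resHJ N'_gt0 low le_De hq.
  by exists p => //; apply: Ip.
- move=> i lt_ic.
  suff [a le_a] : exists a : 'I_(rk F i.+1), (D + i)%:Z <= @fdeg _ _ F i.+1 a.
    exact: le_trans le_a (max_shift_ge _ resF minF).
  elim: i lt_ic => [|i IH] lt_ic; first by exists a1; rewrite DE addn0.
  have [a le_a] := IH (ltnW lt_ic); have [b lt_ab] := incr _ a minF lt_ic.
  exists b; rewrite addnS intS addrC lezD1.
  exact: le_lt_trans le_a lt_ab.
Qed.

End Shifts.

(** * Linear systems of parameters *)

Section Points.
Variable K : fieldType.
Hypothesis charK : [pchar K] =i pred0.

Lemma poly_nonroot (p : {poly K}) : (forall x, p.[x] = 0) -> p = 0.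
Proof.
move=> h; apply/eqP/negPn/negP => nz.
pose rs := [seq (i%:R : K) | i <- iota 0 (size p)].
have : (size rs < size p)%N.
  apply: max_poly_roots => //; first by apply/allP => x _; apply/rootP/h.
  rewrite map_inj_uniq ?iota_uniq // => i j /eqP.
  wlog le_ij : i j / (i <= j)%N.
    by move=> W; case: (leqP i j) => [/W//|/ltnW le]; rewrite eq_sym => /(W _ _ le).
  rewrite -subr_eq0 -opprB oppr_eq0 -natrB //.
  have /pcharf0P -> := charK; rewrite subn_eq0 => le_ji.
  by apply/eqP; rewrite eqn_leq le_ij.
by rewrite size_map size_iota ltnn.
Qed.

(** Induction on the number of variables: the coefficients with respect to the
    last variable vanish at all points. *)
Lemma mpoly_nonroot s (g : {mpoly K[s]}) : (forall b, g.@[b] = 0) -> g = 0.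
Proof.
elim: s g => [|s IH] g h.
  by rewrite [g]nvar0_mpolyC; have := h (fun=> 0);
    rewrite [g]nvar0_mpolyC mevalC mcoeffC eqxx mulr1 => ->; rewrite mpolyC0.
pose res (m : 'X_{1..s.+1}) : 'X_{1..s} := [multinom m (widen_ord (leqnSn s) i) | i < s].
have res_inj m m' : res m = res m' -> m ord_max = m' ord_max -> m = m'.
  move=> /mnmP e1 e2; apply/mnmP => i; case: (unliftP ord_max i) => [j ->|-> //].
  have -> : lift ord_max j = widen_ord (leqnSn s) j.
    by apply: val_inj; rewrite /= /bump leqNgt ltn_ord.
  by have := e1 j; rewrite !mnmE.
have coefE k : (muni g)`_k = \sum_(m <- msupp g) (g@_m * (k == m ord_max)%:R) *: 'X_[res m].
  rewrite muniE coef_sum; apply: eq_bigr => m _.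
  by rewrite coefZ coefXn -scalerA; case: (k == _);
    rewrite ?mulr1 ?mulr0 ?scale1r ?scale0r ?scaler0.
have muni0 k : (muni g)`_k = 0.
  apply: IH => b.
  suff : map_poly (meval b) (muni g) = 0 by move=> /polyP /(_ k); rewrite coef_map coef0.
  apply: poly_nonroot => x.
  pose b' (i : 'I_s.+1) := if unlift ord_max i is Some j then b j else x.
  rewrite -(h b') muniE mevalE raddf_sum horner_sum; apply: eq_bigr => m _ /=.
  rewrite map_polyZ map_polyXn hornerZ hornerXn.
  rewrite -[X in X * _]/((g@_m *: 'X_[res m]).@[b]) mevalZ mevalX -mulrA; congr (_ * _).
  rewrite big_ord_recr /= /b' unlift_none; congr (_ * _); apply: eq_bigr => i _.
  have -> : widen_ord (leqnSn s) i = lift ord_max i.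
    by apply: val_inj; rewrite /= /bump leqNgt ltn_ord.
  rewrite liftK mnmE; congr (_ ^+ m _).
  by apply: val_inj; rewrite /= /bump leqNgt ltn_ord.
apply/mpolyP => m; rewrite mcoeff0.
have [m_g|/memN_msupp_eq0 //] := boolP (m \in msupp g).
have /mpolyP/(_ (res m)) := muni0 (m ord_max).
rewrite coefE mcoeff0 raddf_sum (bigD1_seq m) ?msupp_uniq //=.
rewrite mcoeffZ mcoeffX !eqxx !mulr1 big1 ?addr0 // => m' ne.
rewrite mcoeffZ mcoeffX; case: eqP => [e1|]; last by rewrite !(mulr0, mul0r).
case: eqP => [e2|]; last by rewrite !(mulr0, mul0r).
by case/eqP: ne; apply: res_inj.
Qed.

End Points.

Section LinearParameters.
Variables (K : fieldType) (n : nat).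
Hypothesis charK : [pchar K] =i pred0.
Variable I : {mpoly K[n]} -> Prop.
Hypothesis gI : gideal I.
Hypothesis I1 : ~ I 1.

(** A coordinate system of linear forms split into [c] forms given by [C] and
    [s] forms given by [L]; the matrix [A] is that of the substitution that
    reads the former as coordinates and sends the latter to 0. *)
Definition coordinates c s (A : 'M[K]_(n, c)) (B : 'M[K]_(n, s)) (C : 'M[K]_(c, n))
    (L : 'M[K]_(s, n)) : Prop :=
  [/\ (c + s)%N = n, A *m C + B *m L = 1%:M, C *m A = 1%:M, L *m B = 1%:M
    & C *m B = 0 /\ L *m A = 0].

Definition contains_powers c (A : 'M[K]_(n, c)) N : Prop :=
  forall i : 'I_c, lsub_image A I ('X_i ^+ N).

Lemma row_complete s (b : 'cV[K]_(1 + s)) : b != 0 ->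
  exists R : 'M[K]_(1 + s), R \in unitmx /\ lsubmx R = b.
Proof.
move=> nz; pose e : 'rV[K]_(1 + s) := delta_mx 0 0.
have e1 : e *m (delta_mx 0 0 : 'cV[K]_(1 + s)) = 1%:M.
  by rewrite mul_delta_mx; apply/matrixP => i j; rewrite !ord1 !mxE !eqxx.
have Ub : e *m ((delta_mx 0 0 : 'cV[K]_(1 + s)) *m b^T) = b^T by rewrite mulmxA e1 mul1mx.
have [|g ug Ug] := @complete_unitmx _ 1 (1 + s) e ((delta_mx 0 0 : 'cV[K]_(1 + s)) *m b^T).
  rewrite Ub mxrank_tr mxrank_delta.
  apply/eqP; rewrite eqn_leq rank_leq_col /= lt0n mxrank_eq0 nz //.
exists g^T; split; first by rewrite unitmx_tr.
apply/colP => i; rewrite !mxE.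
have /rowP /(_ i) := Ug; rewrite Ub -rowE !mxE => ->; congr (g _ i).
by apply: val_inj.
Qed.

(** A nonzero vector [b] of coefficients, completed to a basis, provides the
    coordinates in which the parameters become [b] times a new coordinate. *)
Lemma coordinates_refine c s (A : 'M[K]_(n, c)) (B : 'M[K]_(n, 1 + s)) (C : 'M[K]_(c, n))
    (L : 'M[K]_(1 + s, n)) (b : 'cV[K]_(1 + s)) : b != 0 ->
  coordinates A B C L -> exists B' C' L',
    @coordinates (c + 1) s (row_mx A (B *m b)) B' C' L'.
Proof.
move=> nz [cs ACBL CA LB [CB LA]].
have [R [uR Rb]] := row_complete nz.
pose Q := invmx R; have QR : Q *m R = 1%:M by apply: mulVmx.
have RQ : R *m Q = 1%:M by apply: mulmxV.
move: QR RQ; rewrite -[R]hsubmxK -[Q]vsubmxK Rb mul_row_col mul_col_row.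
move: (rsubmx R) (usubmx Q) (dsubmx Q) => R2 Q1 Q2 + RQ.
rewrite (scalar_mx_block 1 s 1) => /eq_block_mx [Q11 Q12 Q21 Q22].
exists (B *m R2), (col_mx C (Q1 *m L)), (Q2 *m L); split.
- by rewrite -cs addnA.
- rewrite mul_row_col -!mulmxA -addrA -mulmxDr.
  by rewrite (mulmxA b) (mulmxA R2) -mulmxDl RQ mul1mx.
- rewrite mul_col_row CA (mulmxA C) CB mul0mx -(mulmxA Q1) LA mulmx0.
  by rewrite -(mulmxA Q1) (mulmxA L) LB mul1mx Q11 -scalar_mx_block.
- by rewrite -mulmxA (mulmxA L) LB mul1mx.
- split; first by rewrite mul_col_mx (mulmxA C) CB mul0mx -(mulmxA Q1) (mulmxA L) LB
  mul1mx Q12 col_mx0.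
  by rewrite mul_mx_row -(mulmxA Q2) LA mulmx0 -(mulmxA Q2) (mulmxA L) LB mul1mx Q21
    row_mx0.
Qed.

Lemma lsub_line s c (b : 'cV[K]_s) d (g : {mpoly K[s]}) : g \is d.-homog ->
  lsub (row_mx 0 b : 'M_(s, c + 1)) g = g.@[fun i => b i 0] *: 'X_(rshift c 0) ^+ d.
Proof.
move=> hg; rewrite {1}[g]mpolyE mevalE raddf_sum scaler_suml !big_seq.
apply: eq_bigr => m m_g; rewrite /= linearZ /= -scalerA; congr (_ *: _).
rewrite lsubX.
have lf i : linform (row_mx 0 b : 'M_(s, c + 1)) i = b i 0 *: 'X_(rshift c 0).
  rewrite /linform big_split_ord /= big_ord1 row_mxEr big1 ?add0r // => j _.
  by rewrite row_mxEl mxE scale0r.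
under eq_bigr do rewrite lf exprZn.
rewrite scaler_prod; congr (_ *: _).
by rewrite -(dhomog_mf hg m_g) /= mdegE expr_sum.
Qed.

(** The substitution on the right sends the last variable to 0. *)
Lemma drop_last c (q : {mpoly K[c + 1]}) :
  exists h, q = lsub (row_mx 1%:M 0 : 'M[K]_(c, c + 1))
    (lsub (col_mx 1%:M 0 : 'M[K]_(c + 1, c)) q) + h * 'X_(rshift c 0).
Proof.
rewrite lsub_comp; set E := (_ *m _).
have TM p q' h h' : p = lsub E p + h * 'X_(rshift c 0) ->
    q' = lsub E q' + h' * 'X_(rshift c 0) ->
    exists h'', p * q' = lsub E (p * q') + h'' * 'X_(rshift c 0).
  move=> e1 e2; exists (lsub E p * h' + h * q').
  by rewrite rmorphM /=; move: (lsub E p) (lsub E q') e1 e2 => u v -> ->; ring.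
elim/mpolyind: q => [|a m p _ _ [h IH]]; first by exists 0; rewrite raddf0 mul0r addr0.
suff [h' h'E] : exists h', 'X_[m] = lsub E 'X_[m] + h' * 'X_(rshift c 0).
  exists (a *: h' + h); rewrite linearP /= {1}h'E {1}IH scalerDr mulrDl scalerAl.
  by rewrite addrACA.
rewrite mpolyXE_id; elim/big_ind: _ => [||i _].
- by exists 0; rewrite rmorph1 mul0r addr0.
- by move=> x y [h1 e1] [h2 e2]; apply: TM e1 e2.
elim: (m i) => [|k [h1 IHk]]; first by exists 0; rewrite expr0 rmorph1 mul0r addr0.
rewrite exprS.
have [h2 e2] : exists h2, 'X_i = lsub E 'X_i + h2 * 'X_(rshift c 0).
  rewrite lsubXU /linform /E mul_col_row !(mul1mx, mulmx0, mul0mx).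
  rewrite -[i]splitK; case: (split i) => j /=.
    exists 0; rewrite mul0r addr0 big_split_ord /= [X in _ + X]big1 ?addr0 => [|l _];
      last first.
      by rewrite block_mxEur mxE scale0r.
    rewrite (bigD1 j) //= block_mxEul mxE eqxx scale1r big1 ?addr0 // => l ne.
    by rewrite block_mxEul mxE eq_sym (negbTE ne) scale0r.
  exists 1; rewrite ord1 mul1r big1 ?add0r // => l _.
  by rewrite -[l]splitK; case: (split l) => l' /=;
    rewrite ?block_mxEdl ?block_mxEdr mxE scale0r.
exact: TM e2 IHk.
Qed.

Lemma gideal_expB c (Q : {mpoly K[c]} -> Prop) a b d :
  gideal Q -> Q (a - b) -> Q (a ^+ d - b ^+ d).
Proof. by move=> [sQ _] Qab; rewrite subrXX mulrC; apply: (submodZ sQ). Qed.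

(** If a form in the parameters [L] lies in [I], one of the parameters can be
    traded: at a point [b] where the form does not vanish, sending the
    parameters to multiples of one new variable [t] maps the form to a nonzero
    multiple of a power of [t]. *)
Lemma trade_parameter c s (A : 'M[K]_(n, c)) (B : 'M[K]_(n, s)) (C : 'M[K]_(c, n))
    (L : 'M[K]_(s, n)) N (g : {mpoly K[s]}) :
  coordinates A B C L -> contains_powers A N -> g != 0 -> I (lsub L g) ->
  exists s' (A' : 'M[K]_(n, c + 1)) (B' : 'M[K]_(n, s')) C' L' N',
    coordinates A' B' C' L' /\ contains_powers A' N'.
Proof.
move=> co hN nz_g Ig.
have [d [h [hd nz_h Ih]]] : exists d (h : {mpoly K[s]}), [/\ h \is d.-homog, h != 0 & I
  (lsub L h)].
  have [d nz] : exists d, pihomog mdeg d g != 0.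
    apply: NNPP => none; case/eqP: nz_g.
    rewrite (pihomog_partitionE (leqnn (msize g))) big1 // => d _.
    by apply/eqP/negPn/negP => nz; apply: none; exists d.
  exists d, (pihomog mdeg d g); split=> //; first exact: pihomogP.
  by rewrite -pihomog_lsub; apply: gI.2.
have [b nz_b] : exists b, h.@[b] <> 0.
  apply: NNPP => none; case/eqP: nz_h; apply: (mpoly_nonroot charK) => b.
  by apply: NNPP => nz; apply: none; exists b.
have d_gt0 : (0 < d)%N.
  rewrite lt0n; apply: contra_not_neq I1 => d0.
  move: hd nz_h Ih; rewrite d0 homog_piE pihomog0E => /eqP <-.
  rewrite mpolyC_eq0 /lsub comp_mpolyC => nz /(submodZ gI.1 (h@_0%MM)^-1%:MP).
  by rewrite /GRing.scale /= -mpolyCM mulVf.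
pose bv := \col_i b i.
have nz_bv : bv != 0.
  apply: contra_not_neq nz_b => /colP b0.
  rewrite mevalE big_seq big1 // => m m_h; have dm := dhomog_mf hd m_h.
  have [i nz_i] : exists i, m i <> 0%N.
    apply: NNPP => none; move: d_gt0; rewrite -dm /= mdegE big1 // => i _.
    by apply: NNPP => nz; apply: none; exists i.
  have bi : b i = 0 by have := b0 i; rewrite !mxE.
  by rewrite (bigD1 i) //= bi expr0n; case: (m i) nz_i => // k _; rewrite mul0r mulr0.
have bvE i : bv i 0 = b i by rewrite mxE.
case: s B L g h hd nz_h Ih b nz_b bv bvE nz_bv co {nz_g Ig} =>
  [|s] B L g h hd nz_h Ih b nz_b bv bvE nz_bv co.
  by case/eqP: nz_bv; apply/colP => - [].
have [B' [C' [L' co']]] := coordinates_refine nz_bv co.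
exists s, (row_mx A (B *m bv)), B', C', L', (N * d + d)%N; split=> // i.
have [_ _ _ LB [CB LA]] := co.
have CA' : C' *m row_mx A (B *m bv) = 1%:M by case: co'.
have gQ := gideal_image CA' gI.
set t : 'I_(c + 1) := rshift c 0.
have Qt : lsub_image (row_mx A (B *m bv)) I ('X_t ^+ d).
  have -> : 'X_t ^+ d = (h.@[b])^-1%:MP * lsub (row_mx A (B *m bv)) (lsub L h).
    rewrite lsub_comp mul_mx_row LA mulmxA LB mul1mx.
    have -> : h.@[b] = h.@[fun i => bv i 0] by apply: meval_eq => j; rewrite bvE.
    rewrite (lsub_line _ _ hd) mul_mpolyC scalerA mulVf ?scale1r //.
    by apply/eqP; rewrite (@meval_eq _ _ _ b) // => j; rewrite bvE.
  by apply: (submodZ gQ.1); exists (lsub L h).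
rewrite -[i]splitK; case: (split i) => j /=; last first.
  by rewrite ord1 exprD; apply: (submodZ gQ.1).
have [p Ip pE] := hN j.
have [q qE] := drop_last (lsub (row_mx A (B *m bv)) p).
rewrite (lsub_comp (row_mx A (B *m bv)) (col_mx 1%:M 0)) mul_row_col in qE.
rewrite mulmx1 mulmx0 addr0 pE rmorphXn /= lsubXU in qE.
have lfE : linform (row_mx 1%:M 0 : 'M[K]_(c, c + 1)) j = 'X_(lshift 1 j).
  rewrite /linform big_split_ord /= [X in _ + X]big1 ?addr0 => [|l _]; last first.
    by rewrite row_mxEr mxE scale0r.
  rewrite (bigD1 j) //= row_mxEl mxE eqxx scale1r big1 ?addr0 // => l ne.
  by rewrite row_mxEl mxE eq_sym (negbTE ne) scale0r.
rewrite lfE in qE.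
have Qy : lsub_image (row_mx A (B *m bv)) I ('X_(lshift 1 j) ^+ N - (- q * 'X_t)).
  by rewrite mulNr opprK -qE; exists p.
have := gideal_expB d gQ Qy; rewrite -exprM exprMn => Qd.
rewrite exprD mulrC; apply: (submodZ gQ.1).
rewrite -['X_(lshift 1 j) ^+ _](subrK ((- q) ^+ d * 'X_t ^+ d)).
by apply: (submodD gQ.1) => //; apply: (submodZ gQ.1).
Qed.

(** With the number [c] of coordinates maximal, no parameter can be traded. *)
Lemma parameters_exist : exists c s (A : 'M[K]_(n, c)) (B : 'M[K]_(n, s))
    (C : 'M[K]_(c, n)) (L : 'M[K]_(s, n)) N,
  [/\ coordinates A B C L, contains_powers A N & forall g, I (lsub L g) -> g = 0].
Proof.
pose P k := exists c s (A : 'M[K]_(n, c)) (B : 'M[K]_(n, s))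
    (C : 'M[K]_(c, n)) (L : 'M[K]_(s, n)) N,
  [/\ coordinates A B C L, contains_powers A N & (c + k)%N = n].
have [|k [[c [s [A [B [C [L [N [co hN ck]]]]]]]] kmin]] := @nat_min P.
  exists n, 0%N, n, 0, 1%:M, 0, 1%:M, 0%N; split=> // [|[]//].
  split; rewrite ?mulmx1 ?mul0mx ?mulmx0 ?mul1mx ?add0r //.
  by rewrite [RHS]flatmx0.
exists c, s, A, B, C, L, N; split=> // g Ig; apply/eqP/negPn/negP => nz.
have [s' [A' [B' [C' [L' [N' [co' hN']]]]]]] := trade_parameter co hN nz Ig.
have [cs' _ _ _ _] := co'.
have /kmin : P s' by exists (c + 1)%N, s', A', B', C', L', N'.
lia.
Qed.

End LinearParameters.

(** * Dimensions of quotients *)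

Lemma nat_max (P : nat -> Prop) M : (exists n, P n) -> (forall n, P n -> (n <= M)%N) ->
  exists n, P n /\ forall m, P m -> (m <= n)%N.
Proof.
move=> [n0 Pn0] le_M.
have [|k [[n [Pn nk]] kmin]] := @nat_min (fun k => exists n, P n /\ (n + k)%N = M).
  by exists (M - n0)%N, n0; split=> //; rewrite subnKC ?le_M.
exists n; split=> // m Pm.
have /kmin : exists n', P n' /\ (n' + (M - m))%N = M.
  by exists m; split=> //; rewrite subnKC ?le_M.
by have := le_M m Pm; lia.
Qed.

Section Dimension.
Variables (K : fieldType) (n : nat).
Local Notation S := {mpoly K[n]}.
Implicit Types P N : S -> Prop.

Definition indep_mod N (T : finType) (b : T -> S) : Prop :=
  forall a : T -> K, N (\sum_k a k *: b k) -> forall k, a k = 0.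

Definition spans_mod P N (T : finType) (b : T -> S) : Prop :=
  forall p, P p -> exists a : T -> K, N (p - \sum_k a k *: b k).

Lemma sum_enum_val (V : nmodType) (T : finType) (F : T -> V) :
  \sum_(i < #|T|) F (enum_val i) = \sum_t F t.
Proof. by rewrite -(big_enum_val (A := T) F); apply: eq_bigl. Qed.

(** The matrix that expresses an independent family by a spanning one has no left
    kernel. *)
Lemma indep_le_spans P N (T T' : finType) (b : T -> S) (b' : T' -> S) :
  @submodule K S N -> (forall k, P (b k)) -> indep_mod N b -> spans_mod P N b' ->
  (#|T| <= #|T'|)%N.
Proof.
move=> sN Pb ind sp.
have /fun_choice [m mP] := fun k => sp _ (Pb k).
pose M := \matrix_(i < #|T|, j < #|T'|) m (enum_val i) (enum_val j).
have /negPn : ~~ ~~ (kermx M == 0).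
  apply/negP => /rowV0Pn [v /sub_kermxP vM /eqP]; apply; apply/rowP => i; rewrite mxE.
  have := ind (fun t => v 0 (enum_rank t)); move=> /(_ _ (enum_val i)).
  rewrite enum_valK; apply.
  have -> : \sum_t v 0 (enum_rank t) *: b t =
      \sum_t v 0 (enum_rank t) *: (b t - \sum_t' m t t' *: b' t').
    rewrite -[LHS]subr0; under [RHS]eq_bigr do rewrite scalerBr.
    rewrite sumrB; congr (_ - _).
    under eq_bigr do rewrite scaler_sumr.
    rewrite exchange_big big1 //= => t' _.
    under eq_bigr do rewrite scalerA.
    rewrite -scaler_suml -[X in X *: _](_ : (v *m M) 0 (enum_rank t') = _).
      by rewrite vM mxE scale0r.
    rewrite mxE -(sum_enum_val (fun t => v 0 (enum_rank t) * m t t')).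
    by apply: eq_bigr => j _; rewrite mxE enum_valK enum_rankK.
  by apply: (submod_sum sN) => t _; apply: (submodZ sN).
by rewrite kermx_eq0 /row_free => /eqP <-; apply: rank_leq_col.
Qed.

(** A largest independent family spans. *)
Lemma basis_exists P N (T' : finType) (b' : T' -> S) :
  @submodule K S N -> spans_mod P N b' ->
  exists h (b : 'I_h -> S), basis_mod P N b.
Proof.
move=> sN sp.
pose Q h := exists b : 'I_h -> S, (forall k, P (b k)) /\ indep_mod N b.
have [||h [[b [Pb ind]] hmax]] := @nat_max Q #|T'|.
- by exists 0%N, (fun=> 0); split=> [[]//|a _ []].
- by move=> h [b [Pb ind]]; have := indep_le_spans sN Pb ind sp; rewrite card_ord.
exists h, b; split=> // p Pp; apply: NNPP => none.
suff /hmax : Q h.+1 by rewrite ltnn.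
exists (fun k => if unlift ord0 k is Some j then b j else p); split.
  by move=> k; case: (unlift _ _).
move=> a; rewrite big_ord_recl unlift_none => Na.
have E : \sum_(i < h) a (lift ord0 i) *: (if unlift ord0 (lift ord0 i) is Some j then b
  j else p) =
   \sum_(i < h) a (lift ord0 i) *: b i by apply: eq_bigr => i _; rewrite liftK.
rewrite E in Na.
have a0 : a ord0 = 0.
  apply/eqP/negPn/negP => nz; apply: none.
  exists (fun i => - (a ord0)^-1 * a (lift ord0 i)).
  have := submodZ sN (a ord0)^-1 Na.
  rewrite scalerDr scalerA mulVf // scale1r scaler_sumr.
  rewrite -sumrN; congr (N (_ + _)); apply: eq_bigr => i _.
  by rewrite mulNr scaleNr opprK scalerA.
rewrite a0 scale0r add0r in Na.
move=> k; case: (unliftP ord0 k) => [j ->|-> //].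
exact: (ind (fun i => a (lift ord0 i))).
Qed.

Lemma dim_modE P N h (b : 'I_h -> S) :
  @submodule K S N -> basis_mod P N b -> dim_mod P N = h.
Proof.
move=> sN bb; have [] : exists b' : 'I_(dim_mod P N) -> S, basis_mod P N b'.
  by apply: (@epsilon_spec nat _ (fun h => exists b : 'I_h -> S, basis_mod P N b));
    exists h, b.
move=> b' [P' i' s']; case: bb => Pb ib sb.
have := indep_le_spans sN P' i' sb; have := indep_le_spans sN Pb ib s'.
by rewrite !card_ord => le1 le2; apply/eqP; rewrite eqn_leq le1 le2.
Qed.

Lemma dim_mod_basis P N (T' : finType) (b' : T' -> S) :
  @submodule K S N -> spans_mod P N b' ->
  exists b : 'I_(dim_mod P N) -> S, basis_mod P N b.
Proof. by move=> sN /(basis_exists sN) [h [b bb]]; rewrite (dim_modE sN bb); exists b. Qed.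

Lemma dim_mod_le P N (T' : finType) (b' : T' -> S) :
  @submodule K S N -> spans_mod P N b' -> (dim_mod P N <= #|T'|)%N.
Proof.
move=> sN sp; have [b [Pb ib _]] := dim_mod_basis sN sp.
by have := indep_le_spans sN Pb ib sp; rewrite card_ord.
Qed.

Lemma indep_le_dim_mod P N (T T' : finType) (b : T -> S) (b' : T' -> S) :
  @submodule K S N -> spans_mod P N b' ->
  (forall k, P (b k)) -> indep_mod N b -> (#|T| <= dim_mod P N)%N.
Proof.
move=> sN sp Pb ib; have [b2 [_ _ s2]] := dim_mod_basis sN sp.
by have := indep_le_spans sN Pb ib s2; rewrite card_ord.
Qed.

Lemma dim_mod_eqT P N (T : finType) (b : T -> S) :
  @submodule K S N -> (forall k, P (b k)) -> indep_mod N b -> spans_mod P N b ->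
  dim_mod P N = #|T|.
Proof.
move=> sN Pb ib sb; apply/eqP; rewrite eqn_leq (dim_mod_le sN sb).
exact: indep_le_dim_mod sb Pb ib.
Qed.

Lemma submod_ideal N : @submodule S S^o N -> @submodule K S N.
Proof.
move=> sN; split; first exact: (submod0 sN).
by move=> a u v Nu Nv; rewrite -mul_mpolyC; apply: (sN.2 a%:MP).
Qed.

(** * Hilbert functions *)

Definition hilb N d : nat := dim_mod (fun p => p \is d.-homog) N.

Lemma homog_spans N d : @submodule K S N ->
  spans_mod (fun p => p \is d.-homog) N (fun m : 'X_{1..n < d.+1} => 'X_[m] : S).
Proof.
move=> sN p hp; exists (fun m : 'X_{1..n < d.+1} => p@_m).
suff -> : p - \sum_(m : 'X_{1..n < d.+1}) p@_m *: 'X_[m] = 0 by apply: (submod0 sN).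
apply/eqP; rewrite subr_eq0 eq_sym; apply/eqP/mpolyP => m.
have [lt|ge] := ltnP (mdeg m) d.+1; first exact: (mcoeff_mpoly (fun m => p@_m)).
rewrite (dhomog_nemf_coeff hp) /=; last by rewrite gtn_eqF.
rewrite raddf_sum big1 //= => b _; rewrite mcoeffZ mcoeffX.
by case: eqP => [bm|]; rewrite ?mulr0 //; move: ge; rewrite -bm leqNgt bmdeg.
Qed.

Definition colon N (a : S) : S -> Prop := fun p => N (a * p).
Definition adjoin N (a : S) : S -> Prop := fun p => exists q r, N q /\ p = q + a * r.

Lemma adjoin_sub N a p : N p -> adjoin N a p.
Proof. by move=> Np; exists p, 0; rewrite mulr0 addr0. Qed.

Lemma adjoin_mem N a : N 0 -> adjoin N a a.
Proof. by move=> N0; exists 0, 1; rewrite mulr1 add0r. Qed.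

Lemma pihomogM d e (a p : S) : a \is e.-homog ->
  pihomog mdeg (d + e) (a * p) = a * pihomog mdeg d p.
Proof.
move=> /dhomog_zhomog ha; have := zcompM d%:Z p ha.
by rewrite mulrC -PoszD /= => ->; rewrite mulrC.
Qed.

Lemma pihomogM_low d e (a p : S) : a \is e.-homog -> (d < e)%N ->
  pihomog mdeg d (a * p) = 0.
Proof.
move=> /dhomog_zhomog ha lt; have := zcompM (d%:Z - e%:Z) p ha.
rewrite mulrC subrK /= => ->.
suff -> : zcomp (d%:Z - e%:Z) p = 0 by rewrite mul0r.
apply/mpolyP => m; rewrite mcoeff_zcomp mcoeff0; case: eqP => // h; lia.
Qed.

Lemma colon_gideal N a e : gideal N -> a \is e.-homog -> gideal (colon N a).
Proof.
move=> [sN gN] ha; split; first split.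
- by rewrite /colon mulr0; apply: (submod0 sN).
- move=> c u v Nu Nv; rewrite /colon mulrDr.
  have -> : a * (c *: (u : S^o)) = c *: (a * u : S^o) by rewrite /GRing.scale /= mulrCA.
  exact: sN.2.
- by move=> d p Np; rewrite /colon -(pihomogM d p ha); apply: gN.
Qed.

Lemma adjoin_gideal N a e : gideal N -> a \is e.-homog -> gideal (adjoin N a).
Proof.
move=> [sN gN] ha; split; first split.
- exact/adjoin_sub/(submod0 sN).
- move=> c _ _ [q [r [Nq ->]]] [q' [r' [Nq' ->]]].
  exists (c * q + q'), (c * r + r'); split; first exact: sN.2.
  by rewrite /GRing.scale /=; ring.
- move=> d _ [q [r [Nq ->]]]; have [le|lt] := leqP e d; last first.
    by rewrite raddfD /= (pihomogM_low r ha lt) addr0; apply/adjoin_sub/gN.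
  exists (pihomog mdeg d q), (pihomog mdeg (d - e) r); split; first exact: gN.
  by rewrite raddfD /= -(pihomogM _ r ha) subnK.
Qed.

(** Additivity along multiplication by [a] on [S / N]. *)
Lemma hilb_adjoin N a e d : gideal N -> a \is e.-homog ->
  hilb N (d + e) = (hilb (colon N a) d + hilb (adjoin N a) (d + e))%N.
Proof.
move=> gN ha; have sN := submod_ideal gN.1.
have gC := colon_gideal gN ha; have gA := adjoin_gideal gN ha.
have [b1 [P1 i1 s1]] := dim_mod_basis (submod_ideal gC.1) (homog_spans (d:=d)
  (submod_ideal gC.1)).
have [b2 [P2 i2 s2]] := dim_mod_basis (submod_ideal gA.1) (homog_spans (d:=(d + e)%N)
  (submod_ideal gA.1)).
rewrite -/(hilb _ _) in b1 P1 i1 s1 *; rewrite -/(hilb _ _) in b2 P2 i2 s2 *.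
pose b (t : 'I_(hilb (colon N a) d) + 'I_(hilb (adjoin N a) (d + e))) : S :=
  match t with inl i => a * b1 i | inr j => b2 j end.
have sumE (f : _ -> K) : \sum_t f t *: b t =
    a * (\sum_i f (inl i) *: b1 i) + \sum_j f (inr j) *: b2 j.
  by rewrite big_sumType mulr_sumr; congr (_ + _); apply: eq_bigr => i _; rewrite scalerAr.
transitivity #|{: 'I_(hilb (colon N a) d) + 'I_(hilb (adjoin N a) (d + e))}|; last first.
  by rewrite card_sum !card_ord.
apply: (@dim_mod_eqT _ _ _ b) => //.
- by case=> i /=; [rewrite addnC; apply: dhomogM | apply: P2].
- move=> f; rewrite sumE => Nf.
  have f2 : forall j, f (inr j) = 0.
    apply: (i2 (fun j => f (inr j))).
    exists (a * (\sum_i f (inl i) *: b1 i) + \sum_j f (inr j) *: b2 j), (- \sum_i f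
      (inl i) *: b1 i).
    by split=> //; rewrite mulrN addrAC subrr add0r.
  have f1 : forall j, f (inl j) = 0.
    apply: (i1 (fun j => f (inl j))); move: Nf; rewrite [X in _ + X]big1 ?addr0 //.
    by move=> j _; rewrite f2 scale0r.
  by case.
- move=> p hp; have [f2 [q [r [Nq e2]]]] := s2 p hp.
  have [f1 h1] := s1 (pihomog mdeg d r) (pihomogP _ _ _).
  exists (fun t => match t with inl i => f1 i | inr j => f2 j end).
  rewrite sumE; set u := \sum_i _; set v := \sum_j _.
  have hv : v \is (d + e).-homog by apply: rpred_sum => j _; apply: rpredZ; apply: P2.
  have -> : p - (a * u + v) = pihomog mdeg (d + e) q + a * (pihomog mdeg d r - u).
    have : pihomog mdeg (d + e) (p - v) = pihomog mdeg (d + e) (q + a * r) by rewrite e2.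
    rewrite raddfB raddfD /= (pihomog_dE hp) (pihomog_dE hv) (pihomogM d r ha) => e3.
    by rewrite opprD addrCA addrC e3 mulrBr addrA.
  by apply: (submodD gN.1); [apply: gN.2 | exact: h1].
Qed.

Lemma hilb_adjoin_low N a e d : gideal N -> a \is e.-homog -> (d < e)%N ->
  hilb N d = hilb (adjoin N a) d.
Proof.
move=> gN ha lt; have sN := submod_ideal gN.1.
have gA := adjoin_gideal gN ha.
have [b [Pb ib sb]] := dim_mod_basis (submod_ideal gA.1) (homog_spans (d:=d)
  (submod_ideal gA.1)).
apply: (@dim_modE _ _ _ b) => //.
have AN p : p \is d.-homog -> adjoin N a p -> N p.
  move=> hp [q [r [Nq pE]]]; rewrite -(pihomog_dE hp) pE raddfD /=.
  by rewrite (pihomogM_low r ha lt) addr0; apply: gN.2.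
have hs f : \sum_k f k *: b k \is d.-homog.
  by apply: rpred_sum => k _; apply: rpredZ; apply: Pb.
split=> // [f Nf|p hp]; first by apply: ib; apply: adjoin_sub.
have [f Af] := sb p hp; exists f; apply: AN => //.
by rewrite rpredB //; apply: hs.
Qed.

Lemma hilb0 N d : @submodule K S N -> (forall p, p \is d.-homog -> N p) -> hilb N d = 0%N.
Proof.
move=> sN h; apply/eqP; rewrite -leqn0.
have := @dim_mod_le (fun p => p \is d.-homog) N void (fun=> 0) sN.
rewrite card_void; apply => p hp; exists (fun=> 0).
by rewrite big_pred0 ?subr0; [apply: h | case].
Qed.

(** * Noetherian induction on graded ideals *)

(** A counterexample would start a strictly ascending sequence of graded ideals,
    whose union is finitely generated. *)
Lemma gideal_ind (Phi : (S -> Prop) -> Prop) :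
  (forall N, gideal N ->
    (forall N', gideal N' -> (forall p, N p -> N' p) -> (exists p, N' p /\ ~ N p) ->
      Phi N') ->
    Phi N) ->
  forall N, gideal N -> Phi N.
Proof.
move=> step N0 g0; apply: NNPP => nPhi.
pose P (i : nat) N := gideal N /\ ~ Phi N.
pose Q (i : nat) (N N' : S -> Prop) := (forall p, N p -> N' p) /\ exists p, N' p /\ ~ N p.
have [||f fP] := @dependent_choice (fun=> S -> Prop) P Q; first by exists N0.
  move=> i N [gN nN]; apply: NNPP => none; apply: nN; apply: step => // N' gN' sub str.
  by apply: NNPP => nN'; apply: none; exists N'.
have mono i k p : f i p -> f (i + k)%N p.
  elim: k => [|k IH]; first by rewrite addn0.
  by move=> /IH h; rewrite addnS; case: (fP (i + k)%N) => _ [sub _]; apply: sub.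
pose U (v : 'rV[S]_1) := exists i, f i (v 0 0).
have [|m [G GP]] := @noetherian_mpoly K n 1 U.
  split; first by exists 0%N; rewrite mxE; apply: (submod0 (fP 0%N).1.1.1).
  move=> a u v [i fu] [j fv]; exists (i + j)%N; rewrite !mxE.
  apply: ((fP (i + j)%N).1.1.1.2 a); first exact: mono.
  by rewrite addnC; apply: mono.
have /fun_choice [ix ixP] : forall k, exists i, f i (G k 0).
  by move=> k; have [i] := spans_rows_row k GP; rewrite mxE; exists i.
pose M := (\max_k ix k)%N.
have [_ [_ [p [fp nfp]]]] := fP M.
apply: nfp; have /GP [w wE] : U p%:M by exists M.+1; rewrite mxE eqxx mulr1n.
have -> : p = \sum_k w 0 k * G k 0.
  by have /matrixP /(_ 0 0) := wE; rewrite !mxE eqxx mulr1n.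
have sM := (fP M).1.1.1.
apply: (submod_sum sM) => k _; apply: (submodZ sM).
rewrite -(subnKC (_ : ix k <= M)%N); first exact: mono.
exact: leq_bigmax.
Qed.

Definition hprime N : Prop := forall a b d e, a \is d.-homog -> b \is e.-homog ->
  N (a * b) -> N a \/ N b.

(** A graded ideal is prime on homogeneous elements, or lies strictly below two
    graded ideals between which its Hilbert function splits. *)
Lemma hprime_dichotomy N : gideal N -> hprime N \/
  exists a e, [/\ a \is e.-homog, exists p, adjoin N a p /\ ~ N p
    & exists p, colon N a p /\ ~ N p].
Proof.
move=> gN; case: (classic (hprime N)) => [|nh]; [by left | right].
apply: NNPP => none; apply: nh => a b d e ha hb Nab.
apply: NNPP => /not_or_and [na nb]; apply: none; exists a, d; split=> //.
  by exists a; split=> //; apply: adjoin_mem; apply: (submod0 gN.1).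
by exists b.
Qed.

(** For [a] outside a prime [N], the colon ideal is [N] itself. *)
Lemma hilb_colon_prime N a d e d' : gideal N -> hprime N -> a \is e.-homog -> ~ N a ->
  d' = (d + e)%N ->
  hilb N d' = (hilb N d + hilb (adjoin N a) d')%N.
Proof.
move=> gN hN ha na ->; rewrite (hilb_adjoin d gN ha); congr (_ + _)%N.
have gC := colon_gideal gN ha.
have [b [Pb ib sb]] := dim_mod_basis (submod_ideal gN.1) (homog_spans (d:=d)
  (submod_ideal gN.1)).
apply: (@dim_modE _ _ _ b); first exact: submod_ideal gC.1.
split=> // [f Cf|p hp].
  apply: ib; have [|//|//] := hN _ _ _ d ha _ Cf.
  by apply: rpred_sum => k _; apply: rpredZ; apply: Pb.
by have [f Nf] := sb p hp; exists f; apply: (submodZ gN.1).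
Qed.

Lemma maximal_hilb0 N d : gideal N -> (forall i, N 'X_i) -> (0 < d)%N -> hilb N d = 0%N.
Proof.
move=> gN NX d0; apply: hilb0; first exact: submod_ideal gN.1.
move=> p hp; rewrite [p]mpolyE big_seq; apply: (submod_sum (submod_ideal gN.1)) => m m_p.
apply: (submodZ (submod_ideal gN.1)).
have [i mi] : exists i, m i <> 0%N.
  apply: NNPP => none; move: d0; rewrite -(dhomog_mf hp m_p) /= mdegE big1 // => i _.
  by apply: NNPP => nz; apply: none; exists i.
have /submK <- : (U_(i) <= m)%MM by rewrite lep1mP; apply/eqP.
by rewrite mpolyXD; apply: (submodZ gN.1).
Qed.

End Dimension.

(** * Hilbert polynomials *)

(** The monomial [X ^ k] is, up to a factor and lower terms, the difference of
    [X ^ (k + 1)]. *)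
Lemma poly_antidifference (q : {poly rat}) :
  exists p : {poly rat}, forall x, p.[x + 1] - p.[x] = q.[x].
Proof.
suff /fun_choice [f fP] : forall k, exists p : {poly rat}, forall x, p.[x + 1] - p.[x]
  = x ^+ k.
  exists (\sum_(i < size q) q`_i *: f i) => x.
  rewrite !horner_sum -sumrB [in RHS](horner_coef q); apply: eq_bigr => i _.
  by rewrite !hornerZ -mulrBr fP.
elim/ltn_ind => k IH.
have /fun_choice [g gP] : forall j : 'I_k, exists p : {poly rat}, forall x, p.[x + 1] -
  p.[x] = x ^+ j.
  by move=> j; apply: IH.
exists (k.+1%:R^-1 *: ('X^(k.+1) - \sum_(j < k) 'C(k.+1, j)%:R *: g j)) => x.
have e1 : (x + 1) ^+ k.+1 = \sum_(j < k) 'C(k.+1, j)%:R * x ^+ j + k.+1%:R * x ^+ k + x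
  ^+ k.+1.
  rewrite addrC exprDn 2!big_ord_recr /= binn binSn subnn !expr1n !mul1r mulr1n mulr_natl.
  by congr (_ + _ + _); apply: eq_bigr => j _; rewrite expr1n mul1r mulr_natl.
have e2 : (\sum_(j < k) 'C(k.+1, j)%:R *: g j).[x + 1] - (\sum_(j < k) 'C(k.+1, j)%:R
  *: g j).[x] =
    \sum_(j < k) 'C(k.+1, j)%:R * x ^+ j.
  rewrite !horner_sum -sumrB; apply: eq_bigr => j _.
  by rewrite !hornerZ -mulrBr gP.
rewrite !hornerZ -mulrBr !(hornerD, hornerN) !hornerXn e1 -e2.
have nz : k.+1%:R != 0 :> rat by rewrite pnatr_eq0.
apply: (mulfI nz); rewrite mulrA mulfV // mul1r.
by ring.
Qed.

Section HilbertPolynomial.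
Variables (K : fieldType) (n : nat).
Local Notation S := {mpoly K[n]}.

Lemma X_homog (i : 'I_n) : ('X_i : S) \is 1.-homog.
Proof. by rewrite dhomogX /= mdeg1. Qed.

(** If [N] is not prime, its Hilbert function is the sum of those of two larger
    ideals, one of them shifted.  If [N] is prime and does not contain the
    variable [X_i], its difference is the Hilbert function of [N + (X_i)]. *)
Lemma hilbert_poly_exists (N : S -> Prop) : gideal N ->
  exists P : {poly rat}, exists d0 : nat, forall d, (d0 <= d)%N -> P.[d%:R] = (hilb N d)%:R.
Proof.
move: N; apply: gideal_ind => N gN IH.
have [hN|[a [e [ha sA sC]]]] := hprime_dichotomy gN; last first.
  have [P1 [d1 h1]] := IH _ (adjoin_gideal gN ha) (@adjoin_sub _ _ N a) sA.
  have subC p : N p -> colon N a p by apply: (submodZ gN.1).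
  have [P2 [d2 h2]] := IH _ (colon_gideal gN ha) subC sC.
  exists (P1 + (P2 \Po ('X - e%:R%:P))), (d1 + d2 + e)%N => d le.
  have dE : d = (d - e + e)%N by lia.
  rewrite hornerD horner_comp !hornerE -natrB; last by lia.
  rewrite h1; last by lia.
  rewrite h2; last by lia.
  have := hilb_adjoin (d - e) gN ha; rewrite -dE => ->.
  by rewrite natrD addrC.
have [[i Xi]|allX] := classic (exists i, ~ N 'X_i); last first.
  exists 0, 1%N => d d_gt0; rewrite horner0 maximal_hilb0 // => i.
  by apply: NNPP => h; apply: allX; exists i.
have [|P1 [d1 h1]] := IH _ (adjoin_gideal gN (X_homog i)) (@adjoin_sub _ _ N 'X_i).
  by exists 'X_i; split=> //; apply: adjoin_mem; apply: (submod0 gN.1).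
have [p pP] := poly_antidifference (P1 \Po ('X + 1)).
pose c : rat := (hilb N d1)%:R - p.[d1%:R].
exists (p + c%:P), d1; elim=> [|d IHd].
  by rewrite leqn0 => /eqP e; rewrite hornerD hornerC /c e addrC subrK.
rewrite leq_eqVlt => /predU1P [e|le].
  by rewrite hornerD hornerC /c e addrC subrK.
rewrite (hilb_colon_prime gN hN (X_homog i) Xi (esym (addn1 d))) natrD -(IHd le) -h1;
  last exact: ltnW.
rewrite !hornerD !hornerC -natr1.
have := pP d%:R; rewrite horner_comp hornerD hornerX hornerC => <-.
by ring.
Qed.

End HilbertPolynomial.

(** * Bounds on the Hilbert function *)

Lemma monomials_of_degree s d : exists l : seq 'X_{1..s.+1},
  [/\ uniq l, size l = 'C(d + s, s) & forall m, (m \in l) = (mdeg m == d)].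
Proof.
exists [seq s2m t | t : d.-tuple 'I_s.+1 <- enum (basis s.+1 d)]; split.
- exact: uniq_basis.
- by rewrite size_basis -bin_sub ?leq_addr // addKn.
- by move=> m; rewrite -basis_cover.
Qed.

(** Homogenization by one more variable embeds these monomials into those of
    degree [D - 1] in [c + 1] variables. *)
Lemma card_monomials_below c D : (0 < D)%N ->
  (#|{: 'X_{1..c < D}}| <= 'C(D.-1 + c, c))%N.
Proof.
move=> D_gt0; have [l [ul sl memL]] := monomials_of_degree c D.-1.
pose f (m : 'X_{1..c < D}) : 'X_{1..c.+1} := (mnmwiden m + U_(ord_max) *+ (D.-1 - mdeg
  m))%MM.
have f_widen m i : f m (widen_ord (leqnSn c) i) = m i.
  rewrite /f mnmDE mulmnE mnm1E.
  have -> : (ord_max == widen_ord (leqnSn c) i) = false.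
    by rewrite -val_eqE /= gtn_eqF.
  by rewrite mul0n addn0 -[RHS]mnmwiden_widen.
have f_inj : injective f.
  by move=> m m' e; apply/val_inj/mnmP => i; rewrite -!f_widen e.
rewrite -sl cardT -(size_map f); apply: uniq_leq_size.
  by rewrite map_inj_uniq ?enum_uniq.
move=> _ /mapP [m _ ->]; rewrite memL /f mdegD mdegMn mdeg1 mul1n.
have -> : mdeg (mnmwiden m) = mdeg m.
  rewrite !mdegE big_ord_recr /= mnmwiden_ordmax addn0; apply: eq_bigr => i _.
  by rewrite -[RHS]mnmwiden_widen.
by rewrite subnKC // -ltnS prednK // bmdeg.
Qed.

Section Bounds.
Variables (K : fieldType) (n c s : nat).
Local Notation S := {mpoly K[n]}.
Variable I : S -> Prop.
Hypothesis gI : gideal I.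
Variables (A : 'M[K]_(n, c)) (B : 'M[K]_(n, s)) (C : 'M[K]_(c, n)) (L : 'M[K]_(s, n)).
Hypothesis co : coordinates A B C L.
Hypothesis L_inj : forall g, I (lsub L g) -> g = 0.
Variable D : nat.
Hypothesis high : forall e q, (D <= e)%N -> q \is e.-homog -> lsub_image A I q.

Let sI := submod_ideal gI.1.

Definition mnm_l (m : 'X_{1..c + s}) : 'X_{1..c} := [multinom m (lshift s i) | i < c].
Definition mnm_r (m : 'X_{1..c + s}) : 'X_{1..s} := [multinom m (rshift c i) | i < s].

Lemma mnm_lr_inj m m' : mnm_l m = mnm_l m' -> mnm_r m = mnm_r m' -> m = m'.
Proof.
move=> /mnmP e1 /mnmP e2; apply/mnmP => i; rewrite -[i]splitK.
by case: (split i) => j /=; [have := e1 j | have := e2 j]; rewrite !mnmE.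
Qed.

Lemma mdeg_lr m : mdeg m = (mdeg (mnm_l m) + mdeg (mnm_r m))%N.
Proof.
by rewrite !mdegE big_split_ord /=; congr (_ + _)%N; apply: eq_bigr => i _; rewrite mnmE.
Qed.

Lemma lsub_col k (C' : 'M[K]_(c, k)) (L' : 'M[K]_(s, k)) m :
  lsub (col_mx C' L') 'X_[m] = lsub C' 'X_[mnm_l m] * lsub L' 'X_[mnm_r m].
Proof.
rewrite !lsubX big_split_ord /=; congr (_ * _); apply: eq_bigr => i _; rewrite mnmE;
  congr (_ ^+ _); apply: eq_bigr => j _; by rewrite ?col_mxEu ?col_mxEd.
Qed.

(** That this holds for all [p] is the finiteness of [S / I] over the polynomial
    ring in the parameters. *)
Let gen (p : S) := exists f : 'X_{1..c < D} -> {mpoly K[s]},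
  I (p - \sum_(a : 'X_{1..c < D}) lsub C 'X_[a] * lsub L (f a)).

Let gen_sub : @submodule K S gen.
Proof.
split.
  exists (fun=> 0); rewrite big1 ?subr0; first exact: (submod0 sI).
  by move=> a _; rewrite raddf0 mulr0.
move=> x u v [f fP] [g gP]; exists (fun a => x *: f a + g a).
have -> : \sum_(a : 'X_{1..c < D}) lsub C 'X_[a] * lsub L (x *: f a + g a) =
    x *: (\sum_(a : 'X_{1..c < D}) lsub C 'X_[a] * lsub L (f a)) +
    \sum_(a : 'X_{1..c < D}) lsub C 'X_[a] * lsub L (g a).
  rewrite scaler_sumr -big_split; apply: eq_bigr => a _.
  by rewrite linearP mulrDr scalerAr.
by rewrite opprD addrACA -scalerBr; apply: sI.2.
Qed.

Let gen_mulL p h : gen p -> gen (p * lsub L h).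
Proof.
move=> [f fP]; exists (fun a => f a * h).
have -> : \sum_(a : 'X_{1..c < D}) lsub C 'X_[a] * lsub L (f a * h) =
    (\sum_(a : 'X_{1..c < D}) lsub C 'X_[a] * lsub L (f a)) * lsub L h.
  by rewrite mulr_suml; apply: eq_bigr => a _; rewrite rmorphM mulrA.
by rewrite -mulrBl mulrC; apply: (submodZ gI.1).
Qed.

Let gen_I p : I p -> gen p.
Proof.
move=> Ip; exists (fun=> 0); rewrite big1 ?subr0 // => a _.
by rewrite raddf0 mulr0.
Qed.

(** A monomial of degree at least [D] in the coordinates is, modulo [I], a
    combination of products with at least one parameter. *)
Let gen_mon (m : 'X_{1..c}) : gen (lsub C 'X_[m]).
Proof.
have [k] := ubnP (mdeg m); elim: k m => // k IH m lt_mk.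
case: co => cs ACBL CA LB [CB LA].
have [lt|ge] := ltnP (mdeg m) D.
  exists (fun a => if a == BMultinom lt then 1 else 0).
  rewrite (bigD1 (BMultinom lt)) //= eqxx rmorph1 mulr1 big1 => [|a /negbTE ->].
    by rewrite addr0 subrr; apply: (submod0 sI).
  by rewrite raddf0 mulr0.
have hX : ('X_[m] : {mpoly K[c]}) \is (mdeg m).-homog by rewrite dhomogX.
have [p0 Ip0 p0E] := high ge hX.
pose p := pihomog mdeg (mdeg m) p0.
have Ip : I p by apply: gI.2.
have pE : lsub A p = 'X_[m] by rewrite -pihomog_lsub p0E pihomog_dE.
pose w := lsub C 'X_[m] - p.
have hw : w \is (mdeg m).-homog.
  by rewrite rpredB ?lsub_homog //; apply: pihomogP.
have Aw : lsub A w = 0 by rewrite raddfB /= lsub_comp CA lsub1 pE subrr.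
rewrite -[lsub C _](subrK p) addrC; apply: (submodD gen_sub); first exact: gen_I.
rewrite -/w; pose w' := lsub (row_mx A B) w.
have wE : w = lsub (col_mx C L) w' by rewrite /w' lsub_comp mul_row_col ACBL lsub1.
have hw' : w' \is (mdeg m).-homog by apply: lsub_homog.
rewrite wE [w']mpolyE raddf_sum big_seq; apply: (submod_sum gen_sub) => b b_w.
rewrite /= linearZ /=; apply: (submodZ gen_sub).
rewrite lsub_col; apply/gen_mulL/IH.
have db : mdeg b = mdeg m := dhomog_mf hw' b_w.
have [r0|r_gt0] := posnP (mdeg (mnm_r b)); last first.
  apply: (@leq_trans (mdeg m)); last by rewrite -ltnS.
  by rewrite -db mdeg_lr -addn1 leq_add2l.
suff : w'@_b = 0 by move/eqP; rewrite mcoeff_eq0 b_w.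
have {}r0 : mnm_r b = 0%MM by apply/eqP; rewrite -mdeg_eq0 r0.
have : (lsub A w)@_(mnm_l b) = w'@_b.
  rewrite wE lsub_comp mul_col_mx CA LA lsub_sum raddf_sum /=.
  rewrite (bigD1_seq b) ?msupp_uniq //= mcoeffZ lsub_col lsub1 r0.
  rewrite mpolyX0 rmorph1 mulr1 mcoeffX eqxx mulr1 big1 ?addr0 // => b' ne.
  rewrite mcoeffZ lsub_col lsub1.
  have [r0'|nz] := eqVneq (mnm_r b') 0%MM.
    rewrite r0' mpolyX0 rmorph1 mulr1 mcoeffX.
    case: eqP => [e|]; last by rewrite mulr0.
    by case/eqP: ne; apply: mnm_lr_inj; rewrite // r0 r0'.
  have -> : lsub (0 : 'M[K]_(s, c)) 'X_[mnm_r b'] = 0; last by rewrite mulr0 mcoeff0 mulr0.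
  have [i nz_i] : exists i, mnm_r b' i <> 0%N.
    apply: NNPP => none; case/eqP: nz; apply/mnmP => i; rewrite mnm0E.
    by apply: NNPP => h; apply: none; exists i.
  rewrite lsubX (bigD1 i) //= {1}/linform big1 => [|j _]; last by rewrite mxE scale0r.
  by rewrite expr0n; case: (mnm_r b' i) nz_i => // k' _; rewrite mul0r.
by rewrite Aw mcoeff0 => <-.
Qed.

Let gen_all p : gen p.
Proof.
case: co => _ ACBL _ _ _.
have -> : p = lsub (col_mx C L) (lsub (row_mx A B) p) by rewrite lsub_comp mul_row_col
  ACBL lsub1.
move: (lsub _ p) => q; rewrite [q]mpolyE raddf_sum; apply: (submod_sum gen_sub) => b _.
by rewrite /= linearZ /=; apply: (submodZ gen_sub); rewrite lsub_col;
  apply/gen_mulL/gen_mon.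
Qed.

Lemma param_generate d (p : S) : p \is d.-homog -> exists f : 'X_{1..c < D} -> {mpoly K[s]},
  (forall a : 'X_{1..c < D}, zhomog (d%:Z - (mdeg a)%:Z) (f a)) /\
  I (p - \sum_(a : 'X_{1..c < D}) lsub C 'X_[a] * lsub L (f a)).
Proof.
move=> hp; have [f fP] := gen_all p.
exists (fun a : 'X_{1..c < D} => zcomp (d%:Z - (mdeg a)%:Z) (f a)); split;
  first by move=> a; apply: zhomog_zcomp.
have -> : p - \sum_(a : 'X_{1..c < D}) lsub C 'X_[a] * lsub L (zcomp (d%:Z - (mdeg
  a)%:Z) (f a)) =
    pihomog mdeg d (p - \sum_(a : 'X_{1..c < D}) lsub C 'X_[a] * lsub L (f a)).
  rewrite [RHS]raddfB /= (pihomog_dE hp); congr (_ - _).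
  rewrite [RHS]raddf_sum; apply: eq_bigr => a _ /=.
  have hX : zhomog (mdeg a)%:Z (lsub C 'X_[a]) by apply/dhomog_zhomog/lsubX_homog.
  have := zcompM (d%:Z - (mdeg a)%:Z) (lsub L (f a)) hX.
  rewrite subrK mulrC /= => ->; rewrite mulrC; congr (_ * _).
  case: (d%:Z - _) => e /=; last by rewrite raddf0.
  by rewrite pihomog_lsub.
exact: gI.2.
Qed.

Lemma spans_all : s = 0%N ->
  spans_mod (fun=> True) I (fun a : 'X_{1..c < D} => lsub C 'X_[a]).
Proof.
move=> s0 p _; have [f fP] := gen_all p; exists (fun a => (f a)@_0%MM).
rewrite (eq_bigr (fun a : 'X_{1..c < D} => lsub C 'X_[a] * lsub L (f a))) // => a _.
by rewrite {2}(nvar0_mpolyC_eq (f a) s0) /lsub comp_mpolyC -/(lsub _ _) mulrC mul_mpolyC.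
Qed.

(** Shifting the monomials in the parameters by powers of the first parameter
    puts all coefficients in the same degree. *)
Lemma hilb_le s' (es : s = s'.+1) d : (0 < D)%N ->
  (hilb I d <= 'C(D.-1 + c, c) * 'C(d + s', s'))%N.
Proof.
move=> D_gt0; pose i0 : 'I_s := cast_ord (esym es) ord0.
have [l' [ul' sl' memL']] : exists l : seq 'X_{1..s},
    [/\ uniq l, size l = 'C(d + s', s') & forall m, (m \in l) = (mdeg m == d)].
  by rewrite es; apply: monomials_of_degree.
pose sh (a : 'X_{1..c < D}) := (U_(i0) *+ mdeg a)%MM.
pose b (t : 'X_{1..c < D} * 'I_(size l')) : S :=
  let m := nth 0%MM l' t.2 in
  if (sh t.1 <= m)%MM then lsub C 'X_[t.1] * lsub L 'X_[m - sh t.1] else 0.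
have sp : spans_mod (fun p => p \is d.-homog) I b.
  move=> p /param_generate [f [hf Ip]].
  exists (fun t : 'X_{1..c < D} * 'I_(size l') => (f t.1)@_(nth 0%MM l' t.2 - sh t.1)).
  rewrite -(pair_bigA _ (fun (a : 'X_{1..c < D}) (j : 'I_(size l')) =>
    (f a)@_(nth 0%MM l' j - sh a) *: b (a, j))) /=.
  suff E a : \sum_(j < size l') (f a)@_(nth 0%MM l' j - sh a) *: b (a, j) =
      lsub C 'X_[a] * lsub L (f a) by rewrite (eq_bigr _ (fun a _ => E a)).
  have fE : f a = \sum_(m <- l') if (sh a <= m)%MM then (f a)@_(m - sh a) *: 'X_[m - sh
    a] else 0.
    apply/mpolyP => m; rewrite raddf_sum /=.
    have [fm0|nz] := eqVneq ((f a)@_m) 0.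
      rewrite fm0 big1 // => m' _; case: ifP => _; last by rewrite mcoeff0.
      by rewrite mcoeffZ mcoeffX; case: eqP => [->|]; rewrite ?fm0 ?mul0r ?mulr0.
    have m_l : (m + sh a)%MM \in l'.
      rewrite memL' mdegD mdegMn mdeg1 mul1n.
      have /zhomogP h := hf a; case: (eqVneq (mdeg m)%:Z (d%:Z - (mdeg a)%:Z)) => [e|/h e].
        by apply/eqP; lia.
      by rewrite e eqxx in nz.
    rewrite (bigD1_seq (m + sh a)%MM) //= lem_addl addmK mcoeffZ mcoeffX eqxx mulr1.
    rewrite big1 ?addr0 // => m' ne; case: ifPn => [le|_]; last by rewrite mcoeff0.
    rewrite mcoeffZ mcoeffX; case: eqP => [e|]; rewrite ?mulr0 //.
    by case/eqP: ne; rewrite -e submK.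
  rewrite {2}fE raddf_sum mulr_sumr (big_nth 0%MM) big_mkord; apply: eq_bigr => j _.
  rewrite /b /=; case: ifP => _; last by rewrite scaler0 raddf0 mulr0.
  by rewrite linearZ /= scalerAr.
have := dim_mod_le sI sp; rewrite card_prod card_ord sl' => /leq_trans; apply.
by rewrite leq_mul2r card_monomials_below ?orbT.
Qed.

(** The monomials in the parameters are independent modulo [I]. *)
Lemma hilb_ge s' (es : s = s'.+1) d : ('C(d + s', s') <= hilb I d)%N.
Proof.
have [l [ul sl memL]] : exists l : seq 'X_{1..s},
    [/\ uniq l, size l = 'C(d + s', s') & forall m, (m \in l) = (mdeg m == d)].
  by rewrite es; apply: monomials_of_degree.
rewrite -sl -[size l]card_ord.
apply: (indep_le_dim_mod sI (homog_spans (d:=d) sI) (b := fun j =>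
  lsub L 'X_[nth 0%MM l (j : 'I_(size l))])).
  move=> j; have : nth 0%MM l j \in l by apply: mem_nth.
  by rewrite memL => /eqP <-; apply: lsubX_homog.
move=> f If j.
have /L_inj : I (lsub L (\sum_j f j *: 'X_[nth 0%MM l (j : 'I_(size l))])).
  by rewrite raddf_sum; under eq_bigr do rewrite /= linearZ.
move=> /mpolyP /(_ (nth 0%MM l j)); rewrite mcoeff0 raddf_sum (bigD1 j) //=.
rewrite mcoeffZ mcoeffX eqxx mulr1 big1 ?addr0 // => j' ne.
rewrite mcoeffZ mcoeffX nth_uniq // (inj_eq val_inj) (negbTE ne) mulr0 //.
Qed.

Lemma card_bmultinom_le k : (#|{: 'X_{1..s < k}}| <= k ^ s)%N.
Proof.
case: k => [|k].
  rewrite (eq_card0 (_ : {: 'X_{1..s < 0}} =i pred0)) // => m.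
  by have := bmdeg m.
pose f (m : 'X_{1..s < k.+1}) : {ffun 'I_s -> 'I_k.+1} := [ffun i => inord (m i)].
have le m i : (val (m : 'X_{1..s < k.+1}) i <= k)%N.
  rewrite -ltnS; apply: leq_ltn_trans (bmdeg m).
  by rewrite mdegE (bigD1 i) //= leq_addr.
have f_inj : injective f.
  move=> m m' /ffunP e; apply/val_inj/mnmP => i.
  by have := e i; rewrite !ffunE => /(congr1 val); rewrite /= !inordK ?ltnS ?le.
have := leq_card f f_inj; by rewrite card_ffun !card_ord.
Qed.

Lemma spans_low_degree k : exists (T : finType) (b : T -> S),
  spans_mod (fun p => (msize p <= k)%N) I b /\ (#|T| <= #|{: 'X_{1..c < D}}| * k ^ s)%N.
Proof.
exists ('X_{1..c < D} * 'X_{1..s < k})%type,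
  (fun t : 'X_{1..c < D} * 'X_{1..s < k} => lsub C 'X_[t.1] * lsub L 'X_[t.2]).
split; last by rewrite card_prod leq_mul2l card_bmultinom_le orbT.
move=> p le_pk.
have /fun_choice [f fP] : forall d : 'I_k, exists f : 'X_{1..c < D} -> {mpoly K[s]},
  (forall a : 'X_{1..c < D}, zhomog (d%:Z - (mdeg a)%:Z) (f a)) /\
  I (pihomog mdeg d p - \sum_(a : 'X_{1..c < D}) lsub C 'X_[a] * lsub L (f a)).
  by move=> d; apply/param_generate/pihomogP.
pose g (a : 'X_{1..c < D}) := \sum_d f d a.
have gs a : (msize (g a) <= k)%N.
  apply: leq_trans (msize_sum _ _ _) _; apply/bigmax_leqP => d _.
  rewrite msizeE; apply/bigmax_leqP_seq => m m_f _.
  by have := (fP d).1 a m m_f; have := ltn_ord d; lia.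
exists (fun t : 'X_{1..c < D} * 'X_{1..s < k} => (g t.1)@_t.2).
rewrite -(pair_bigA _ (fun (a : 'X_{1..c < D}) (m : 'X_{1..s < k}) =>
  (g a)@_m *: (lsub C 'X_[a] * lsub L 'X_[m]))) /=.
have -> : \sum_(a : 'X_{1..c < D}) \sum_(m : 'X_{1..s < k}) (g a)@_m *: (lsub C 'X_[a]
  * lsub L 'X_[m]) =
    \sum_d \sum_(a : 'X_{1..c < D}) lsub C 'X_[a] * lsub L (f d a).
  rewrite [RHS]exchange_big; apply: eq_bigr => a _ /=.
  rewrite -mulr_sumr -raddf_sum /= -/(g a) {2}(mpolywE (gs a)) raddf_sum mulr_sumr.
  by apply: eq_bigr => m _; rewrite /= linearZ /= scalerAr.
rewrite {1}(pihomog_partitionE le_pk) -sumrB; apply: (submod_sum sI) => d _.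
exact: (fP d).2.
Qed.

End Bounds.

(** * Ideals and growth *)

Lemma bin_growth m l : (m.+1 ^ l <= l`! * 'C(m + l, l))%N.
Proof.
rewrite mulnC bin_ffact; elim: l => [|l IH]; first by rewrite expn0 ffactn0.
rewrite addnS ffactnS expnS leq_mul //=; first by rewrite ltnS leq_addr.
Qed.

Section Growth.
Variables (K : fieldType) (n : nat).
Local Notation S := {mpoly K[n]}.
Implicit Types (N P Q : S -> Prop).

Definition prime_ideal P : Prop :=
  [/\ @submodule S S^o P, ~ P 1 & forall p q, P (p * q) -> P p \/ P q].

Definition prime_tower N l (P : nat -> S -> Prop) : Prop :=
  (forall i, (i <= l)%N -> prime_ideal (P i) /\ forall p, N p -> P i p) /\
  (forall i, (i < l)%N -> (forall p, P i p -> P i.+1 p) /\ exists p, P i.+1 p /\ ~ P i p).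

(** * Chains of primes are bounded by the growth *)

Definition indep_low P k h : Prop :=
  exists b : 'I_h -> S, (forall i, (msize (b i) <= k)%N) /\ indep_mod P b.

Lemma indep_low1 P k : @submodule S S^o P -> ~ P 1 -> (0 < k)%N -> indep_low P k 1.
Proof.
move=> sP P1 k_gt0; exists (fun=> 1); split=> [i|a]; first by rewrite msize1.
rewrite big_ord1 => Pa i; rewrite ord1; apply/eqP/negPn/negP => nz; apply: P1.
have := submodZ (submod_ideal sP) (a 0)^-1 Pa.
by rewrite scalerA mulVf // scale1r.
Qed.

(** If [f] lies in [Q] but not in the smaller prime [P], multiplication by [f]
    embeds [S / P] into the kernel of [S / P -> S / Q]. *)
Lemma indep_low_step P Q f E k h h' : prime_ideal P -> @submodule S S^o Q ->
  (forall p, P p -> Q p) -> Q f -> ~ P f -> (msize f <= E.+1)%N ->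
  indep_low Q (k + E) h -> indep_low P k h' -> indep_low P (k + E) (h' + h).
Proof.
move=> [sP P1 prP] sQ PQ Qf Pf szf [b [szb ib]] [b' [szb' ib']].
exists (fun t => match split t with inl i => f * b' i | inr j => b j end); split.
  move=> t; case: (split t) => i //.
  have [->|nz_f] := eqVneq f 0; first by rewrite mul0r msize0.
  have [->|nz_b] := eqVneq (b' i) 0; first by rewrite mulr0 msize0.
  rewrite msizeM //; have := szb' i; have := szf.
  by move: (mmeasure _ f) (mmeasure _ (b' i)) => u v; lia.
have fP p : P (f * p) -> P p by move=> /prP [].
move=> a; rewrite big_split_ord /=.
under eq_bigr do rewrite (unsplitK (inl _)).
under [X in _ + X]eq_bigr do rewrite (unsplitK (inr _)).
have -> : \sum_i a (lshift h i) *: (f * b' i) = f * \sum_i a (lshift h i) *: b' i.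
  by rewrite mulr_sumr; apply: eq_bigr => i _; rewrite scalerAr.
move=> Pa.
have a2 : forall j, a (rshift h' j) = 0.
  apply: (ib (fun j => a (rshift h' j))).
  have Qfu : Q (f * \sum_i a (lshift h i) *: b' i) by rewrite mulrC; apply: (submodZ sQ).
  by have := submodB sQ (PQ _ Pa) Qfu; rewrite addrAC subrr add0r.
have a1 : forall i, a (lshift h i) = 0.
  apply: (ib' (fun i => a (lshift h i))); apply: fP; move: Pa.
  by rewrite [X in _ + X]big1 ?addr0 // => j _; rewrite a2 scale0r.
by move=> t; rewrite -[t]splitK; case: (split t).
Qed.

(** From the top of the tower downwards: modulo the [i]-th prime from the top
    there are at least ['C(m + i, i)] independent elements of degree [m * E],
    by Pascal's rule and [indep_low_step]. *)
Lemma tower_growth N l (P : nat -> S -> Prop) : prime_tower N l P ->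
  exists E, forall i m, (i <= l)%N -> indep_low (P (l - i)%N) (m * E).+1 'C(m + i, i).
Proof.
move=> [prP incP].
have /fun_choice [f fP] : forall i : 'I_l, exists p, P i.+1 p /\ ~ P i p.
  by move=> i; have [_] := incP i (ltn_ord i).
pose E := (\max_i msize (f i))%N; exists E.
elim=> [|i IHi] m le_il.
  by rewrite subn0 bin0; have [[sP P1 _] _] := prP l (leqnn l); apply: indep_low1.
have [[sP P1 pP] _] := prP (l - i.+1)%N (leq_subr _ _).
have ltj : (l - i.+1 < l)%N by lia.
have jE : (l - i.+1).+1 = (l - i)%N by lia.
elim: m => [|m IHm]; first by rewrite add0n binn; apply: indep_low1.
have [[sQ _ _] _] := prP (l - i)%N (leq_subr _ _).
rewrite addSnnS addnS binS -addSnnS.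
have -> : (m.+1 * E).+1 = ((m * E).+1 + E)%N by rewrite mulSn; lia.
have [fQ fnP] := fP (Ordinal ltj); rewrite /= jE in fQ.
apply: (@indep_low_step _ (P (l - i)%N) (f (Ordinal ltj))) => //.
- by rewrite -jE; have [] := incP _ ltj.
- by apply: leqW; apply: (leq_bigmax (F := fun i => msize (f i)) (Ordinal ltj)).
- have -> : ((m * E).+1 + E = (m.+1 * E).+1)%N by rewrite mulSn; lia.
  by apply: IHi; apply: ltnW.
- by rewrite addnS in IHm.
Qed.

(** The number of independent elements grows with exponent [l], and is at most
    that of a spanning family, which grows with exponent [s]. *)
Lemma tower_length N l (P : nat -> S -> Prop) (X s : nat) : @submodule S S^o N ->
  prime_tower N l P ->
  (forall k, exists (T : finType) (b : T -> S),
    spans_mod (fun p => (msize p <= k)%N) N b /\ (#|T| <= X * k ^ s)%N) ->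
  (l <= s)%N.
Proof.
move=> sN tow sp; have [E growth] := tower_growth tow.
have le m : (m.+1 ^ l <= l`! * X * (E.+1) ^ s * m.+1 ^ s)%N.
  have [T [b [sb cT]]] := sp (m * E).+1.
  have := growth l m (leqnn l); rewrite subnn => - [b' [szb' ib']].
  have [[sP0 _ _] NP0] := tow.1 0%N (leq0n l).
  have sb' : spans_mod (fun p => (msize p <= (m * E).+1)%N) (P 0%N) b.
    by move=> p /sb [a Na]; exists a; apply: NP0.
  have := indep_le_spans (submod_ideal sP0) szb' ib' sb'; rewrite card_ord => le1.
  apply: leq_trans (bin_growth m l) _; rewrite -!mulnA leq_mul2l; apply/orP; right.
  apply: leq_trans le1 _; apply: leq_trans cT _; rewrite leq_mul2l; apply/orP; right.
  by rewrite -expnMn; case: (s) => // s'; rewrite leq_exp2r //; nia.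
rewrite leqNgt; apply/negP => lt_sl.
pose C := (l`! * X * E.+1 ^ s)%N.
have /leq_trans : (C.+1 ^ s.+1 <= C.+1 ^ l)%N by rewrite leq_pexp2l.
move=> /(_ _ (le C)); rewrite -/C expnS leq_pmul2r ?ltnn //.
by rewrite expn_gt0.
Qed.

(** * Chains of primes that reach the growth *)

Definition chilb N d : nat := \sum_(j < d.+1) hilb N j.

(** The Hilbert function of [S / N] grows with exponent at least [t - 1].  The
    cumulative function and the factor [d + 1] cover the case [t = 0], where the
    condition says that [N] is proper. *)
Definition big_growth N t : Prop :=
  ~ exists C, forall d, (d.+1 * chilb N d <= C * d.+1 ^ t)%N.

Lemma chilbS N d : chilb N d.+1 = (chilb N d + hilb N d.+1)%N.
Proof. by rewrite /chilb big_ord_recr. Qed.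

Lemma chilb_mono N d d' : (d <= d')%N -> (chilb N d <= chilb N d')%N.
Proof.
move=> /subnK <-; elim: (d' - d)%N => [//|k IH].
by rewrite addSn chilbS (leq_trans IH) ?leq_addr.
Qed.

Lemma chilb_adjoin_colon N a e d : gideal N -> a \is e.-homog ->
  (chilb N d <= chilb (colon N a) d + chilb (adjoin N a) d)%N.
Proof.
move=> gN ha; have [le|lt] := leqP e d; last first.
  apply: leq_trans (leq_addl _ _); apply: leq_sum => j _.
  by rewrite (hilb_adjoin_low gN ha) // (leq_ltn_trans _ lt) // -ltnS.
have low (j : nat) : (j < e)%N -> chilb N j = chilb (adjoin N a) j.
  by move=> lt; apply: eq_bigr => i _;
    rewrite (hilb_adjoin_low gN ha) // (leq_ltn_trans _ lt) // -ltnS.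
suff E k : (chilb N (k + e) <= chilb (colon N a) k + chilb (adjoin N a) (k + e))%N.
  rewrite -(subnK le); apply: leq_trans (E _) _.
  by rewrite leq_add2r chilb_mono // leq_addr.
elim: k => [|k IH]; last first.
  by rewrite addSn !chilbS -addSn (hilb_adjoin _ gN ha); lia.
rewrite add0n.
have -> : chilb (colon N a) 0 = hilb (colon N a) 0 by rewrite /chilb big_ord1.
have h0 := hilb_adjoin 0 gN ha; rewrite add0n in h0.
case: e ha low h0 {le} => [|e] ha low h0.
  by rewrite /chilb !big_ord1 h0.
by rewrite !chilbS low // h0; lia.
Qed.

Lemma big_growth_split N a e t : gideal N -> a \is e.-homog -> big_growth N t ->
  big_growth (colon N a) t \/ big_growth (adjoin N a) t.
Proof.
move=> gN ha bN; apply: NNPP => /not_or_and [/NNPP [C1 h1] /NNPP [C2 h2]].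
apply: bN; exists (C1 + C2)%N => d.
have := chilb_adjoin_colon d gN ha; have := h1 d; have := h2 d.
move: (chilb _ _) (chilb _ _) (chilb _ _) => u v w.
by move: (_ ^ _)%N => y; nia.
Qed.

(** If the product of [p] and [q] lies in [N], so does the product of their top
    components, hence one of these, which can be subtracted. *)
Lemma hprime_prime N : gideal N -> ~ N 1 -> hprime N -> prime_ideal N.
Proof.
move=> gN N1 hN; split=> //; first exact: gN.1.
suff H k : forall p q, (msize p + msize q <= k)%N -> N (p * q) -> N p \/ N q.
  by move=> p q; apply: H (leqnn _).
elim: k => [|k IH] p q.
  rewrite leqn0 addn_eq0 => /andP [/eqP p0 _] _; left.
  by move/eqP: p0; rewrite msize_poly_eq0 => /eqP ->; apply: (submod0 gN.1).
move=> le Npq.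
have [->|nz_p] := eqVneq p 0; first by left; apply: (submod0 gN.1).
have [->|nz_q] := eqVneq q 0; first by right; apply: (submod0 gN.1).
pose d := (msize p).-1; pose e := (msize q).-1.
have size_top (r : S) : r != 0 -> (msize (r - pihomog mdeg (msize r).-1 r)%R < msize r)%N.
  move=> nz; rewrite (mpolySpred _ nz) ltnS msizeE; apply/bigmax_leqP_seq => m m_r _.
  rewrite ltnNge; apply/negP => le_m.
  move: m_r; rewrite mcoeff_msupp mcoeffB mcoeff_pihomog.
  case: (mdeg m =P (msize r).-1) => [_|ne]; first by rewrite subrr eqxx.
  rewrite subr0 -mcoeff_msupp => /msize_mdeg_lt; rewrite (mpolySpred _ nz) ltnS => ge.
  by apply: ne; apply/eqP; rewrite eqn_leq ge.
have topM : N (pihomog mdeg d p * pihomog mdeg e q).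
  suff <- : pihomog mdeg (d + e) (p * q) = pihomog mdeg d p * pihomog mdeg e q by
    apply: gN.2.
  rewrite -{1}[p](subrK (pihomog mdeg d p)) mulrDl raddfD /= [(d + e)%N]addnC.
  rewrite (pihomogM e q (pihomogP _ d p)) [X in X + _](_ : _ = 0) ?add0r //.
  apply/mpolyP => m; rewrite mcoeff_pihomog mcoeff0; case: eqP => // dm.
  apply/memN_msupp_eq0/msize_mdeg_ge.
  have := size_top p nz_p; rewrite -/d.
  have [->|nz] := eqVneq (p - pihomog mdeg d p) 0; first by rewrite mul0r msize0.
  have dE : msize p = d.+1 := mpolySpred mdeg nz_p.
  have eE : msize q = e.+1 := mpolySpred mdeg nz_q.
  rewrite msizeM // dm dE eE; move: (mmeasure _ _) => u; lia.
have [Np|Nq] := hN _ _ _ _ (pihomogP _ d p) (pihomogP _ e q) topM.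
  have [||h|] := IH (p - pihomog mdeg d p) q.
  - by have := size_top p nz_p; rewrite -/d; lia.
  - by rewrite mulrBl; apply: (submodB gN.1) => //; rewrite mulrC; apply: (submodZ gN.1).
  - by left; rewrite -[p](subrK (pihomog mdeg d p)); apply: (submodD gN.1).
  - by right.
have [||h|h] := IH p (q - pihomog mdeg e q).
- by have := size_top q nz_q; rewrite -/e; lia.
- by rewrite mulrBr; apply: (submodB gN.1) => //; apply: (submodZ gN.1).
- by left.
- by right; rewrite -[q](subrK (pihomog mdeg e q)); apply: (submodD gN.1).
Qed.

Lemma big_growth_proper N t : gideal N -> big_growth N t -> ~ N 1.
Proof.
move=> gN bN N1; apply: bN; exists 0%N => d; rewrite /chilb big1 ?muln0 // => j _.
apply: hilb0; first exact: submod_ideal gN.1.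
by move=> p _; rewrite -[p]mulr1; apply: (submodZ gN.1).
Qed.

(** A graded ideal that is maximal among those of a given growth is prime. *)
Lemma big_growth_prime N t : gideal N -> big_growth N t ->
  exists P, [/\ gideal P, forall p, N p -> P p, hprime P & big_growth P t].
Proof.
move: N; apply: (gideal_ind (Phi := fun N => big_growth N t -> exists P,
  [/\ gideal P, forall p, N p -> P p, hprime P & big_growth P t])) => N gN IH bN.
have [hN|[a [e [ha sA sC]]]] := hprime_dichotomy gN; first by exists N.
have subC p : N p -> colon N a p by apply: (submodZ gN.1).
have [bC|bA] := big_growth_split gN ha bN.
  have [P [gP CP hP bP]] := IH _ (colon_gideal gN ha) subC sC bC.
  by exists P; split=> // p /subC/CP.
have [P [gP AP hP bP]] := IH _ (adjoin_gideal gN ha) (@adjoin_sub _ _ N a) sA bA.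
by exists P; split=> // p /(@adjoin_sub _ _ N a)/AP.
Qed.

(** The Hilbert function of a prime [P] with [X_i] not in [P] is the cumulative
    Hilbert function of [P + (X_i)]. *)
Lemma big_growth_cut P t : gideal P -> hprime P -> big_growth P t.+1 ->
  exists i : 'I_n, ~ P 'X_i /\ big_growth (adjoin P 'X_i) t.
Proof.
move=> gP hP bP.
have [i Xi] : exists i : 'I_n, ~ P 'X_i.
  apply: NNPP => none; apply: bP; exists (chilb P 0) => d.
  have -> : chilb P d = chilb P 0.
    elim: d => // d IH; rewrite chilbS IH (maximal_hilb0 gP) ?addn0 // => i.
    by apply: NNPP => h; apply: none; exists i.
  by rewrite mulnC leq_mul2l expnS leq_pmulr ?orbT // expn_gt0.
exists i; split=> // - [C hC]; apply: bP; exists C => d.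
have hE k : hilb P k = chilb (adjoin P 'X_i) k.
  elim: k => [|k IH].
    by rewrite /chilb big_ord1 (hilb_adjoin_low gP (X_homog K i)).
  by rewrite chilbS -IH (hilb_colon_prime gP hP (X_homog K i) Xi (esym (addn1 k))).
have le : (chilb P d <= d.+1 * chilb (adjoin P 'X_i) d)%N.
  rewrite -[d.+1 in X in (_ <= X)%N]card_ord -sum_nat_const; apply: leq_sum => j _.
  by rewrite hE chilb_mono // -ltnS.
apply: leq_trans (_ : d.+1 * (d.+1 * chilb (adjoin P 'X_i) d) <= _)%N.
  by rewrite leq_mul2l le orbT.
by rewrite expnS mulnCA leq_mul2l hC orbT.
Qed.

Lemma tower_exists t N : gideal N -> big_growth N t -> exists P : nat -> S -> Prop,
  prime_tower N t P.
Proof.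
elim: t N => [|t IH] N gN bN; have [P [gP NP hP bP]] := big_growth_prime gN bN.
  have pP := hprime_prime gP (big_growth_proper gP bP) hP.
  by exists (fun=> P).
have pP := hprime_prime gP (big_growth_proper gP bP) hP.
have [i [Xi bA]] := big_growth_cut gP hP bP.
have [Q [prQ incQ]] := IH _ (adjoin_gideal gP (X_homog K i)) bA.
exists (fun j => if j is j'.+1 then Q j' else P); split.
  move=> [|j] le; first by split.
  have [pQ AQ] := prQ j le; split=> // p /NP/(@adjoin_sub _ _ P 'X_i); exact: AQ.
move=> [|j] lt; last exact: incQ.
have [pQ AQ] := prQ 0%N (leq0n t); split=> [p /(@adjoin_sub _ _ P 'X_i)|]; first exact: AQ.
by exists 'X_i; split=> //; apply/AQ/adjoin_mem/(submod0 gP.1).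
Qed.

End Growth.

Local Open Scope quotient_scope.

(** * Prime ideals of the quotient ring *)

Section Quotient.
Variables (K : fieldType) (n : nat) (I : idealr {mpoly K[n]}).
Local Notation S := {mpoly K[n]}.
Local Notation Q := {ideal_quot I}.

Lemma pi_eqI (p q : S) : p - q \in I <-> \pi_Q p = \pi_Q q.
Proof. by rewrite Quotient.idealrBE; split=> [/eqP|/eqP]. Qed.

Lemma idealr_submodule : @submodule S S^o (fun p => p \in I).
Proof.
split; first exact: rpred0.
by move=> a u v Iu Iv; apply: rpredD => //; apply: idealMr.
Qed.

Lemma tower_prime_chain l (P : nat -> S -> Prop) :
  prime_tower (fun p => p \in I) l P -> exists Pq : nat -> {pred Q}, prime_chain l Pq.
Proof.
move=> [prP incP].
pose b (X : Prop) : bool := if excluded_middle_informative X then true else false.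
have bP X : reflect X (b X) by rewrite /b; case: excluded_middle_informative => h;
  constructor.
pose Pq i : {pred Q} := fun x => b (P i (repr x)).
have PqE i p : (i <= l)%N -> reflect (P i p) (\pi_Q p \in Pq i).
  move=> le; apply: (iffP (bP _)); have [[sP _ _] NP] := prP i le.
    have : repr (\pi_Q p) - p \in I by apply/pi_eqI; rewrite reprK.
    by move=> /NP h Pr; rewrite -[p](subKr (repr (\pi_Q p))); apply: (submodB sP).
  have : repr (\pi_Q p) - p \in I by apply/pi_eqI; rewrite reprK.
  by move=> /NP h Pp; rewrite -[repr _](subrK p); apply: (submodD sP).
exists Pq; split=> i lt.
  have [[sP P1 pP] NP] := prP i lt; split; first split.
  - by rewrite -[0](rmorph0 \pi_Q); apply/(PqE _ _ lt); apply: (submod0 sP).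
  - by rewrite -[1](rmorph1 \pi_Q); apply/negP => /(PqE _ _ lt).
  - move=> x u v; rewrite -[x]reprK -[u]reprK -[v]reprK =>
    /(PqE _ _ lt) Pu /(PqE _ _ lt) Pv.
    by rewrite -rmorphM -rmorphD; apply/(PqE _ _ lt); apply: (sP.2 _ _ _ Pu Pv).
  - move=> u v; rewrite -[u]reprK -[v]reprK -rmorphM => /(PqE _ _ lt) /pP [h|h].
      by apply/orP; left; apply/(PqE _ _ lt).
    by apply/orP; right; apply/(PqE _ _ lt).
have [sub [p [Pp nPp]]] := incP i lt; split.
  by move=> x; rewrite -[x]reprK => /(PqE _ _ (ltnW lt)) h; apply/(PqE _ _ lt); apply: sub.
exists (\pi_Q p); first exact/(PqE _ _ lt).
by apply/negP => /(PqE _ _ (ltnW lt)).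
Qed.

Lemma prime_chain_tower l (Pq : nat -> {pred Q}) : prime_chain l Pq ->
  prime_tower (fun p => p \in I) l (fun i p => \pi_Q p \in Pq i).
Proof.
move=> [prP incP]; split=> i lt.
  have [[P0 P1 PD] pP] := prP i lt; split; first split.
  - split; first by rewrite rmorph0.
    by move=> a u v Pu Pv; rewrite rmorphD rmorphM; apply: PD.
  - by rewrite rmorph1; apply/negP.
  - by move=> p q; rewrite rmorphM => /pP /orP.
  - move=> p Ip; have -> : \pi_Q p = 0; last exact: P0.
    by rewrite -(rmorph0 \pi_Q); apply/pi_eqI; rewrite subr0.
have [sub [x Px nPx]] := incP i lt; split=> [p|]; first exact: sub.
by exists (repr x); rewrite reprK; split=> //; apply/negP.
Qed.

Lemma krull_dimE s : (exists P, prime_tower (fun p => p \in I) s P) ->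
  (forall l P, prime_tower (fun p => p \in I) l P -> (l <= s)%N) ->
  krull_dim Q = s.
Proof.
move=> [P tow] le; apply: greatest_eq; split; first exact: tower_prime_chain tow.
by move=> l [Pq /prime_chain_tower /le].
Qed.

End Quotient.

(** * Leading coefficients *)

(** The bound [- e] away from 0 makes the induction work: [X] times a polynomial
    that is eventually below [- e] tends to minus infinity. *)
Lemma lead_coef_lt0 (p : {poly rat}) : lead_coef p < 0 ->
  exists e : rat, exists d0 : nat, 0 < e /\ forall d, (d0 <= d)%N -> p.[d%:R] <= - e.
Proof.
elim/poly_ind: p => [|p c IH]; first by rewrite lead_coef0 ltxx.
have [->|nz] := eqVneq p 0.
  rewrite mul0r add0r lead_coefC => c0; exists (- c), 0%N.
  by rewrite oppr_gt0 opprK; split=> // d _; rewrite hornerC.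
rewrite lead_coefDl ?size_polyC ?size_mulX //; last by case: (c != 0);
  rewrite // ltnS size_poly_gt0.
rewrite lead_coefMX => /IH [e [d0 [e0 h]]].
exists e, (d0 + (Num.bound `|(c + e) / e|%R))%N; split=> // d le.
rewrite hornerMXaddC.
have le1 : (c + e) / e <= d%:R.
  apply: le_trans (ler_norm _) _; apply: le_trans (ltW (archi_boundP (normr_ge0 _))) _.
  by rewrite ler_nat (leq_trans (leq_addl _ _) le).
have : p.[d%:R] * d%:R <= - e * d%:R by rewrite ler_wpM2r ?ler0n // h // (leq_trans
  (leq_addr _ _) le).
move: le1; rewrite ler_pdivrMr // => le1 le2.
by lra.
Qed.

Lemma lead_coef_ge0 (p : {poly rat}) :
  (exists d0 : nat, forall d, (d0 <= d)%N -> 0 <= p.[d%:R]) -> 0 <= lead_coef p.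
Proof.
move=> [d0 h]; rewrite leNgt; apply/negP => /lead_coef_lt0 [e [d1 [e0 h']]].
have := h (d0 + d1)%N (leq_addr _ _); have := h' (d0 + d1)%N (leq_addl _ _).
by lra.
Qed.

(** The polynomial that takes the value ['C(d + s, s)] at [d]. *)
Definition bin_poly (s : nat) : {poly rat} := s`!%:R^-1 *: \prod_(i < s) ('X - (-
  i.+1%:R)%:P).

Lemma bin_polyE s d : (bin_poly s).[d%:R] = 'C(d + s, s)%:R.
Proof.
have nz : s`!%:R != 0 :> rat by rewrite pnatr_eq0 -lt0n fact_gt0.
apply: (mulfI nz); rewrite hornerZ mulrA mulfV // mul1r -natrM mulnC bin_ffact.
elim: s {nz} => [|s IH]; first by rewrite big_ord0 hornerC.
rewrite big_ord_recr hornerM IH /= hornerXsubC opprK addnS ffactSS natrM mulrC.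
by rewrite -natrD addnS.
Qed.

Lemma bin_poly_size s : size (bin_poly s) = s.+1 /\ lead_coef (bin_poly s) = s`!%:R^-1.
Proof.
have nz : s`!%:R^-1 != 0 :> rat by rewrite invr_eq0 pnatr_eq0 -lt0n fact_gt0.
rewrite /bin_poly size_scale // lead_coefZ size_prod_XsubC; split.
  by rewrite /index_enum -enumT size_enum_ord.
by rewrite (monicP (monic_prod_XsubC _ _ _)) mulr1.
Qed.

(** A polynomial squeezed between two multiples of [bin_poly s] has degree [s],
    and its leading coefficient is squeezed accordingly. *)
Lemma lead_coef_squeeze (P : {poly rat}) (X s d0 : nat) :
  (forall d, (d0 <= d)%N -> 'C(d + s, s)%:R <= P.[d%:R] <= X%:R * 'C(d + s, s)%:R) ->
  s`!%:R * lead_coef P <= X%:R.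
Proof.
move=> h; have [szB lcB] := bin_poly_size s.
set B := bin_poly s in szB lcB.
have lo : 0 <= lead_coef (P - B).
  apply: lead_coef_ge0; exists d0 => d /h /andP [h1 _].
  by rewrite hornerD hornerN bin_polyE subr_ge0.
have hi : 0 <= lead_coef (X%:R *: B - P).
  apply: lead_coef_ge0; exists d0 => d /h /andP [_ h2].
  by rewrite hornerD hornerN hornerZ bin_polyE subr_ge0.
have fact0 : 0 < s`!%:R :> rat by rewrite ltr0n fact_gt0.
have szXB : (size (X%:R *: B)%R <= s.+1)%N by rewrite (leq_trans (size_scale_leq _ _)) ?szB.
have [lt|] := ltnP (size P) s.+1.
  have : lead_coef (P - B) = - s`!%:R^-1.
    have lt' : (size P < size (- B)%R)%N by rewrite size_polyN szB.
    by rewrite addrC (lead_coefDl lt') lead_coefN lcB.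
  by move=> e; move: lo; rewrite e oppr_ge0 invr_le0 leNgt fact0.
rewrite leq_eqVlt => /predU1P [szP|gt]; last first.
  have e1 : lead_coef (P - B) = lead_coef P by rewrite lead_coefDl // size_polyN szB.
  have e2 : lead_coef (X%:R *: B - P) = - lead_coef P.
    by rewrite addrC lead_coefDl ?lead_coefN // size_polyN; apply: leq_ltn_trans gt.
  have : lead_coef P = 0.
    by apply: le_anti; move: lo hi; rewrite e1 e2 oppr_ge0 => -> ->.
  by move=> ->; rewrite mulr0 ler0n.
have coefE : (X%:R *: B - P)`_s = X%:R / s`!%:R - lead_coef P.
  by rewrite coefB coefZ -lcB /lead_coef szB -szP.
rewrite mulrC -ler_pdivlMr // -subr_ge0 -coefE leNgt; apply/negP => neg.
move: hi; rewrite /lead_coef.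
have -> : size (X%:R *: B - P)%R = s.+1.
  apply/eqP; rewrite eqn_leq; apply/andP; split.
    by apply: leq_trans (size_polyD _ _) _; rewrite geq_max szXB size_polyN -szP leqnn.
  by rewrite ltnNge; apply/negP => /leq_sizeP /(_ s (leqnn s)) e; rewrite e ltxx in neg.
by rewrite leNgt neg.
Qed.

(** * The multiplicity bound *)

Lemma ffact_prod_add D c : (0 < D)%N -> ((D.-1 + c) ^_ c)%N = (\prod_(i < c) (D + i))%N.
Proof.
move=> D_gt0; elim: c => [|c IH]; first by rewrite ffactn0 big_ord0.
by rewrite addnS ffactSS IH big_ord_recr /= mulnC -addSn prednK.
Qed.

Section Bound.
Variables (K : fieldType) (n : nat) (I : idealr {mpoly K[n]}).
Hypothesis charK : [pchar K] =i pred0.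
Hypothesis grI : graded_ideal I.
Hypothesis linI : componentwise_linear I.
Local Notation Im := (fun p : {mpoly K[n]} => p \in I).

Let gI : gideal Im.
Proof. by split; [exact: idealr_submodule | move=> d p; apply: grI]. Qed.

Let I1 : 1 \notin I.
Proof. by rewrite idealr1. Qed.

Section WithParameters.
Variables (c s D : nat) (A : 'M[K]_(n, c)) (B : 'M[K]_(n, s)).
Variables (C : 'M[K]_(c, n)) (L : 'M[K]_(s, n)).
Hypothesis co : coordinates A B C L.
Hypothesis L_inj : forall g, lsub L g \in I -> g = 0.
Hypothesis D_gt0 : (0 < D)%N.
Hypothesis high : forall e q, (D <= e)%N -> q \is e.-homog -> lsub_image A Im q.

Lemma params_growth : big_growth Im s.
Proof.
move=> [E hE].
have lo d : ('C(d + s, s) <= chilb Im d)%N.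
  case es: s => [|s'].
    rewrite bin0; apply: leq_trans (_ : chilb Im 0 <= _)%N; last exact: chilb_mono.
    rewrite /chilb big_ord1.
    have := indep_le_dim_mod (submod_ideal gI.1) (homog_spans (d:=0) (submod_ideal gI.1))
      (b := fun _ : unit => 1); rewrite card_unit; apply; first by move=> _; apply: dhomog1.
    move=> a; rewrite (bigD1 tt) //= big1 => [|[]//]; rewrite addr0 => Ia [].
    apply/eqP/negPn/negP => nz; case/negP: I1.
    have := submodZ (submod_ideal gI.1) (a tt)^-1 Ia.
    by rewrite scalerA mulVf // scale1r.
  elim: d => [|d IH].
    by rewrite add0n binn /chilb big_ord1 (leq_trans _ (hilb_ge gI L_inj es 0)) //
      add0n binn.
  rewrite chilbS addSn binS leq_add // -addSnnS.
  exact: (hilb_ge gI L_inj es d.+1).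
pose M := (s`! * E)%N.
have := hE M; have := bin_growth M s.
have := lo M; move: (chilb _ _) ('C(_, _)) => h b le1 le2 le3.
have : (M.+1 * M.+1 ^ s <= M * M.+1 ^ s)%N.
  rewrite {3}/M -mulnA; apply: leq_trans (_ : s`! * (M.+1 * h) <= _)%N.
    by rewrite mulnCA leq_mul2l (leq_trans le2) ?leq_mul2l ?le1 ?orbT.
  by rewrite leq_mul2l le3 orbT.
by rewrite leq_pmul2r ?ltnn // expn_gt0.
Qed.

Lemma params_krull : krull_dim {ideal_quot I} = s.
Proof.
apply: krull_dimE; first exact: tower_exists gI params_growth.
move=> l P tow; apply: (tower_length (X := #|{: 'X_{1..c < D}}|) gI.1 tow) => k.
exact: (spans_low_degree gI co high k).
Qed.

Lemma params_codim : codim I = c.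
Proof. by have [cs _ _ _ _] := co;
  rewrite /codim params_krull -[X in (X - s)%N]cs addnK. Qed.

Lemma params_multiplicity : multiplicity I <= 'C(D.-1 + c, c)%:R.
Proof.
rewrite /multiplicity params_krull; case es: s => [|s'] /=.
  rewrite ler_nat; apply: leq_trans (card_monomials_below c D_gt0).
  exact: (dim_mod_le (submod_ideal gI.1) (spans_all gI co high es)).
have [d0 d0P] : exists d0 : nat, forall d, (d0 <= d)%N ->
    (hilbert_poly I).[d%:R] = (hilbert_fun I d)%:R.
  exact: (epsilon_spec (inhabits 0) (fun P : {poly rat} => exists d0 : nat,
    forall d, (d0 <= d)%N -> P.[d%:R] = (hilbert_fun I d)%:R) (hilbert_poly_exists gI)).
apply: (lead_coef_squeeze (d0 := d0)) => d le_d; rewrite d0P //.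
by rewrite -natrM !ler_nat (hilb_ge gI L_inj es) (hilb_le gI co high es d D_gt0).
Qed.

End WithParameters.

Lemma multiplicity_le : multiplicity I <=
  ((codim I)`!%:R)^-1 * \prod_(1 <= i < (codim I).+1) (max_shift I i)%:~R.
Proof.
have nI1 : ~ (1 \in I) by apply/negP.
have [c [s [A [B [C [L [N [co hN L_inj]]]]]]]] := parameters_exist charK gI nI1.
have [_ _ CA _ _] := co.
have [D [D_gt0 high shifts]] := componentwise_linear_shifts gI I1 linI CA hN.
rewrite (params_codim co L_inj high).
apply: le_trans (params_multiplicity co L_inj D_gt0 high) _.
rewrite ler_pdivlMl ?ltr0n ?fact_gt0 // -natrM mulnC bin_ffact ffact_prod_add //.
rewrite big_add1 big_mkord natr_prod; apply: ler_prod => i _.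
rewrite ler0n /= pmulrn ler_int; exact: shifts.
Qed.

End Bound.

Theorem theorem3p7 (K : fieldType) (n : nat) (I : idealr {mpoly K[n]}) :
  [pchar K] =i pred0 ->
  graded_ideal I ->
  componentwise_linear I ->
  multiplicity I <=
    ((codim I)`!%:R)^-1 * \prod_(1 <= i < (codim I).+1) (max_shift I i)%:~R.
Proof. exact: multiplicity_le. Qed.
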